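(* Let $\alpha\in(0,\pi)$ and $\delta=\epsilon\log\frac1\epsilon$. 1. (Lower bound) Let $(\phi_\epsilon)_{\epsilon>0}$ be a family of functions in $H^1(-1,1)$ such that $\phi_\epsilon(-1)\in\{\alpha,-\alpha\}$ and $\phi_\epsilon(1)\in2\pi\mathbb{Z}\pm\alpha$ for all $\epsilon>0$, and such that $\phi_\epsilon\to\phi_0$ in $L^2(-1,1)$ for a simple $\phi_0\in\Phi$. Suppose that $(a,d)$ is the transition profile of $\phi_0$ and $N=\iota(\phi_0)$. Then $$E_\epsilon(\phi_\epsilon)\ge\frac{\eta(\phi_0)}{\log\frac1\delta}+\frac{\sum_{n=1}^Ne(d_n)+W(a,d)}{(\log\frac1\delta)^2}-o\left(\frac1{(\log\frac1\delta)^2}\right)\quad\text{as }\epsilon\searrow0.$$ 2. (Upper bound) If $\phi_0\in\Phi$ is simple with transition profile $(a,d)$ and if $N=\iota(\phi_0)$, then there exists a family $(\phi_\epsilon)_{\epsilon>0}$ in $H^1(-1,1)$ such that $\phi_\epsilon(-1)\in\{\alpha,-\alpha\}$ and $\phi_\epsilon(1)\in2\pi\mathbb{Z}\pm\alpha$ for all $\epsilon>0$, $\phi_\epsilon\to\phi_0$ in $L^2(-1,1)$, and $$E_\epsilon(\phi_\epsilon)\le\frac{\eta(\phi_0)}{\log\frac1\delta}+\frac{\sum_{n=1}^Ne(d_n)+W(a,d)}{(\log\frac1\delta)^2}+o\left(\frac1{(\log\frac1\delta)^2}\right)\quad\text{as }\epsilon\searrow0.$$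
   Context: For $m=(m_1,m_2)\in H^1((-1,1);\mathbb{S}^1)$ with $m_1(\pm1)=\cos\alpha$, extend $m_1$ to $\mathbb{R}$ by $\cos\alpha$ outside $(-1,1)$ and set $$E_\epsilon(m)=\frac\epsilon2\int_{-1}^1|m'|^2\,dx_1+\frac12\|m_1-\cos\alpha\|_{\dot H^{1/2}(\mathbb{R})}^2,\qquad \|f\|_{\dot H^{1/2}(\mathbb{R})}^2=\frac1{2\pi}\int_{-\infty}^\infty\int_{-\infty}^\infty\frac{(f(s)-f(t))^2}{(s-t)^2}\,ds\,dt.$$ For a lifting $\phi\in H^1(-1,1)$ write $E_\epsilon(\phi)=E_\epsilon(m)$ with $m=(\cos\phi,\sin\phi)$. For $N\in\mathbb{N}\cup\{0\}$ let $A_N=\{a\in(-1,1)^N:-1<a_1<\dots<a_N<1\}$. For $a\in A_N$, $d\in\{\pm1\}^N$ let $M(a,d)$ be the set of $m\in H^1((-1,1);\mathbb{S}^1)$ with $m_1(\pm1)=\cos\alpha$ and $m_1(a_n)=d_n$ for $n=1,\dots,N$; set $\gamma_n=d_n-\cos\alpha$ and $$W(a,d)=-\frac\pi2\sum_{n=1}^N\gamma_n^2\log(2-2a_n^2)-\frac\pi2\sum_{n=1}^N\sum_{k\ne n}\gamma_k\gamma_n\log\left(\frac{1+\sqrt{1-\varrho(a_k,a_n)^2}}{\varrho(a_k,a_n)}\right),\quad\varrho(b,c)=\frac{|b-c|}{1-bc},$$ with $W=0$ for $N=0$. The function $e:\{\pm1\}\to\mathbb{R}$ (depending only on $\alpha$):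 by an earlier theorem of Ignat and Moser there is a (unique) function $e$ such that for all $N\ge0$, $a\in A_N$, $d\in\{\pm1\}^N$, as $\epsilon\searrow0$, $$\inf_{M(a,d)}E_\epsilon=\frac{\pi\sum_{n=1}^N\gamma_n^2}{2\log\frac1\delta}+\frac{W(a,d)+\sum_{n=1}^Ne(d_n)}{(\log\frac1\delta)^2}+o\left(\frac1{(\log\frac1\delta)^2}\right).$$ This is the function $e$ in the claim. $\Phi=\{\phi\in\mathrm{BV}(-1,1):\phi(x_1)\in2\pi\mathbb{Z}\pm\alpha\text{ for almost all }x_1\in(-1,1)\}$. With $\boldsymbol\delta_b$ the Dirac measure at $b$, for every $\phi\in\Phi$ one has a representation $\phi'=\sum_{\ell=1}^L\sigma_\ell\boldsymbol\delta_{b_\ell}$ with $b_1\le\dots\le b_L$ in $(-1,1)$, $\sigma_\ell\in\{\pm2\alpha,\pm2(\pi-\alpha)\}$, and $|\sigma_{\ell-1}+\sigma_\ell|=2\pi$ whenever $b_{\ell-1}=b_\ell$; $\iota(\phi)=L$ and $\eta(\phi)=\frac\pi2\sum_{\ell=1}^L(1-\cos\frac{\sigma_\ell}2)^2$ (these depend only on $\phi$). $\phi\in\Phi$ is simple if $\phi'=\sum_{n=1}^N\omega_n\boldsymbol\delta_{a_n}$ for some $N\in\mathbb{N}\cup\{0\}$, $a\in A_N$, $\omega\in\{\pm2\alpha,\pm2(\pi-\alpha)\}^N$; then $N=\iota(\phi)$. Its transition profile is $(a,d)$ where, if $\alpha\ne\pi/2$, $d_n=1$ if $|\omega_n|=2\alpha$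 and $d_n=-1$ if $|\omega_n|=2\pi-2\alpha$; and if $\alpha=\pi/2$, $d_n=1$ if either $\lim_{x_1\nearrow a_n}\phi(x_1)\in2\pi\mathbb{Z}-\pi/2$ and $\omega_n=\pi$, or $\lim_{x_1\nearrow a_n}\phi(x_1)\in2\pi\mathbb{Z}+\pi/2$ and $\omega_n=-\pi$, and $d_n=-1$ otherwise.
   Formalization: Part 2 is proved only for φ_0 whose limit at −1 from the right is α or −α; without this it is false, e.g. for the constant φ_0=2π+α, since liftings starting at ±α then need an extra transition near −1 costing order 1/log(1/δ). *)

(* Defs.v *)
From HB Require Import structures.
From mathcomp Require Import all_boot all_order all_algebra.
From mathcomp Require Import all_classical all_reals all_analysis.

Set Implicit Arguments.
Unset Strict Implicit.
Unset Printing Implicit Defensive.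

Import Order.TTheory GRing.Theory Num.Theory.
Import numFieldNormedType.Exports.

Local Open Scope classical_set_scope.
Local Open Scope ring_scope.

(* Functions on (-1, 1) are represented by total functions R -> R whose values
   outside [-1, 1] are irrelevant. *)

Section FunctionSpaces.
Context {R : realType}.
Local Notation mu := (@lebesgue_measure R).

Definition Iopen : set R := `]-1, 1[.
Definition Iclosed : set R := `[-1, 1].

Definition L2norm (f : R -> R) : \bar R :=
  Lnorm mu 2%:E (fun x => ((f \_ Iopen) x)%:E).

Definition L2 (f : R -> R) : Prop :=
  measurable_fun Iopen f /\ (L2norm f < +oo)%E.

Definition test_function (psi : R -> R) : Prop :=
  (forall n x, derivable (derive1n n psi) x 1) /\
  exists K : set R, [/\ compact K, K `<=` Iopen & forall x, ~ K x -> psi x = 0].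

(* The distributional derivative of f on (-1, 1) is the functional T; f is
   expected to be integrable on (-1, 1). *)
Definition distributional_derivative (f : R -> R) (T : (R -> R) -> R) : Prop :=
  forall psi, test_function psi ->
    (\int[mu]_(x in Iopen) (f x * derive1 psi x))%R = - T psi.

Definition weak_derivative (f g : R -> R) : Prop :=
  L2 g /\
  distributional_derivative f (fun psi => \int[mu]_(x in Iopen) (g x * psi x))%R.

(* H^1(-1, 1), each class being represented by its continuous representative on
   [-1, 1], so that point values, including those at -1 and 1, make sense. *)
Definition H1 (f : R -> R) : Prop :=
  [/\ {within Iclosed, continuous f}, L2 f & exists g, weak_derivative f g].

(* A choice of weak derivative, unique up to null sets. *)
Definition wderiv (f : R -> R) : R -> R :=
  xget (fun=> 0) [set g | weak_derivative f g].

Definition BV (f : R -> R) : Prop :=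
  mu.-integrable Iopen (EFin \o f) /\
  exists C : R, forall psi, test_function psi -> (forall x, `|psi x| <= 1) ->
    (\int[mu]_(x in Iopen) (f x * derive1 psi x))%R <= C.

(* f' = \sum_l sigma_l delta_(b_l) as distributions on (-1, 1). *)
Definition derivative_is_dirac_sum (f : R -> R) (L : nat)
    (b sigma : 'I_L -> R) : Prop :=
  distributional_derivative f (fun psi => \sum_(l < L) sigma l * psi (b l)).

(* One-sided limits of a function defined up to null sets. *)
Definition left_limit (f : R -> R) (a l : R) : Prop :=
  forall k : R, 0 < k -> exists2 h : R, 0 < h &
    {ae mu, forall x, a - h < x < a -> `|f x - l| < k}.

Definition right_limit (f : R -> R) (a l : R) : Prop :=
  forall k : R, 0 < k -> exists2 h : R, 0 < h &
    {ae mu, forall x, a < x < a + h -> `|f x - l| < k}.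

Definition L2_converges (phi : R -> R -> R) (phi0 : R -> R) : Prop :=
  L2norm (fun x => phi eps x - phi0 x) @[eps --> (0 : R)^'+] --> 0%E.

End FunctionSpaces.

Section Energy.
Context {R : realType}.
Local Notation mu := (@lebesgue_measure R).

Definition sqr_seminorm_Hhalf (f : R -> R) : \bar R :=
  (((2 * pi)^-1)%:E *
   \int[mu]_s \int[mu]_t ((f s - f t) ^+ 2 / (s - t) ^+ 2)%:E)%E.

(* m_1 - cos alpha on the real line, m_1 being extended by cos alpha. *)
Definition excess (alpha : R) (m1 : R -> R) (x : R) : R :=
  if -1 < x < 1 then m1 x - cos alpha else 0.

Definition energy (alpha eps : R) (m1 m2 : R -> R) : \bar R :=
  ((eps / 2)%:E *
     \int[mu]_(x in Iopen) ((wderiv m1 x) ^+ 2 + (wderiv m2 x) ^+ 2)%:E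
   + (2^-1)%:E * sqr_seminorm_Hhalf (excess alpha m1))%E.

Definition energy_lift (alpha eps : R) (phi : R -> R) : \bar R :=
  energy alpha eps (cos \o phi) (sin \o phi).

Definition H1_circle (m1 m2 : R -> R) : Prop :=
  [/\ H1 m1, H1 m2 & forall x, Iclosed x -> m1 x ^+ 2 + m2 x ^+ 2 = 1].

Definition ordered_points (N : nat) (a : 'I_N -> R) : Prop :=
  (forall n, -1 < a n < 1) /\ (forall i j : 'I_N, (i < j)%N -> a i < a j).

(* The set {1, -1} is encoded by bool, with true for 1 and false for -1. *)
Definition pm (b : bool) : R := if b then 1 else -1.

Definition admissible (alpha : R) (N : nat) (a : 'I_N -> R) (d : 'I_N -> bool)
    (m : (R -> R) * (R -> R)) : Prop :=
  [/\ H1_circle m.1 m.2, m.1 (-1) = cos alpha, m.1 1 = cos alpha &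
      forall n, m.1 (a n) = pm (d n)].

Definition inf_energy (alpha eps : R) (N : nat) (a : 'I_N -> R)
    (d : 'I_N -> bool) : \bar R :=
  ereal_inf [set energy alpha eps m.1 m.2 | m in admissible alpha a d].

Definition gamma (alpha : R) (b : bool) : R := pm b - cos alpha.

Definition varrho (b c : R) : R := `|b - c| / (1 - b * c).

Definition W (alpha : R) (N : nat) (a : 'I_N -> R) (d : 'I_N -> bool) : R :=
  - (pi / 2) * (\sum_(n < N) gamma alpha (d n) ^+ 2 * ln (2 - 2 * a n ^+ 2))
  - (pi / 2) * (\sum_(n < N) \sum_(k < N | k != n)
      gamma alpha (d k) * gamma alpha (d n) *
      ln ((1 + Num.sqrt (1 - varrho (a k) (a n) ^+ 2)) / varrho (a k) (a n))).

Definition delta (eps : R) : R := eps * ln (1 / eps).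

Definition logdelta (eps : R) : R := ln (1 / delta eps).

(* r(eps) = o(1 / (log (1 / delta))^2) as eps decreases to 0. *)
Definition remainder (r : R -> R) : Prop :=
  (r : R -> R^o) =o_ ((0 : R)^'+) ((fun eps => 1 / logdelta eps ^+ 2) : R -> R^o).

(* Existence and uniqueness of such an e are due to Ignat and Moser. *)
Definition core_energy (alpha : R) (e : bool -> R) : Prop :=
  forall (N : nat) (a : 'I_N -> R) (d : 'I_N -> bool), ordered_points a ->
  exists2 r : R -> R, remainder r &
    \forall eps \near (0 : R)^'+,
      inf_energy alpha eps a d =
      (pi * (\sum_(n < N) gamma alpha (d n) ^+ 2) / (2 * logdelta eps)
       + (W alpha a d + \sum_(n < N) e (d n)) / logdelta eps ^+ 2
       + r eps)%:E.

End Energy.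

Section Limits.
Context {R : realType}.
Local Notation mu := (@lebesgue_measure R).

(* y \in 2 pi Z + c *)
Definition in_2piZ_plus (c y : R) : Prop := exists k : int, y = 2 * pi * k%:~R + c.

Definition in_2piZ_pm (alpha y : R) : Prop :=
  in_2piZ_plus alpha y \/ in_2piZ_plus (- alpha) y.

Definition Phi (alpha : R) (phi : R -> R) : Prop :=
  BV phi /\ {ae mu, forall x, Iopen x -> in_2piZ_pm alpha (phi x)}.

Definition jump_size (alpha s : R) : Prop :=
  `|s| = 2 * alpha \/ `|s| = 2 * (pi - alpha).

Definition jump_representation (alpha : R) (phi : R -> R) (L : nat)
    (b sigma : 'I_L -> R) : Prop :=
  derivative_is_dirac_sum phi b sigma /\
  [/\ forall l, -1 < b l < 1,
      forall i j : 'I_L, (i <= j)%N -> b i <= b j,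
      forall l, jump_size alpha (sigma l) &
      forall i j : 'I_L, j = i.+1 :> nat -> b i = b j ->
        `|sigma i + sigma j| = 2 * pi].

(* For phi in Phi, the sets below are singletons. *)
Definition iota_jumps (alpha : R) (phi : R -> R) : nat :=
  xget 0%N [set L | exists b sigma : 'I_L -> R,
                      jump_representation alpha phi b sigma].

Definition eta_jumps (alpha : R) (phi : R -> R) : R :=
  xget 0 [set v | exists (L : nat) (b sigma : 'I_L -> R),
    jump_representation alpha phi b sigma /\
    v = pi / 2 * \sum_(l < L) (1 - cos (sigma l / 2)) ^+ 2].

Definition simple_representation (alpha : R) (phi : R -> R) (N : nat)
    (a omega : 'I_N -> R) : Prop :=
  [/\ ordered_points a, forall n, jump_size alpha (omega n) &
      derivative_is_dirac_sum phi a omega].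

Definition simple (alpha : R) (phi : R -> R) : Prop :=
  Phi alpha phi /\
  exists (N : nat) (a omega : 'I_N -> R), simple_representation alpha phi a omega.

(* For alpha = pi / 2: phi jumps at the point c, with jump w, through 2 pi Z. *)
Definition positive_jump (phi : R -> R) (c w : R) : Prop :=
  (exists2 l, left_limit phi c l & in_2piZ_plus (- (pi / 2)) l) /\ w = pi \/
  (exists2 l, left_limit phi c l & in_2piZ_plus (pi / 2) l) /\ w = - pi.

Definition transition_profile (alpha : R) (phi : R -> R) (N : nat)
    (a : 'I_N -> R) (d : 'I_N -> bool) : Prop :=
  exists2 omega : 'I_N -> R, simple_representation alpha phi a omega &
    (alpha <> pi / 2 -> forall n,
       (`|omega n| = 2 * alpha -> d n = true) /\
       (`|omega n| = 2 * pi - 2 * alpha -> d n = false)) /\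
    (alpha = pi / 2 -> forall n,
       (positive_jump phi (a n) (omega n) -> d n = true) /\
       (~ positive_jump phi (a n) (omega n) -> d n = false)).

Definition admissible_family (alpha : R) (phi : R -> R -> R) : Prop :=
  forall eps, 0 < eps ->
    [/\ H1 (phi eps),
        phi eps (-1) = alpha \/ phi eps (-1) = - alpha &
        in_2piZ_pm alpha (phi eps 1)].

(* Liftings starting at alpha or -alpha fix the additive constant in 2 pi Z.
   This is the same normalisation for phi in Phi. A simple phi violating it
   cannot be approximated by such liftings without further transitions near -1,
   whose energy is of order 1 / log (1 / delta) at least. *)
Definition normalised_start (alpha : R) (phi : R -> R) : Prop :=
  right_limit phi (-1) alpha \/ right_limit phi (-1) (- alpha).

End Limits.

(* Main.v *)
Require Import Defs.
From HB Require Import structures.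
From mathcomp Require Import all_boot all_order all_algebra.
From mathcomp Require Import all_classical all_reals all_analysis.
From mathcomp Require Import measurable_realfun ring lra.

Set Implicit Arguments.
Unset Strict Implicit.
Unset Printing Implicit Defensive.

Import Order.TTheory GRing.Theory Num.Theory.
Import numFieldNormedType.Exports.

Local Open Scope classical_set_scope.
Local Open Scope ring_scope.

(** The expansion of the infimum of the energy is given for competitors with
    prescribed nodes a_n, at which m_1 = d_n. The theorem transfers it to
    liftings that approximate a jump function with transition profile (a, d).
    Below, l stands for log (1 / delta) and f for m_1 - cos alpha.

    A simple phi0 is almost everywhere a step function [step_ae]. Its values
    before and after a jump have the same cosine, so half way up the jump lies a
    multiple of pi, whose cosine is the sign d_n of the transition
    [jump_geometry, profile_step]. Hence eta(phi0) is pi / 2 times the sum of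
    the squares of the gamma_n, the leading coefficient of the expansion
    [eta_jumps_simple]. Liftings phi are compared with theta = acos (cos phi),
    which has the same f and not more exchange energy [circle_fold].

    Lower bound. Since phi_eps is continuous and close to phi0, it attains the
    value half way up the n-th jump at a point b_n that tends to a_n [crossing].
    So theta is a competitor, but for the nodes b rather than a. Composition
    with a diffeomorphism psi of [-1, 1] that maps a_n to b_n repairs this. It
    multiplies the exchange energy by a factor close to 1. It turns the kernel 1
    / (s - t)^2 into 1 / (u - v)^2 + k(u, v), where k is bounded, and small when
    psi is close to the identity. As the integral of k(u, v) in v is exactly
    what compensates the change of the interaction with the exterior of (-1, 1),
    the seminorm changes only by an integral of k(u, v) against the product of
    the deformed f at u and v [seminorm_transform], hence by a small multiple of
    the square of the integral of |f| [moved_nodes_energy]. These errors are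
    o(1/l^2) provided that the exchange energy and the square of the integral of
    |f| are O(1/l^2), which need only be shown when the energy is below its
    asserted lower bound [dissipation]. To see this, use deformations close to u
    + kappa (u - u^3) instead. Their kernel defect is bounded above by a
    negative constant, so for f of one sign the seminorm decreases by a multiple
    of the square of the integral of |f| [contracted_nodes_energy]. This applies
    to the minimum and to the maximum of theta and alpha, which keep the nodes
    with d_n = 1 and with d_n = -1, respectively, and whose energies add up to
    at most that of theta [half_seminorm_split]. If moreover eps is replaced by
    eps / 4, then a part of the exchange energy remains unused. As this changes
    l by a bounded amount only, the terms of order 1/l cancel, and what remains
    is O(1/l^2).

    Upper bound. Given an almost minimal m for the nodes a, and theta = acos
    m_1, the difference theta - alpha is added to the step function phi0 with a
    sign that changes at every node. Then the jumps cancel, and the result is a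
    lifting of the same energy [recovery]. Its distance to phi0 is that of theta
    to alpha, which the nonlocal energy controls [lifting_distance].

    H^1 functions are treated as primitives [prim], by way of the lemma of du
    Bois-Reymond [du_bois_reymond]. *)

(** * Smooth functions and bumps *)

Section Smooth.
Context {R : realType}.
Implicit Types f g : R -> R.

(** A recursive form of n-fold differentiability that suits induction on n. *)
Fixpoint diff_times (n : nat) f : Prop :=
  if n is n'.+1 then
    exists f' : R -> R, (forall x : R, is_derive x (1 : R) f (f' x)) /\ diff_times n' f'
  else True.

Definition smooth f := forall n, diff_times n f.

Lemma is_derive_derive1 f f' : (forall x : R, is_derive x (1 : R) f (f' x)) ->
  derive1 f = f'.
Proof. by move=> h; apply/funext => x; rewrite derive1E; case: (h x). Qed.

Lemma diff_timesW n f : diff_times n.+1 f -> diff_times n f.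
Proof.
elim: n f => [|n IH] f; first by [].
by move=> [f' [df h]]; exists f'; split; [exact: df | exact: IH].
Qed.

Lemma smooth_derivable1n f : smooth f ->
  forall n x, derivable (derive1n n f) x 1.
Proof.
move=> sf n; have := sf n.+1; elim: n f {sf} => [|n IH] f [f' [df h]] x.
  by case: (df x).
by rewrite derive1Sn (is_derive_derive1 df); apply: IH.
Qed.

Lemma derivable1n_smooth f :
  (forall n x, derivable (derive1n n f) x 1) -> smooth f.
Proof.
move=> df n; elim: n f df => [|n IH] f df; first by [].
exists (derive1 f); split.
  by move=> x; rewrite derive1E; apply/derivableP; exact: (df 0%N).
by apply: IH => k x; have := df k.+1 x; rewrite derive1Sn.
Qed.

Lemma diff_timesD n f g : diff_times n f -> diff_times n g ->
  diff_times n (f \+ g).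
Proof.
elim: n f g => [|n IH] f g; first by [].
move=> [f' [df hf]] [g' [dg hg]]; exists (f' \+ g'); split.
  by move=> x; exact: is_deriveD.
exact: IH.
Qed.

Lemma diff_timesM n f g : diff_times n f -> diff_times n g ->
  diff_times n (f \* g).
Proof.
elim: n f g => [|n IH] f g hf hg; first by [].
have [f' [df hf']] := hf; have [g' [dg hg']] := hg.
exists ((f \* g') \+ (g \* f')); split.
  by move=> x; have := is_deriveM (df x) (dg x).
by apply: diff_timesD; apply: IH; try assumption; apply: diff_timesW.
Qed.

Lemma diff_times_cst n (c : R) : diff_times n (cst c).
Proof.
elim: n c => [|n IH] c; first by [].
by exists (cst 0); split; [move=> x; exact: is_derive_cst | exact: IH].
Qed.

Lemma is_derive_affine (a b x : R) : is_derive x (1 : R) (fun x : R => a * x + b) a.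
Proof.
have h := is_deriveD (is_deriveZ a (is_derive_id x (1:R))) (is_derive_cst b x (1:R)).
by apply: is_derive_eq; rewrite addr0 /GRing.scale /= mulr1.
Qed.

Lemma diff_times_affine n f (a b : R) : diff_times n f ->
  diff_times n (fun x => f (a * x + b)).
Proof.
elim: n f => [|n IH] f; first by [].
move=> [f' [df hf]]; exists (fun x => f' (a * x + b) * a); split.
  move=> x; apply: (@is_derive1_comp _ f (fun x => a * x + b)).
  exact: is_derive_affine.
apply: (@diff_timesM n (fun x => f' (a * x + b)) (cst a)).
  exact: IH.
exact: diff_times_cst.
Qed.

(** For flat functions at the origin, where a quadratic estimate is at hand. *)
Lemma is_derive_quad f (x l C : R) : 0 <= C ->
  (forall h, `|h| <= 1 -> `|f (x + h) - f x - l * h| <= C * `|h| ^+ 2) ->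
  is_derive x (1 : R) f l.
Proof.
move=> C0 hf.
have h : h^-1 *: ((f \o shift x) (h *: (1 : R)) - f x) @[h --> 0^'] --> l.
  apply/cvgrPdist_le => e e0.
  near=> h.
  have h0 : h != 0 by near: h; exact: nbhs_dnbhs_neq.
  have h1 : `|h| <= 1 by near: h; apply: dnbhs0_le.
  have he : `|h| <= e / (C + 1).
    by near: h; apply: dnbhs0_le; rewrite divr_gt0// ltr_wpDl.
  have -> : l - h^-1 *: ((f \o shift x) (h *: (1 : R)) - f x) =
      - (h^-1 * (f (x + h) - f x - l * h)).
    by rewrite /GRing.scale/= mulr1 (addrC h); field.
  rewrite normrN normrM normfV -ler_pdivlMl ?invr_gt0 ?normr_gt0// invrK.
  apply: (le_trans (hf _ h1)); rewrite expr2 mulrA mulrC; apply: ler_wpM2l => //.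
  apply: le_trans (_ : (C + 1) * (e / (C + 1)) <= _).
    by apply: ler_pM => //; rewrite lerDl.
  by rewrite mulrCA divff ?mulr1// gt_eqF// ltr_wpDl.
apply: DeriveDef; first by apply/cvg_ex; exists l.
exact/cvg_lim.
Unshelve. all: by end_near. Qed.

Lemma poly_expRN_bounded (p : {poly R}) :
  exists2 C : R, 0 <= C & forall t, 1 <= t -> `|p.[t]| * expR (- t) <= C.
Proof.
exists ((\sum_(i < size p) `|p`_i|) * (size p)`!%:R).
  by rewrite mulr_ge0 ?ler0n// sumr_ge0.
move=> t t1; have t0 : 0 <= t by apply: le_trans t1.
have fp : 0 < (size p)`!%:R :> R by rewrite ltr0n fact_gt0.
rewrite expRN -ler_pdivlMr ?invr_gt0 ?expR_gt0// invrK.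
have h1 : `|p.[t]| <= (\sum_(i < size p) `|p`_i|) * t ^+ size p.
  rewrite horner_coef mulr_suml; apply: (le_trans (ler_norm_sum _ _ _)).
  apply: ler_sum => i _; rewrite normrM; apply: ler_wpM2l => //.
  by rewrite ger0_norm ?exprn_ge0// ler_weXn2l// ltnW.
apply: (le_trans h1); rewrite -mulrA; apply: ler_wpM2l; first by rewrite sumr_ge0.
have [->|] := eqVneq (size p) 0%N.
  by rewrite expr0 mul1r; have := expR_ge1Dx t; lra.
case: (size p) fp => // n fp _; have h := expR_ge1Dxn n t0.
rewrite mulrC -ler_pdivrMr//; apply: le_trans h.
by rewrite lerDr.
Qed.

(** Derivatives of exp(-1/x) keep the form p(1/x) exp(-1/x), which is why a
    polynomial factor is carried along. *)
Definition flat_poly (p : {poly R}) (x : R) : R :=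
  if 0 < x then p.[x^-1] * expR (- x^-1) else 0.

(** The exponential beats the polynomial p(t) t^2, where t = 1/x. *)
Lemma flat_poly_small (p : {poly R}) :
  exists2 C : R, 0 <= C & forall x, `|x| <= 1 -> `|flat_poly p x| <= C * `|x| ^+ 2.
Proof.
have [C C0 hC] := poly_expRN_bounded (p * 'X^2).
exists C => // x x1; rewrite /flat_poly; case: ifPn => x0; last first.
  by rewrite normr0 mulr_ge0// sqr_ge0.
have xi : 1 <= x^-1 by rewrite invf_ge1// -(gtr0_norm x0).
have := hC _ xi; rewrite hornerM hornerXn !normrM.
rewrite normfV (gtr0_norm (expR_gt0 _)) (gtr0_norm x0).
rewrite -ler_pdivrMr ?exprn_gt0// expr2 invfM.
by congr (_ <= _); ring.
Qed.

Lemma is_derive_flat_poly (p : {poly R}) (x : R) :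
  is_derive x (1 : R) (flat_poly p) (flat_poly ('X ^+ 2 * (p - p^`())) x).
Proof.
have [x0|x0|x0] := ltgtP 0 x.
- have h : is_derive x (1 : R) (fun x => p.[x^-1] * expR (- x^-1))
      (flat_poly ('X ^+ 2 * (p - p^`())) x).
    have dv : is_derive x (1 : R) (fun x : R => x^-1) (- x ^- 2).
      have := @is_deriveV _ id x 1 1 (lt0r_neq0 x0) (is_derive_id _ _).
      by rewrite /GRing.scale/= mulr1.
    have d1 := @is_derive1_comp _ (horner p) _ _ _ _ (is_derive_poly p x^-1) dv.
    have d2 := @is_derive1_comp _ expR _ _ _ _ (is_derive_expR ((- (fun x : R => x^-1)) x))
        (@is_deriveN _ _ _ _ _ _ _ dv).
    have := is_deriveM d1 d2; rewrite /= => d3; apply: (is_derive_eq d3).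
    rewrite /flat_poly x0 /GRing.scale/= hornerM hornerXn hornerD hornerN opprK exprVn.
    by ring.
  apply: near_eq_is_derive h.
  by near=> y; rewrite /flat_poly ifT//; near: y; exact: lt_nbhsr.
- have -> : flat_poly ('X ^+ 2 * (p - p^`())) x = 0 by rewrite /flat_poly ltNge ltW.
  have h := is_derive_cst (0 : R) x (1 : R).
  apply: near_eq_is_derive h.
  by near=> y; rewrite /flat_poly ifF//; apply/negbTE; rewrite -leNgt ltW//; near: y; exact:
      lt_nbhsl.
- have -> : flat_poly ('X ^+ 2 * (p - p^`())) x = 0 by rewrite /flat_poly -x0 ltxx.
  have [C C0 hC] := flat_poly_small p.
  apply: (@is_derive_quad _ _ _ C C0) => h h1.
  rewrite mul0r subr0 -x0 add0r [flat_poly p 0]/flat_poly ltxx subr0.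
  exact: hC.
Unshelve. all: by end_near. Qed.

Lemma smooth_flat_poly (p : {poly R}) : smooth (flat_poly p).
Proof.
move=> n; elim: n p => [|n IH] p; first by [].
exists (flat_poly ('X ^+ 2 * (p - p^`()))).
by split; [exact: is_derive_flat_poly | exact: IH].
Qed.

Definition flat := flat_poly 1.

Lemma flatE x : flat x = if 0 < x then expR (- x^-1) else 0.
Proof. by rewrite /flat /flat_poly hornerC mul1r. Qed.

Lemma flat_ge0 x : 0 <= flat x.
Proof. by rewrite flatE; case: ifP => // _; exact: expR_ge0. Qed.

Lemma flat_le1 x : flat x <= 1.
Proof.
by rewrite flatE; case: ifP => // x0; rewrite -expR0 ler_expR oppr_le0 invr_ge0 ltW.
Qed.

Lemma flat_gt0 x : (0 < flat x) = (0 < x).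
Proof. by rewrite flatE; case: ifP => //; rewrite ?expR_gt0 ?ltxx. Qed.

Lemma flat_eq0 x : x <= 0 -> flat x = 0.
Proof. by rewrite flatE leNgt => /negbTE ->. Qed.

Lemma cvg_flat x : 0 < x -> flat (n.+1%:R * x) @[n --> \oo] --> (1 : R).
Proof.
move=> x0.
have -> : (fun n => flat (n.+1%:R * x)) = (fun n => expR (- (x^-1 * n.+1%:R^-1))).
  by apply/funext => n; rewrite flatE ifT ?mulr_gt0// invfM mulrC.
rewrite -[X in _ --> X]expR0; apply: cvg_comp; last exact: continuous_expR.
rewrite -oppr0 -(mulr0 x^-1); apply: cvgN; apply: cvgM; first exact: cvg_cst.
exact: cvg_harmonic.
Qed.

(** With large c this is a smooth approximation from below of the indicator
    function of ]a, b[. *)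
Definition bump (a b c : R) (x : R) := flat (c * (x - a)) * flat (c * (b - x)).

Lemma smooth_bump a b c : smooth (bump a b c).
Proof.
move=> n; apply: diff_timesM.
- have -> : (fun x => flat (c * (x - a))) = (fun x => flat (c * x + - (c * a))).
    by apply/funext => x; rewrite mulrBr.
  by apply: diff_times_affine; exact: smooth_flat_poly.
- have -> : (fun x => flat (c * (b - x))) = (fun x => flat ((- c) * x + c * b)).
    by apply/funext => x; rewrite mulrBr mulNr addrC.
  by apply: diff_times_affine; exact: smooth_flat_poly.
Qed.

Lemma bump_ge0 a b c x : 0 <= bump a b c x.
Proof. by rewrite mulr_ge0 ?flat_ge0. Qed.

Lemma bump_le1 a b c x : bump a b c x <= 1.
Proof. by rewrite mulr_ile1 ?flat_ge0 ?flat_le1. Qed.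

Lemma bump_out a b c x : 0 < c -> ~ (a < x < b) -> bump a b c x = 0.
Proof.
move=> c0 /negP; rewrite negb_and -!leNgt => /orP[xa|bx].
  by rewrite /bump flat_eq0 ?mul0r// pmulr_rle0// subr_le0.
by rewrite /bump [X in _ * X]flat_eq0 ?mulr0// pmulr_rle0// subr_le0.
Qed.

Lemma bump_gt0 a b c x : 0 < c -> a < x < b -> 0 < bump a b c x.
Proof.
by move=> c0 /andP[ax xb]; rewrite mulr_gt0// flat_gt0 mulr_gt0// subr_gt0.
Qed.

Lemma cvg_bump a b x : a < x < b -> bump a b n.+1%:R x @[n --> \oo] --> (1 : R).
Proof.
move=> /andP[ax xb]; rewrite -[X in _ --> X](mulr1 (1 : R)).
by apply: cvgM; apply: cvg_flat; rewrite subr_gt0.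
Qed.

Lemma smooth_continuous f : smooth f -> continuous f.
Proof.
move=> sf x; have [f' [df _]] := sf 1%N.
by apply: differentiable_continuous; apply/derivable1_diffP; case: (df x).
Qed.

Lemma IopenE (x : R) : Iopen x = (-1 < x < 1) :> Prop.
Proof. by rewrite /Iopen /= in_itv. Qed.

Lemma smooth_test_function f a b : smooth f -> -1 < a -> b < 1 ->
  (forall x, ~ (a <= x <= b) -> f x = 0) -> test_function f.
Proof.
move=> sf a1 b1 f0; split; first exact: smooth_derivable1n.
exists `[a, b]%classic; split.
- exact: segment_compact.
- move=> x /=; rewrite IopenE in_itv/= => /andP[ax xb].
  by rewrite (lt_le_trans a1 ax) (le_lt_trans xb b1).
- by move=> x h; apply: f0 => h'; apply: h; rewrite /= in_itv.
Qed.

Lemma smooth_derive1 f : smooth f -> smooth (derive1 f).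
Proof.
move=> sf n; have [f' [df h]] := sf n.+1.
by rewrite (is_derive_derive1 df).
Qed.

Lemma smooth_is_derive f x : smooth f -> is_derive x (1 : R) f (derive1 f x).
Proof.
by move=> sf; have [f' [df _]] := sf 1%N; rewrite (is_derive_derive1 df).
Qed.

Lemma test_function_smooth f : test_function f -> smooth f.
Proof. by move=> [df _]; exact: derivable1n_smooth. Qed.

End Smooth.

(** * The lemma of du Bois-Reymond *)

Section DuBoisReymond.
Context {R : realType}.
Implicit Types f g : R -> R.
Local Notation mu := (@lebesgue_measure R).
Local Notation meas D f := (@measurable_fun _ _ (measurableTypeR R) R D f).

Definition intI f := mu.-integrable Iopen (EFin \o f).

Lemma measurable_Iopen : measurable (@Iopen R : set (measurableTypeR R)).
Proof. exact: measurable_itv. Qed.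

Lemma aeS (P Q : R -> Prop) : (forall x, P x -> Q x) ->
  {ae mu, forall x, P x} -> {ae mu, forall x, Q x}.
Proof. by apply: filterS; exact: (ae_filter_ringOfSetsType mu). Qed.

Lemma aeS2 (P Q S : R -> Prop) : (forall x, P x -> Q x -> S x) ->
  {ae mu, forall x, P x} -> {ae mu, forall x, Q x} -> {ae mu, forall x, S x}.
Proof. by apply: filterS2; exact: (ae_filter_ringOfSetsType mu). Qed.

Lemma integrable_continuous f a b : continuous f ->
  mu.-integrable `[a, b] (EFin \o f).
Proof.
move=> cf; apply: continuous_compact_integrable; first exact: segment_compact.
exact: continuous_subspaceT.
Qed.

Lemma integrable_continuous_support f a b : continuous f ->
  (forall x, ~ (a <= x <= b) -> f x = 0) -> mu.-integrable setT (EFin \o f).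
Proof.
move=> cf f0.
have -> : EFin \o f = (EFin \o f) \_ `[a, b].
  apply/funext => x; rewrite patchE; case: ifPn => //.
  by rewrite notin_setE /= in_itv/= => h; rewrite f0.
rewrite -integrable_mkcond; last exact: measurable_itv.
exact: integrable_continuous.
Qed.

(** The source of test functions with a prescribed derivative: if the integral of
    f vanishes, then F has compact support. *)
Lemma smooth_primitive f a b : smooth f ->
  (forall x, ~ (a <= x <= b) -> f x = 0) ->
  let F x := \int[mu]_(t in `]-oo, x]) f t in
  [/\ forall x, is_derive x (1 : R) F (f x), forall x, x < a -> F x = 0 &
      forall x, b < x -> F x = \int[mu]_t f t].
Proof.
move=> sf f0 F.
have fi := integrable_continuous_support (smooth_continuous sf) f0.
split.
- move=> x.
  have xx1 : x < x + 1 by rewrite ltrDl.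
  have [] := @continuous_FTC1 R f -oo%O x (x + 1) xx1 _ _ (@smooth_continuous R f sf x).
  + exact: integrableS fi.
  + by rewrite ltNyr.
  by move=> dF F'; split; [exact: dF | rewrite -F' derive1E].
- move=> x xa; rewrite /F (_ : \int[mu]_(t in _) f t = \int[mu]_(t in `]-oo, x]) 0).
    by rewrite Rintegral_cst ?mul0r.
  apply: eq_Rintegral => t; rewrite inE/= in_itv/= => tx; apply: f0.
  by move=> /andP[at_ _]; have := le_lt_trans (le_trans at_ tx) xa; rewrite ltxx.
- move=> x bx; rewrite /F Rintegral_mkcond; apply: eq_Rintegral => t _.
  rewrite patchE; case: ifPn => //; rewrite notin_setE /= in_itv/= => /negP.
  by rewrite -ltNge => xt; rewrite f0// => /andP[_ tb]; have := le_lt_trans tb (lt_trans bx xt);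
      rewrite ltxx.
Qed.

Lemma intIM_bounded f g (M : R) : intI f -> meas Iopen g ->
  (forall x, Iopen x -> `|g x| <= M) -> intI (f \* g).
Proof.
move=> fi mg gM.
apply: (@integrableMl _ _ R mu _ measurable_Iopen (EFin \o f) g) => //; exists M; split; first
    exact: num_real.
by move=> m Mm x Ix; exact: le_trans (gM x Ix) (ltW Mm).
Qed.

Lemma continuous_meas f (D : set R) : measurable (D : set (measurableTypeR R)) ->
  continuous f -> meas D f.
Proof. by move=> mD cf; apply: measurable_funTS; exact: continuous_measurable_fun. Qed.

Lemma itv_oo_Iopen (x y : R) : -1 <= x -> y <= 1 -> `]x, y[ `<=` Iopen.
Proof.
move=> x1 y1 t /=; rewrite IopenE in_itv/= => /andP[xt ty].
by rewrite (le_lt_trans x1 xt) (lt_le_trans ty y1).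
Qed.

(** The indefinite integral is locally constant on (-1, 1), and by Lebesgue's
    theorem its derivative is f almost everywhere. *)
Lemma itv_vanishing_ae f : intI f ->
  (forall x y, -1 < x -> x < y -> y < 1 -> \int[mu]_(t in `]x, y[) f t = 0) ->
  {ae mu, forall x, Iopen x -> f x = 0}.
Proof.
move=> fi f0.
have mI := measurable_Iopen.
have fT : mu.-integrable setT (EFin \o (f \_ Iopen)).
  rewrite (_ : EFin \o _ = (EFin \o f) \_ Iopen); last by rewrite restrict_EFin.
  by rewrite -integrable_mkcond.
have fy y : mu.-integrable `]-oo, y] (EFin \o (f \_ Iopen)) by exact: integrableS fT.
have := @FTC1Ny R (f \_ Iopen) fy
  (open_integrable_locally openT fT).
set F := fun x => _.
apply: aeS => x /= [dF F'] Ix; have : (f \_ Iopen) x = f x by rewrite patchE mem_set.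
rewrite -F' => <-.
have Fc y z : -1 < y -> y < z -> z < 1 -> F z = F y.
  move=> y1 yz z1; apply/eqP; rewrite -subr_eq0 /F Rintegral_itvB//; last by rewrite bnd_simp ltW.
  rewrite -Rintegral_itv_bndo_bndc; last first.
    exact: integrableS fT.
  rewrite -(f0 y z)//; apply/eqP; apply: eq_Rintegral => t; rewrite inE => /itv_oo_Iopen It.
  by rewrite patchE mem_set//; apply: It; exact: ltW.
have [x1 x2] : -1 < x /\ x < 1 by move: Ix; rewrite IopenE => /andP.
have : is_derive x (1 : R) F 0.
  have h := is_derive_cst (F x) x (1 : R).
  apply: near_eq_is_derive h; near=> y.
  have y1 : -1 < y by near: y; exact: lt_nbhsr.
  have y2 : y < 1 by near: y; exact: lt_nbhsl.
  by have [xy|yx|->//] := ltgtP x y; [rewrite (Fc x y)|rewrite (Fc y x)].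
by move=> [_ h]; rewrite derive1E.
Unshelve. all: by end_near. Qed.

Lemma intI_continuous f : continuous f -> intI f.
Proof.
move=> cf; apply: integrableS (integrable_continuous (-1) 1 cf) => //.
  exact: measurable_Iopen.
by move=> x; rewrite IopenE /= in_itv/= => /andP[/ltW -> /ltW ->].
Qed.

Lemma intI_cst (c : R) : intI (cst c).
Proof. by apply: intI_continuous => x; exact: cvg_cst. Qed.

Lemma intID f g : intI f -> intI g -> intI (f \+ g).
Proof.
by move=> fi gi; have := integrableD measurable_Iopen fi gi; apply: eq_integrable; first exact:
    measurable_Iopen.
Qed.

Lemma intIB f g : intI f -> intI g -> intI (f \- g).
Proof.
by move=> fi gi; have := integrableB measurable_Iopen fi gi; apply: eq_integrable; first exact:
    measurable_Iopen.
Qed.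

Lemma intIZ (c : R) f : intI f -> intI (fun x => c * f x).
Proof.
by move=> fi; have := integrableZl measurable_Iopen c fi; apply: eq_integrable; first exact:
    measurable_Iopen.
Qed.

Lemma intI_measurable f : intI f -> meas Iopen f.
Proof. by move=> /integrableP[/measurable_EFinP]. Qed.

(** Dominated convergence, as the bumps increase to the indicator function. *)
Lemma cvg_integral_bump f (x y : R) : intI f -> -1 <= x -> y <= 1 ->
  \int[mu]_(t in Iopen) (f t * bump x y n.+1%:R t) @[n --> \oo] -->
  \int[mu]_(t in `]x, y[) f t.
Proof.
move=> fi x1 y1; have mI := measurable_Iopen.
have mf := intI_measurable fi.
have xyI : `]x, y[%classic `&` Iopen = `]x, y[%classic.
  by apply/setIidl; exact: itv_oo_Iopen.
have -> : \int[mu]_(t in `]x, y[) f t =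
    \int[mu]_(t in Iopen) (f t * \1_(`]x, y[ : set R) t).
  rewrite -{1}xyI Rintegral_mkcondl; apply: eq_Rintegral => t tI.
  by rewrite patchE indicE; case: (t \in _); rewrite ?mulr1 ?mulr0.
have mb n : meas Iopen (fun t => f t * bump x y n.+1%:R t).
  apply: measurable_funM => //; apply: continuous_meas => //.
  exact/smooth_continuous/smooth_bump.
have [|||||h1 _ h2] := @dominated_convergence _ _ R mu Iopen mI
    (fun n t => (f t * bump x y n.+1%:R t)%:E)
    (fun t => (f t * \1_(`]x, y[ : set R) t)%:E) (abse \o (EFin \o f)).
- by move=> n; exact/measurable_EFinP.
- apply/measurable_EFinP; apply: measurable_funM => //; exact: measurable_indic.
- apply: aeW => t It; apply: cvg_EFin; first by near=> n.
  apply: cvgM; first exact: cvg_cst.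
  rewrite indicE; case: (boolP (t \in _)).
    by rewrite inE /= in_itv/= => h; exact: cvg_bump.
  rewrite notin_setE /= in_itv/= => h.
  have -> : (fun n => bump x y n.+1%:R t) = (fun=> 0).
    by apply/funext => n; rewrite bump_out.
  exact: cvg_cst.
- exact: integrable_abse.
- apply: aeW => t n It /=; rewrite lee_fin normrM ler_piMr//.
  by rewrite ger0_norm ?bump_ge0 ?bump_le1.
apply: (@fine_cvg _ _ _ _ _ (\int[mu]_(t in Iopen) (f t * \1_(`]x, y[ : set R) t))).
by rewrite /Rintegral fineK; [exact: h2 | exact: integrable_fin_num].
Unshelve. all: by end_near. Qed.

(** It suffices to test against smooth approximations of indicators of
    intervals, corrected by a multiple of one fixed bump so that their
    primitives have compact support. *)
Lemma du_bois_reymond f : intI f ->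
  (forall psi, test_function psi ->
     \int[mu]_(x in Iopen) (f x * derive1 psi x) = 0) ->
  exists c, {ae mu, forall x, Iopen x -> f x = c}.
Proof.
move=> fi f0; have mI := measurable_Iopen.
pose b0 : R -> R := bump (- 2^-1) 2^-1 1.
have sb0 : smooth b0 := smooth_bump _ _ _.
pose m0 := \int[mu]_t b0 t.
have b0out x : ~ (- 2^-1 <= x <= 2^-1) -> b0 x = 0.
  move=> h; apply: bump_out => // /andP[h1 h2]; apply: h; apply/andP.
  by split; exact: ltW.
have b0i := integrable_continuous_support (smooth_continuous sb0) b0out.
have m0_gt0 : 0 < m0.
  have [dF F0 F1] := smooth_primitive sb0 b0out.
  set F := (X in forall x, is_derive x _ X _) in dF.
  rewrite /m0 -(F1 1) -/(F 1); last lra.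
  have mvt (x y : R) : x <= y -> exists2 z, z \in `[x, y] & F y - F x = b0 z * (y - x).
    move=> xy; apply: (@MVT_segment R F b0 x y xy).
    apply: continuous_subspaceT => z; apply: differentiable_continuous.
    by apply/derivable1_diffP; case: (dF z).
  have mono x y : x <= y -> F x <= F y.
    move=> xy; have [z _ h] := mvt x y xy.
    by rewrite -subr_ge0 h mulr_ge0 ?bump_ge0 ?subr_ge0.
  have [|z] := mvt (- 4^-1) 4^-1; first lra.
  rewrite in_itv/= => /andP[z1 z2] h.
  have bz : 0 < b0 z by apply: bump_gt0 => //; apply/andP; split; lra.
  have : 0 < F 4^-1 - F (- 4^-1) by rewrite h mulr_gt0//; lra.
  have Fm : F (-1) = 0 by apply: F0; lra.
  have m1 : F (-1) <= F (- 4^-1) by apply: mono; lra.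
  have m2 : F 4^-1 <= F 1 by apply: mono; lra.
  move: (F 1) (F 4^-1) (F (- 4^-1)) (F (-1)) m1 m2 Fm => *; lra.
pose c := (\int[mu]_(x in Iopen) (f x * b0 x)) / m0.
exists c.
have fbi g : smooth g -> (forall x, `|g x| <= 1) -> intI (f \* g).
  move=> sg g1; apply: (@intIM_bounded f g 1 fi) => [|x _]; last exact: g1.
  by apply: continuous_meas => //; exact: smooth_continuous.
have normb x y k t : `|bump x y k t| <= 1 :> R.
  by rewrite ger0_norm ?bump_ge0 ?bump_le1.
have key (x y : R) n : -1 < x -> x < y -> y < 1 ->
    \int[mu]_(t in Iopen) ((f t - c) * bump x y n.+1%:R t) = 0.
  move=> x1 xy y1; set b := bump x y n.+1%:R.
  have sb : smooth b := smooth_bump _ _ _.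
  have bout t : ~ (x <= t <= y) -> b t = 0.
    move=> h; apply: bump_out => // /andP[h1 h2]; apply: h; apply/andP.
    by split; exact: ltW.
  have bi := integrable_continuous_support (smooth_continuous sb) bout.
  pose k := (\int[mu]_t b t) / m0.
  pose g t := b t + cst (- k) t * b0 t.
  have sg : smooth g.
    move=> m; apply: (@diff_timesD R m b); first exact: sb.
    by apply: (@diff_timesM R m (cst (- k))); [exact: diff_times_cst | exact: sb0].
  pose l := Num.min x (- 2^-1); pose r := Num.max y 2^-1.
  have lr : -1 < l /\ r < 1.
    by rewrite /l /r lt_min gt_max x1 y1/=; split; lra.
  have gout t : ~ (l <= t <= r) -> g t = 0.
    move=> h; rewrite /g bout ?b0out ?mulr0 ?addr0//.
      by move=> /andP[h1 h2]; apply: h; rewrite /l /r ge_min h1 orbT le_max h2 orbT.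
    by move=> /andP[h1 h2]; apply: h; rewrite /l /r ge_min h1/= le_max h2.
  have [dF F0 F1] := smooth_primitive sg gout.
  set F := (X in forall x, is_derive x _ X _) in dF F0 F1.
  have intg : \int[mu]_t g t = 0.
    rewrite /g /= RintegralD//; last first.
      by have := integrableZl measurableT (- k) b0i; apply: eq_integrable.
    by rewrite RintegralZl// /k mulNr divfK ?subrr// gt_eqF.
  have tF : test_function F.
    apply: (@smooth_test_function R F l r) => //; try by case: lr.
      by case=> [//|m]; exists g; split; [exact: dF | exact: sg].
    move=> t /negP; rewrite negb_and -!ltNge => /orP[tl|rt]; first exact: F0.
    by rewrite /F F1.
  have := f0 F tF; rewrite (is_derive_derive1 dF) /g => h.
  have fb : intI (f \* b) by apply: (fbi _ sb) => t; exact: normb.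
  have fb0 : intI (f \* b0) by apply: (fbi _ sb0) => t; exact: normb.
  have bI : \int[mu]_(t in Iopen) b t = \int[mu]_t b t.
    rewrite Rintegral_mkcond; apply: eq_Rintegral => t _; rewrite patchE.
    case: ifPn => //; rewrite notin_setE IopenE => h'; rewrite bout// => /andP[h1 h2].
    by apply: h'; rewrite (lt_le_trans x1 h1) (le_lt_trans h2 y1).
  have bIi : intI b by apply: intI_continuous; exact: smooth_continuous.
  transitivity (\int[mu]_(t in Iopen) (f t * b t - c * b t)).
    by apply: eq_Rintegral => t _; rewrite mulrBl.
  rewrite RintegralB//; last by have := intIZ c bIi.
  rewrite RintegralZl// bI.
  move: h; rewrite (_ : \int[mu]_(t in Iopen) _ =
     \int[mu]_(t in Iopen) (f t * b t + (- k) * (f t * b0 t))); last first.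
    by apply: eq_Rintegral => t _; rewrite /=; ring.
  rewrite RintegralD//; last by have := intIZ (- k) fb0.
  rewrite RintegralZl// => h.
  rewrite -h; congr (_ + _); rewrite mulNr; congr (- _).
  by rewrite /c /k; ring.
have fci : intI (f \- cst c) by apply: intIB => //; exact: intI_cst.
have h : {ae mu, forall x, Iopen x -> (f \- cst c) x = 0}.
  apply: (itv_vanishing_ae fci) => x y x1 xy y1.
  have := @cvg_integral_bump _ x y fci (ltW x1) (ltW y1).
  under eq_fun do rewrite key//.
  move=> h; apply/esym.
  by apply: (@cvg_unique _ (@Rhausdorff R) _ _ _ _ (cvg_cst _) h).
by apply: aeS h => x h Ix; apply/eqP; rewrite -subr_eq0; apply/eqP; exact: h.
Qed.

End DuBoisReymond.

(** * Continuous functions on the closed interval *)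

Section Continuity.
Context {R : realType}.
Implicit Types f g h : R -> R.
Local Notation mu := (@lebesgue_measure R).
Local Notation meas D f := (@measurable_fun _ _ (measurableTypeR R) R D f).

Lemma IclosedE (x : R) : Iclosed x = (-1 <= x <= 1) :> Prop.
Proof. by rewrite /Iclosed /= in_itv. Qed.

Lemma Iopen_closed : @Iopen R `<=` Iclosed.
Proof. by move=> x; rewrite IopenE IclosedE => /andP[/ltW -> /ltW ->]. Qed.

Definition cont11 f := {within Iclosed, continuous f}.

Lemma cont11P f : cont11 f <-> forall x, Iclosed x -> forall e : R, 0 < e ->
  exists2 d : R, 0 < d & forall y, Iclosed y -> `|x - y| < d -> `|f x - f y| < e.
Proof.
split.
- move=> /subspace_continuousP cf x Ix e e0.
  have /cvgrPdist_lt/(_ e e0) := cf x Ix.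
  rewrite near_withinE => /nbhs_ballP[d /= d0 hd]; exists d => // y Iy xy.
  by apply: hd.
- move=> hf; apply/subspace_continuousP => x Ix; apply/cvgrPdist_lt => e e0.
  have [d d0 hd] := hf x Ix e e0.
  rewrite near_withinE; apply/nbhs_ballP; exists d => //= y xy Iy.
  exact: hd.
Qed.

Lemma cont11_uniform f : cont11 f -> forall e : R, 0 < e ->
  exists2 d : R, 0 < d & forall x y, Iclosed x -> Iclosed y ->
    `|x - y| < d -> `|f x - f y| < e.
Proof.
move=> /cont11P cf e e0.
have /compact_near_coveringP h : compact (@Iclosed R) by exact: segment_compact.
pose P (d : R) (x : R) := Iclosed x -> forall y, Iclosed y -> `|x - y| < d -> `|f x - f y| < e.
have := h R (0^'+) P _ _.
case.
- move=> x Ix; have [d d0 hd] := cf x Ix (e / 2) (divr_gt0 e0 (ltr0n _ 2)).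
  exists (ball x (d / 2), [set r | r < d / 2]).
    split; first by apply: nbhsx_ballx; rewrite divr_gt0.
    by apply: nbhs_right_lt; rewrite divr_gt0.
  move=> [y r] /= [xy rd] Iy z Iz yz.
  have xz : `|x - z| < d.
    rewrite -(subrKA y); apply: (le_lt_trans (ler_normD _ _)).
    rewrite (splitr d); apply: ltrD => //; exact: lt_trans yz rd.
  rewrite -(subrKA (f x)); apply: (le_lt_trans (ler_normD _ _)).
  rewrite (splitr e); apply: ltrD; last exact: hd.
  rewrite distrC; apply: hd => //; apply: (lt_trans xy).
  by rewrite ltr_pdivrMr// ltr_pMr// ltr1n.
- move=> r /= r0 hr; exists (r / 2); first by rewrite divr_gt0.
  move=> x y Ix Iy xy.
  apply: (hr (r / 2) _ _ x Ix Ix y Iy xy); last by rewrite divr_gt0.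
  by rewrite /= sub0r normrN gtr0_norm ?divr_gt0// ltr_pdivrMr// ltr_pMr// ltr1n.
Qed.

Lemma cont11_bounded f : cont11 f ->
  exists M : R, forall x, Iclosed x -> `|f x| <= M.
Proof.
move=> cf.
have le11 : (-1 : R) <= 1 by lra.
have [a _ ha] := EVT_max le11 cf; have [b _ hb] := EVT_min le11 cf.
exists (Num.max (f a) (- f b)) => x; rewrite IclosedE => Ix.
rewrite ler_norml le_max ha ?in_itv// andbT.
by rewrite lerNl le_max lerN2 hb ?orbT// in_itv.
Qed.

Lemma cont11_meas f : cont11 f -> meas Iopen f.
Proof.
move=> cf.
have h : meas Iclosed f.
  by apply: subspace_continuous_measurable_fun => //; exact: measurable_itv.
apply: measurable_funS h; [exact: measurable_itv | exact: Iopen_closed].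
Qed.

Lemma cont11_comp f G : cont11 f -> (forall x, Iclosed x -> {for f x, continuous G}) ->
  cont11 (G \o f).
Proof.
move=> /cont11P cf cG; apply/cont11P => x Ix e e0.
have /cvgrPdist_lt/(_ e e0)/nbhs_ballP[r /= r0 hr] := cG x Ix.
have [d d0 hd] := cf x Ix r r0.
by exists d => // y Iy xy; apply: hr; apply: hd.
Qed.

Lemma cont11_continuous f : continuous f -> cont11 f.
Proof. exact: continuous_subspaceT. Qed.

Lemma cont11D f g : cont11 f -> cont11 g -> cont11 (f \+ g).
Proof.
move=> /subspace_continuousP cf /subspace_continuousP cg.
by apply/subspace_continuousP => x Ix; apply: cvgD; [exact: cf | exact: cg].
Qed.

Lemma cont11M f g : cont11 f -> cont11 g -> cont11 (f \* g).
Proof.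
move=> /subspace_continuousP cf /subspace_continuousP cg.
by apply/subspace_continuousP => x Ix; apply: cvgM; [exact: cf | exact: cg].
Qed.

End Continuity.

(** * Primitives and the chain rule *)

Section Primitive.
Context {R : realType}.
Implicit Types f g h w F : R -> R.
Local Notation mu := (@lebesgue_measure R).
Local Notation meas D f := (@measurable_fun _ _ (measurableTypeR R) R D f).

Lemma intI_itv g (x y : R) : intI g -> -1 <= x -> y <= 1 ->
  mu.-integrable `]x, y[ (EFin \o g).
Proof.
move=> gi x1 y1; apply: integrableS gi; first exact: measurable_Iopen.
  exact: measurable_itv.
exact: itv_oo_Iopen.
Qed.

Lemma integral_itv_add g (x y z : R) : intI g -> -1 <= x -> x <= y -> y <= z -> z <= 1 ->
  \int[mu]_(t in `]x, z[) g t =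
  \int[mu]_(t in `]x, y[) g t + \int[mu]_(t in `]y, z[) g t.
Proof.
move=> gi x1 xy yz z1.
have [->|yz'] := eqVneq y z; first by rewrite set_itvoo0 Rintegral_set0 addr0.
have yz2 : y < z by rewrite lt_neqAle yz'.
have gxz : mu.-integrable `]x, z[ (EFin \o g) by exact: intI_itv.
have := @Rintegral_itvB R g (BRight x) (BLeft z) y gxz.
rewrite !bnd_simp => /(_ xy yz2) <-.
rewrite -(@Rintegral_itv_bndo_bndc R (BRight x) y g).
  by rewrite addrC subrK.
by apply: intI_itv => //; apply: le_trans z1.
Qed.

Lemma integral_itv_ge0 w (x y : R) : (forall t, Iopen t -> 0 <= w t) -> -1 <= x -> y <= 1 ->
  0 <= \int[mu]_(t in `]x, y[) w t.
Proof. by move=> w0 x1 y1; apply: Rintegral_ge0 => t /(itv_oo_Iopen x1 y1); exact: w0. Qed.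

(** The integrated form of f' = g, which is stable under composition with C^1
    functions and under dominated limits. *)
Definition prim f g := intI g /\
  forall x y, -1 <= x -> x <= y -> y <= 1 -> f y - f x = \int[mu]_(t in `]x, y[) g t.

(** Partition [x, y] into short intervals: the increments add up to at most e
    times an integral, for every e. *)
Lemma const_of_small F w : intI w -> (forall t, Iopen t -> 0 <= w t) ->
  (forall e : R, 0 < e -> exists2 d : R, 0 < d & forall x y, -1 <= x -> x <= y -> y <= 1 ->
     y - x < d -> `|F y - F x| <= e * \int[mu]_(t in `]x, y[) w t) ->
  forall x y, -1 <= x -> x <= y -> y <= 1 -> F y = F x.
Proof.
move=> wi w0 hF x y x1 xy y1.
have key (e : R) : 0 < e -> `|F y - F x| <= e * \int[mu]_(t in `]x, y[) w t.
  move=> e0; have [d d0 hd] := hF e e0.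
  pose n := Num.truncn ((y - x) / d).
  pose h := (y - x) / n.+1%:R.
  have h0 : 0 <= h by rewrite divr_ge0 ?subr_ge0.
  have hltd : h < d.
    rewrite /h ltr_pdivrMr// mulrC -ltr_pdivrMr//.
    exact: truncnS_gt.
  have xn : x + n.+1%:R * h = y by rewrite /h mulrCA mulfV// mulr1 addrC subrK.
  suff H (i : nat) : (i <= n.+1)%N ->
      `|F (x + i%:R * h) - F x| <= e * \int[mu]_(t in `]x, (x + i%:R * h)[) w t.
    by have := H n.+1 (leqnn _); rewrite xn.
  elim: i => [|i IH] iln.
    by rewrite mul0r addr0 subrr normr0 set_itvoo0 Rintegral_set0 mulr0.
  have mono (j k : nat) : (j <= k)%N -> x + j%:R * h <= x + k%:R * h.
    by move=> jk; rewrite lerD2l ler_wpM2r// ler_nat.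
  have xi (k : nat) : x <= x + k%:R * h by rewrite lerDl mulr_ge0.
  have iy : x + i.+1%:R * h <= 1 by apply: le_trans y1; rewrite -xn mono.
  rewrite (@integral_itv_add w x (x + i%:R * h))//; last by rewrite mono.
  rewrite mulrDr -(subrKA (F (x + i%:R * h))) addrC.
  apply: (le_trans (ler_normD _ _)); apply: lerD; first exact/IH/ltnW.
  apply: hd => //; first exact: le_trans (xi _).
    by rewrite mono.
  suff -> : x + i.+1%:R * h - (x + i%:R * h) = h by [].
  by rewrite -natr1; ring.
apply/eqP; rewrite -subr_eq0 -normr_eq0 -(negbK (_ == 0)); apply/negP => ne0.
have Fp : 0 < `|F y - F x| by rewrite lt_neqAle eq_sym ne0 /=.
set I := \int[mu]_(t in `]x, y[) w t in key.
have I0 : 0 <= I by apply: integral_itv_ge0.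
have := key (`|F y - F x| / (2 * (I + 1))) _.
move=> /(_ (divr_gt0 Fp (mulr_gt0 (ltr0n _ 2) (ltr_wpDl I0 ltr01)))).
rewrite -mulrA -{1}(mulr1 `|F y - F x|) (ler_pM2l Fp) => h1.
have : I / (2 * (I + 1)) < 1 by rewrite ltr_pdivrMr; lra.
by rewrite ltNge [X in 1 <= X]mulrC h1.
Qed.

Lemma prim_cont f g : prim f g -> cont11 f.
Proof.
move=> [gi hf]; apply/cont11P => x Ix e e0.
have gT : mu.-integrable setT (EFin \o (g \_ Iopen)).
  rewrite (_ : EFin \o _ = (EFin \o g) \_ Iopen); last by rewrite restrict_EFin.
  by rewrite -integrable_mkcond//; exact: measurable_Iopen.
have [d [d0 hd]] := integral_normr_continuous gT e0.
have key y z : -1 <= y -> y <= z -> z <= 1 -> z - y < d -> `|f z - f y| < e.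
  move=> y1 yz z1 zy; rewrite hf//.
  apply: le_lt_trans (hd `]y, z[%classic _ _); last 2 first.
  - exact: measurable_itv.
  - change (mu `]y, z[%classic < d%:E)%E; rewrite lebesgue_measure_itv /=; case: ifP => _; last
      by rewrite lte_fin.
    by rewrite EFinN lte_fin.
  apply: (le_trans (le_normr_Rintegral _ _)) => //; first exact: intI_itv.
  rewrite le_eqVlt; apply/orP; left; apply/eqP; apply: eq_Rintegral => t.
  rewrite inE => /(itv_oo_Iopen y1 z1) It.
  by rewrite patchE mem_set.
exists d => // y; move: Ix; rewrite !IclosedE => /andP[x1 x2] /andP[y1 y2] xy.
have [le|/ltW le] := leP x y.
  by rewrite distrC; apply: key => //; move: xy; rewrite distrC ger0_norm ?subr_ge0.
by apply: key => //; move: xy; rewrite ger0_norm ?subr_ge0.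
Qed.

(** On short intervals G' o f is almost constant by uniform continuity, so G o f
    and the integral of (G' o f) g have nearly the same increments, and
    const_of_small applies to their difference. *)
Lemma prim_chain f g (c d : R) G G' : prim f g ->
  (forall x, Iclosed x -> c < f x < d) ->
  (forall u : R, c < u < d -> is_derive u (1 : R) G (G' u)) ->
  (forall u : R, c < u < d -> {for u, continuous G'}) ->
  prim (G \o f) (fun x => G' (f x) * g x).
Proof.
move=> pfg fr dG cG'; have [gi hf] := pfg.
have cf := prim_cont pfg.
have cGf : cont11 (G' \o f) by apply: cont11_comp => // x Ix; apply: cG'; exact: fr.
have [M hM] := cont11_bounded cGf.
have Ggi : intI (fun x => G' (f x) * g x).
  have := @intIM_bounded R g (G' \o f) M gi (cont11_meas cGf) (fun x Ix => hM x (Iopen_closed Ix)).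
  by apply: eq_integrable; [exact: measurable_Iopen | move=> x _ /=; rewrite mulrC].
split => // x y x1 xy y1.
have ngi : intI (fun x => `|g x|) by exact: integrable_norm.
pose F z := G (f z) - \int[mu]_(t in `](-1), z[) (G' (f t) * g t).
have Fc : F y = F x.
  apply: (@const_of_small F _ ngi) => // e e0.
  have [r r0 hr] := cont11_uniform cGf e0.
  exists r => // {x y x1 xy y1} x y x1 xy y1 xyr.
  rewrite /F (@integral_itv_add _ (-1) x y)//.
  have Gmvt : exists2 z, x <= z <= y & G (f y) - G (f x) = G' (f z) * (f y - f x).
    have mvt (u v : R) : c < u -> u <= v -> v < d ->
        exists2 w, u <= w <= v & G v - G u = G' w * (v - u).
      move=> cu uv vd.
      have ucvd t : u <= t <= v -> c < t < d.
        by move=> /andP[ut tv]; rewrite (lt_le_trans cu ut) (le_lt_trans tv vd).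
      have [||w] := @MVT_segment R G G' u v uv.
      - by move=> t; rewrite in_itv/= => /andP[/ltW ut /ltW tv]; apply: dG; apply: ucvd; rewrite ut.
      - apply: continuous_in_subspaceT => t; rewrite inE /= in_itv/= => utv.
        apply: differentiable_continuous; apply/derivable1_diffP.
        by case: (dG t (ucvd t utv)).
      by rewrite in_itv/= => uwv e1; exists w.
    have Ix : Iclosed x by rewrite IclosedE x1 (le_trans xy y1).
    have Iy : Iclosed y by rewrite IclosedE (le_trans x1 xy) y1.
    have cxy : {within `[x, y], continuous f}.
      apply: continuous_subspaceW cf => t; rewrite IclosedE /= in_itv/= => /andP[xt ty].
      by rewrite (le_trans x1 xt) (le_trans ty y1).
    have /andP[cx dx] := fr x Ix; have /andP[cy dy] := fr y Iy.
    have [w wxy hw] : exists2 w, Num.min (f x) (f y) <= w <= Num.max (f x) (f y) &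
        G (f y) - G (f x) = G' w * (f y - f x).
      have [fxy|/ltW fyx] := leP (f x) (f y).
        have [w wxy hw] := mvt _ _ cx fxy dy.
        by exists w.
      have [w wxy hw] := mvt _ _ cy fyx dx.
      by exists w => //; rewrite -[LHS]opprB hw -mulrN opprB.
    have [z] := IVT xy cxy wxy.
    by rewrite in_itv/= => xzy fz; exists z => //; rewrite fz.
  have [z /andP[xz zy] hz] := Gmvt.
  rewrite (_ : _ - _ = \int[mu]_(t in `]x, y[) ((G' (f z) - G' (f t)) * g t)); last first.
    rewrite (_ : \int[mu]_(t in `]x, y[) ((G' (f z) - G' (f t)) * g t) =
      \int[mu]_(t in `]x, y[) (G' (f z) * g t - G' (f t) * g t)); last first.
      by apply: eq_Rintegral => t _; rewrite mulrBl.
    rewrite RintegralB//; last 2 first.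
    - by have := intI_itv (intIZ (G' (f z)) gi) x1 y1.
    - exact: intI_itv.
    rewrite RintegralZl//; last exact: intI_itv.
    rewrite -hf// -hz.
    by ring.
  have e1 : -1 <= y by apply: le_trans xy.
  have bnd t : `]x, y[%classic t -> `|(G' (f z) - G' (f t)) * g t| <= e * `|g t|.
    rewrite /= in_itv/= => /andP[xt ty]; rewrite normrM ler_wpM2r//.
    apply/ltW/hr; rewrite ?IclosedE.
    - by rewrite (le_trans x1 xz) (le_trans zy y1).
    - by rewrite (le_trans x1 (ltW xt)) (le_trans (ltW ty) y1).
    - by rewrite ltr_norml; apply/andP; split; lra.
  have iG : mu.-integrable `]x, y[ (EFin \o (fun t => (G' (f z) - G' (f t)) * g t)).
    apply: intI_itv => //.
    have := intIB (intIZ (G' (f z)) gi) Ggi.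
    by apply: eq_integrable; [exact: measurable_Iopen | move=> t _ /=; rewrite mulrBl].
  apply: (le_trans (le_normr_Rintegral _ _)) => //.
  rewrite -RintegralZl//; last exact: intI_itv.
  apply: le_Rintegral => //.
  - by apply: integrable_norm.
  - by have := intI_itv (intIZ e ngi) x1 y1.
move: Fc; rewrite /F (@integral_itv_add _ (-1) x y)//= => Fc.
lra.
Qed.

End Primitive.

(** * Calculus of primitives *)

Section PrimitiveCalculus.
Context {R : realType}.
Implicit Types f g h k F : R -> R.
Local Notation mu := (@lebesgue_measure R).
Local Notation meas D f := (@measurable_fun _ _ (measurableTypeR R) R D f).

Lemma integral_eq_in (x y : R) f g : (forall t, x < t < y -> f t = g t) ->
  \int[mu]_(t in `]x, y[) f t = \int[mu]_(t in `]x, y[) g t.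
Proof. by move=> fg; apply: eq_Rintegral => t; rewrite inE /= in_itv/=; exact: fg. Qed.

Lemma prim_ext f f' g g' : (forall x, Iclosed x -> f x = f' x) ->
  (forall x, Iopen x -> g x = g' x) -> prim f g -> prim f' g'.
Proof.
move=> ff gg [gi hf]; split.
  apply: eq_integrable gi; first exact: measurable_Iopen.
  by move=> x; rewrite inE /= => /gg ->.
move=> x y x1 xy y1; rewrite -!ff ?IclosedE ?x1 ?y1 ?(le_trans x1 xy) ?(le_trans xy y1)// hf//.
apply: eq_Rintegral => t; rewrite inE => It; apply: gg; exact: itv_oo_Iopen It.
Qed.

Lemma primD f g h k : prim f g -> prim h k -> prim (f \+ h) (g \+ k).
Proof.
move=> [gi hf] [ki hh]; split; first exact: intID.
move=> x y x1 xy y1; rewrite RintegralD//; try exact: intI_itv.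
by rewrite -hf// -hh//=; ring.
Qed.

Lemma primZ (c : R) f g : prim f g -> prim (fun x => c * f x) (fun x => c * g x).
Proof.
move=> [gi hf]; split; first exact: intIZ.
move=> x y x1 xy y1; rewrite RintegralZl//; last exact: intI_itv.
by rewrite -hf// mulrBr.
Qed.

Lemma prim_cst (c : R) : prim (cst c) (cst 0).
Proof.
split; first exact: intI_cst.
by move=> x y x1 xy y1; rewrite Rintegral_cst ?mul0r ?subrr.
Qed.

Lemma primB f g h k : prim f g -> prim h k -> prim (f \- h) (g \- k).
Proof.
move=> pf /(primZ (-1)) ph; apply: prim_ext (primD pf ph) => x _ /=; ring.
Qed.

Lemma prim_sqr f g : prim f g -> prim (fun x => f x * f x) (fun x => 2 * f x * g x).
Proof.
move=> pf; have [M hM] := cont11_bounded (prim_cont pf).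
have M0 : 0 <= M by apply: le_trans (hM 0 _) => //; rewrite IclosedE; lra.
apply: (@prim_chain R f g (- (M + 1)) (M + 1) (fun u => u * u) (fun u => 2 * u)) => //.
- by move=> x /hM; rewrite -ltr_norml => h; apply: le_lt_trans h _; lra.
- move=> u _; have h := is_deriveM (is_derive_id u (1 : R)) (is_derive_id u (1 : R)).
  by apply: (is_derive_eq h); rewrite /GRing.scale/= mulr1 mulr2n mulrDl mul1r.
- move=> u _; apply: cvgM; first exact: cvg_cst.
  exact: cvg_id.
Qed.

(** By polarisation from the chain rule for the square. *)
Lemma primM f g h k : prim f g -> prim h k ->
  prim (fun x => f x * h x) (fun x => f x * k x + h x * g x).
Proof.
move=> pf ph.
have p1 := prim_sqr (primD pf ph); have p2 := prim_sqr (primB pf ph).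
by apply: prim_ext (primZ 4^-1 (primB p1 p2)) => x _ /=; field.
Qed.

Lemma integral_itv_derive F f (x y : R) : x <= y ->
  (forall t : R, is_derive t (1 : R) F (f t)) -> continuous f ->
  \int[mu]_(t in `]x, y[) f t = F y - F x.
Proof.
move=> + dF cf.
have cF : continuous F.
  by move=> t; apply: differentiable_continuous; apply/derivable1_diffP; case: (dF t).
rewrite le_eqVlt => /predU1P[->|xy]; first by rewrite subrr set_itvoo0 Rintegral_set0.
have := @continuous_FTC2 R f F x y xy (continuous_subspaceT cf).
rewrite /Rintegral -(integral_itv_bndoo true false); last first.
  by apply/measurable_EFinP; apply: continuous_meas => //; exact: measurable_itv.
move=> -> //; last by move=> t _; rewrite (is_derive_derive1 dF).
split; first by move=> t _; case: (dF t).
- by apply: cvg_at_right_filter; exact: cF.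
- by apply: cvg_at_left_filter; exact: cF.
Qed.

Lemma prim_C1 F f : (forall x : R, is_derive x (1 : R) F (f x)) -> continuous f ->
  prim F f.
Proof.
move=> dF cf; split; first exact: intI_continuous.
by move=> x y x1 xy y1; rewrite (integral_itv_derive xy dF).
Qed.

(** An exceptional point would have an exceptional neighbourhood. *)
Lemma cont11_ae_eq f (c : R) : cont11 f -> {ae mu, forall x, Iopen x -> f x = c} ->
  forall x, Iclosed x -> f x = c.
Proof.
move=> /cont11P cf [N [mN N0 hN]] x Ix.
apply/eqP; rewrite -subr_eq0 -normr_eq0; apply/negPn/negP => ne.
have e0 : 0 < `|f x - c| by rewrite lt_neqAle eq_sym ne /=.
have [d d0 hd] := cf x Ix _ e0.
pose l := Num.max (-1) (x - d); pose r := Num.min 1 (x + d).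
have lr : l < r.
  move: Ix; rewrite IclosedE => /andP[x1 x2].
  rewrite /l /r gt_max !lt_min; apply/andP; split; apply/andP; split; lra.
have sub : `]l, r[%classic `<=` N.
  move=> t /=; rewrite in_itv/= /l /r gt_max lt_min => /andP[/andP[t1 t2] /andP[t3 t4]].
  apply: hN => /= h.
  have It : Iopen t by rewrite IopenE t1 t3.
  have := hd t (Iopen_closed It); rewrite (h It) ltxx => /(_ _)/notF; apply.
  by rewrite ltr_norml; apply/andP; split; lra.
have : (mu `]l, r[%classic <= mu N)%E by apply: le_measure => //; rewrite inE.
by rewrite N0 lebesgue_measure_itv /= lte_fin lr -EFinD lee_fin subr_le0 leNgt lr.
Qed.

Lemma prim_unique f g k : prim f g -> prim f k ->
  {ae mu, forall x, Iopen x -> g x = k x}.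
Proof.
move=> [gi hg] [ki hk].
have h : {ae mu, forall x, Iopen x -> (g \- k) x = 0}.
  apply: itv_vanishing_ae; first exact: intIB.
  move=> x y x1 xy y1; rewrite RintegralB//.
  - by rewrite -hg -?hk ?subrr; try exact: ltW.
  - by apply: intI_itv => //; exact: ltW.
  - by apply: intI_itv => //; exact: ltW.
by apply: aeS h => x h /h /eqP; rewrite subr_eq0 => /eqP.
Qed.

Lemma prim_test (psi : R -> R) : test_function psi -> prim psi (derive1 psi).
Proof.
move=> /test_function_smooth sp; apply: prim_C1.
  by move=> x; exact: smooth_is_derive.
by apply: smooth_continuous; exact: smooth_derive1.
Qed.

Lemma test_boundary (psi : R -> R) : test_function psi -> psi (-1) = 0 /\ psi 1 = 0.
Proof.
move=> [_ [K [_ KI h]]]; split; apply: h => /KI; rewrite IopenE => /andP[]; by rewrite ltxx.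
Qed.

(** The product of f and a test function is a primitive that vanishes at both end
    points. *)
Lemma prim_distributional f g : prim f g ->
  distributional_derivative f (fun psi => \int[mu]_(x in Iopen) (g x * psi x)).
Proof.
move=> pf psi tp; have [p0 p1] := test_boundary tp.
have pp := prim_test tp.
have [ppi hp] := pp; have [gi hf] := pf.
have [_ /(_ (-1) 1)] := primM pf pp.
rewrite p0 p1 !mulr0 subrr => h.
have {h} := h (lexx _) ltac:(lra) (lexx _).
have [M hM] := cont11_bounded (prim_cont pf).
have [M' hM'] := cont11_bounded (prim_cont pp).
have i1 : intI (fun x => f x * derive1 psi x).
  have := @intIM_bounded R (derive1 psi) f M ppi (cont11_meas (prim_cont pf)) (fun x Ix => hM x
      (Iopen_closed Ix)).
  by apply: eq_integrable; [exact: measurable_Iopen | move=> x _ /=; rewrite mulrC].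
have i2 : intI (fun x => psi x * g x).
  have := @intIM_bounded R g psi M' gi (cont11_meas (prim_cont pp)) (fun x Ix => hM' x
      (Iopen_closed Ix)).
  by apply: eq_integrable; [exact: measurable_Iopen | move=> x _ /=; rewrite mulrC].
rewrite -/Iopen RintegralD//; last exact: measurable_Iopen.
move=> /eqP; rewrite eq_sym addr_eq0 => /eqP ->; congr (- _).
by apply: eq_Rintegral => x _; rewrite mulrC.
Qed.

End PrimitiveCalculus.

(** * Sobolev functions as primitives *)

Section Sobolev.
Context {R : realType}.
Implicit Types f g h k F : R -> R.
Local Notation mu := (@lebesgue_measure R).
Local Notation meas D f := (@measurable_fun _ _ (measurableTypeR R) R D f).

Definition sqint f : \bar R := (\int[mu]_(x in Iopen) ((f x) ^+ 2)%:E)%E.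

Lemma sqint_ge0 f : (0 <= sqint f)%E.
Proof. by apply: integral_ge0 => x _; rewrite lee_fin sqr_ge0. Qed.

Lemma L2norm_sqint f : (L2norm f `^ 2 = sqint f)%E.
Proof.
rewrite /L2norm poweR_Lnorm// /sqint [RHS]integral_mkcond.
apply: eq_integral => x _; rewrite !patchE; case: ifP => _.
  by rewrite /= powR_mulrn// real_normK// num_real.
by rewrite /= normr0 powR0.
Qed.

Lemma L2norm_lty f : (L2norm f < +oo)%E = (sqint f < +oo)%E.
Proof.
rewrite -L2norm_sqint; apply/idP/idP => h; first exact: poweR_lty.
by apply: (@lty_poweRy _ _ 2) => //.
Qed.

Lemma L2E f : L2 f <-> meas Iopen f /\ (sqint f < +oo)%E.
Proof. by rewrite /L2 L2norm_lty. Qed.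

Lemma L2_intI f : L2 f -> intI f.
Proof.
move=> /L2E[mf ff].
have i1 : mu.-integrable Iopen (EFin \o (fun x => f x ^+ 2)).
  apply/integrableP; split.
    by apply/measurable_EFinP; exact: measurable_funX.
  by under eq_integral do rewrite /= ger0_norm ?sqr_ge0//; exact: ff.
have i2 := intID (intI_cst 1) i1.
apply: le_integrable i2; first exact: measurable_Iopen.
  exact/measurable_EFinP.
move=> x _ /=; rewrite lee_fin [leRHS]ger0_norm ?addr_ge0 ?sqr_ge0//.
rewrite -real_normK ?num_real//; have := sqr_ge0 (`|f x| - 2^-1).
rewrite sqrrB; move: (`|f x|) (normr_ge0 (f x)) => t t0; lra.
Qed.

Lemma L2_bounded f (M : R) : meas Iopen f -> (forall x, Iopen x -> `|f x| <= M) -> L2 f.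
Proof.
move=> mf fM; apply/L2E; split => //.
have i1 := intI_cst (M ^+ 2).
have : intI (fun x => f x ^+ 2).
  apply: le_integrable i1; first exact: measurable_Iopen.
    by apply/measurable_EFinP; exact: measurable_funX.
  move=> x Ix /=; rewrite lee_fin !ger0_norm ?sqr_ge0//.
  rewrite -real_normK ?num_real//; apply: lerXn2r; rewrite ?nnegrE//.
    by apply: le_trans (fM x Ix).
  exact: fM.
by move=> /integrableP[_]; under eq_integral do rewrite /= ger0_norm ?sqr_ge0//.
Qed.

Lemma cont11_L2 f : cont11 f -> L2 f.
Proof.
move=> cf; have [M hM] := cont11_bounded cf.
by apply: (@L2_bounded f M) => [|x /Iopen_closed/hM//]; exact: cont11_meas.
Qed.

Lemma prim_integral g : intI g -> prim (fun x => \int[mu]_(t in `](-1), x[) g t) g.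
Proof.
move=> gi; split => // x y x1 xy y1.
by rewrite (@integral_itv_add _ g (-1) x y)// addrAC subrr add0r.
Qed.

(** The difference of f and the integral of g has vanishing weak derivative. *)
Lemma weak_derivative_prim f g : cont11 f -> weak_derivative f g -> prim f g.
Proof.
move=> cf [L2g dg]; have gi := L2_intI L2g.
have pF := prim_integral gi; set F := (F in prim F _) in pF.
have cF := prim_cont pF.
have L1 h : cont11 h -> intI h by move=> /cont11_L2/L2_intI.
have [c hc] : exists c, {ae mu, forall x, Iopen x -> (f \- F) x = c}.
  apply: du_bois_reymond; first by apply: intIB; exact: L1.
  move=> psi tp.
  have cp : cont11 (derive1 psi).
    apply: cont11_continuous; apply: smooth_continuous; apply: smooth_derive1.
    exact: test_function_smooth.
  have -> : \int[mu]_(x in Iopen) ((f \- F) x * derive1 psi x) =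
      \int[mu]_(x in Iopen) (f x * derive1 psi x - F x * derive1 psi x).
    by apply: eq_Rintegral => x _ /=; rewrite mulrBl.
  rewrite RintegralB; last 3 first.
  - exact: measurable_Iopen.
  - by have := L1 _ (cont11M cf cp).
  - by have := L1 _ (cont11M cF cp).
  by rewrite (dg psi tp) (prim_distributional pF tp) subrr.
have cfF : cont11 (f \- F).
  have cN : cont11 (fun x => -1 * F x).
    by apply: (@cont11M R (cst (-1)) F) => //; apply: cont11_continuous => x; exact: cvg_cst.
  have -> : f \- F = f \+ (fun x => -1 * F x) by apply/funext => x /=; rewrite mulN1r.
  exact: cont11D.
have h := cont11_ae_eq cfF hc.
split => // x y x1 xy y1.
have hx : f x - F x = c by apply: h; rewrite IclosedE x1 (le_trans xy y1).
have hy : f y - F y = c by apply: h; rewrite IclosedE y1 (le_trans x1 xy).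
have [_ /(_ x y x1 xy y1) <-] := pF; lra.
Qed.

Lemma prim_weak_derivative f g : prim f g -> L2 g -> weak_derivative f g.
Proof. by move=> pf L2g; split => //; exact: prim_distributional. Qed.

(** The continuous representative is what makes the weak derivative a derivative
    of f in the integrated sense. *)
Lemma H1P f : H1 f <-> exists2 g, prim f g & L2 g.
Proof.
split=> [[cf _ [g wg]]|[g pf L2g]].
  by exists g; [exact: weak_derivative_prim | case: wg].
split; first exact: prim_cont pf.
  exact/cont11_L2/(prim_cont pf).
by exists g; exact: prim_weak_derivative.
Qed.

(** The weak derivative chosen in the definition of the energy agrees with any
    other one up to a null set. *)
Lemma wderiv_prim f g : prim f g -> L2 g ->
  [/\ prim f (wderiv f), L2 (wderiv f) & {ae mu, forall x, Iopen x -> wderiv f x = g x}].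
Proof.
move=> pf L2g.
have w : weak_derivative f (wderiv f).
  apply: (@xgetPex _ _ [set g | weak_derivative f g]).
  by exists g; exact: prim_weak_derivative.
have p := weak_derivative_prim (prim_cont pf) w.
split => //; first by case: w.
exact: prim_unique p pf.
Qed.

Definition half_seminorm alpha m1 : \bar R :=
  ((2^-1)%:E * sqr_seminorm_Hhalf (excess alpha m1))%E.

Lemma energyE alpha eps m1 m2 g1 g2 : prim m1 g1 -> L2 g1 -> prim m2 g2 -> L2 g2 ->
  energy alpha eps m1 m2 =
  ((eps / 2)%:E * (sqint g1 + sqint g2) + half_seminorm alpha m1)%E.
Proof.
move=> p1 l1 p2 l2; rewrite /energy /half_seminorm; congr (_ * _ + _)%E.
have [_ lw1 w1] := wderiv_prim p1 l1; have [_ lw2 w2] := wderiv_prim p2 l2.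
have [mw1 _] := (L2E _).1 lw1; have [mw2 _] := (L2E _).1 lw2.
have [mg1 _] := (L2E _).1 l1; have [mg2 _] := (L2E _).1 l2.
have mI := measurable_Iopen.
rewrite /sqint -ge0_integralD//.
- apply: ge0_ae_eq_integral => //.
  + by apply/measurable_EFinP; apply: measurable_funD; exact: measurable_funX.
  + apply: emeasurable_funD; apply/measurable_EFinP; exact: measurable_funX.
  + by move=> x _; rewrite lee_fin addr_ge0 ?sqr_ge0.
  + by move=> x _; rewrite -EFinD lee_fin addr_ge0 ?sqr_ge0.
  + by apply: aeS2 w1 w2 => x h1 h2 Ix; rewrite h1// h2// EFinD.
- by move=> x _; rewrite lee_fin sqr_ge0.
- by apply/measurable_EFinP; exact: measurable_funX.
- by move=> x _; rewrite lee_fin sqr_ge0.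
- by apply/measurable_EFinP; exact: measurable_funX.
Qed.

End Sobolev.

(** * Distance of angles and of their cosines; limits of primitives *)

Section InverseCosine.
Context {R : realType}.
Local Notation mu := (@lebesgue_measure R).
Local Notation meas D f := (@measurable_fun _ _ (measurableTypeR R) R D f).
Implicit Types f g : R -> R.

Lemma sin_ge_half (t : R) : 0 <= t <= pi / 2 -> t / 2 <= sin t.
Proof.
move=> /andP[t0 t1]; have pi0 := pi_gt0 R.
have cmono (u : R) : 0 <= u <= t / 2 -> cos (pi / 4) <= cos u.
  move=> /andP[u0 u1]; rewrite leNgt; apply/negP => h.
  have : pi / 4 < u.
    by rewrite -(@ltr_cos R) ?in_itv/= ?h//; apply/andP; split; lra.
  by lra.
have c4 : cos (pi / 4 : R) ^+ 2 = 2^-1.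
  have : cos (pi / 2 : R) = 0 by exact: cos_pihalf.
  have -> : pi / 2 = pi / 4 *+ 2 :> R by rewrite mulr2n; field.
  rewrite cos_mulr2n => h.
  have : cos (pi / 4 : R) ^+ 2 *+ 2 = 1 by move/eqP: h; rewrite subr_eq0 => /eqP.
  rewrite mulr2n; lra.
have c0 : 0 <= cos (pi / 4 : R).
  by apply/ltW/cos_gt0_pihalf; apply/andP; split; lra.
have [c + hc] : exists2 c, c \in `[0, (t / 2)] & sin (t / 2) - sin 0 = cos c * (t / 2 - 0).
  apply: (@MVT_segment R (@sin R) (@cos R)); first lra.
  exact/continuous_subspaceT/continuous_sin.
rewrite in_itv/= => hct; have := cmono c hct => hc'.
rewrite sin0 !subr0 in hc.
have -> : sin t = 2 * (sin (t / 2) * cos (t / 2)).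
  have tt : t = t / 2 + t / 2 by lra.
  by rewrite {1}tt sinD; ring.
have h2 : cos (pi / 4) <= cos (t / 2) by apply: cmono; apply/andP; split; lra.
rewrite hc.
have : cos (pi / 4) * cos (pi / 4) <= cos c * cos (t / 2) by apply: ler_pM.
rewrite -expr2 c4 => h.
have : 2^-1 * t <= cos c * cos (t / 2) * t by apply: ler_wpM2r.
by move: (cos c) (cos (t / 2)) => u v; lra.
Qed.

(** cos x - cos y = 2 sin((y - x) / 2) sin((y + x) / 2), and the second factor
    dominates the first on [0, pi]. *)
Lemma cos_dist_ge (x y : R) : 0 <= x <= pi -> 0 <= y <= pi ->
  (x - y) ^+ 2 <= 8 * `|cos x - cos y|.
Proof.
wlog xy : x y / x <= y => [H|].
  move=> hx hy; have [|/ltW] := leP x y; first by move=> xy; exact: H.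
  by move=> yx; rewrite -[x - y]opprB sqrrN distrC; exact: H.
move=> /andP[x0 x1] /andP[y0 y1].
have pi0 := pi_gt0 R.
pose p := x / 2; pose q := y / 2.
have xE : x = p *+ 2 by rewrite mulr2n /p; lra.
have yE : y = q *+ 2 by rewrite mulr2n /q; lra.
have sp : 0 <= sin p by apply: sin_ge0_pi; rewrite /p; apply/andP; split; lra.
have cq : 0 <= cos q.
  by apply: cos_ge0_pihalf; rewrite /q; apply/andP; split; lra.
have e : cos x - cos y = 2 * (sin (q - p) * sin (q + p)).
  rewrite xE yE !cos_mulr2n sinB sinD.
  have := cos2Dsin2 p; have := cos2Dsin2 q.
  move: (cos p) (cos q) (sin p) (sin q) => a b c d h1 h2.
  have e1 : c ^+ 2 = 1 - a ^+ 2 by lra.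
  have e2 : d ^+ 2 = 1 - b ^+ 2 by lra.
  rewrite (_ : (d * a - b * c) * (d * a + b * c) = d ^+ 2 * a ^+ 2 - b ^+ 2 * c ^+ 2); last by ring.
  by rewrite e1 e2; ring.
have s1 : (q - p) / 2 <= sin (q - p) by apply: sin_ge_half; rewrite /p /q; apply/andP; split; lra.
have s2 : sin (q - p) <= sin (q + p).
  by rewrite sinB sinD; have := mulr_ge0 cq sp; move: (cos q * sin p) => ?; lra.
have s0 : 0 <= (q - p) / 2 by rewrite /p /q; lra.
have : ((q - p) / 2) * ((q - p) / 2) <= sin (q - p) * sin (q + p).
  by apply: ler_pM => //; apply: le_trans s2.
rewrite e ger0_norm; last first.
  by rewrite mulr_ge0// mulr_ge0// ?(le_trans s0 s1)// (le_trans s0 (le_trans s1 s2)).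
by move: (sin _ * sin _) => u; rewrite /p /q; lra.
Qed.

(** The inverse cosine is Hoelder continuous with exponent 1/2. *)
Lemma acos_dist (u v : R) : -1 <= u <= 1 -> -1 <= v <= 1 ->
  (acos u - acos v) ^+ 2 <= 8 * `|u - v|.
Proof.
move=> hu hv; have [h1 h2] := acos_def hu; have [h3 h4] := acos_def hv.
by have := cos_dist_ge h1 h3; rewrite h2 h4.
Qed.

(** Dominated convergence in the defining identity of primitives. *)
Lemma prim_limit (f_ g_ : (R -> R)^nat) f g w :
  (forall n, prim (f_ n) (g_ n)) -> meas Iopen g -> intI w ->
  (forall x, Iclosed x -> f_ n x @[n --> \oo] --> f x) ->
  {ae mu, forall x, Iopen x -> g_ n x @[n --> \oo] --> g x} ->
  {ae mu, forall x, Iopen x -> forall n, `|g_ n x| <= w x} ->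
  prim f g.
Proof.
move=> pn mg wi fc gc gw.
have mn n : meas Iopen (g_ n) by case: (pn n) => /intI_measurable.
have dct (D : set R) : measurable (D : set (measurableTypeR R)) -> D `<=` Iopen ->
    mu.-integrable D (EFin \o g) /\
    (\int[mu]_(x in D) (g_ n x)%:E)%E @[n --> \oo] --> (\int[mu]_(x in D) (g x)%:E)%E.
  move=> mD DI.
  have [|||||h1 _ h2] := @dominated_convergence _ _ R mu D mD
    (fun n x => (g_ n x)%:E) (EFin \o g) (EFin \o w).
  - move=> n; apply/measurable_EFinP.
    by apply: measurable_funS (mn n) => //; exact: measurable_Iopen.
  - by apply/measurable_EFinP; apply: measurable_funS mg => //; exact: measurable_Iopen.
  - apply: aeS gc => x h Dx; apply: cvg_EFin; first by near=> n.
    by apply: h; exact: DI.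
  - by apply: integrableS wi => //; exact: measurable_Iopen.
  - by apply: aeS gw => x h n Dx /=; rewrite lee_fin; apply: h; exact: DI.
  by split.
have gi : intI g by have [] := dct Iopen measurable_Iopen (@subset_refl _ _).
split => // x y x1 xy y1.
have [_ h] := dct `]x, y[%classic (measurable_itv _) (itv_oo_Iopen x1 y1).
have Ix : Iclosed x by rewrite IclosedE x1 (le_trans xy y1).
have Iy : Iclosed y by rewrite IclosedE y1 (le_trans x1 xy).
have c1 : f_ n y - f_ n x @[n --> \oo] --> f y - f x by apply: cvgB; exact: fc.
have c2 : f_ n y - f_ n x @[n --> \oo] --> \int[mu]_(t in `]x, y[) g t.
  have -> : (fun n => f_ n y - f_ n x) = (fun n => \int[mu]_(t in `]x, y[) g_ n t).
    by apply/funext => n; have [_ ->] := pn n.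
  apply: fine_cvg; rewrite /Rintegral fineK//.
  by apply: integrable_fin_num => //; exact: intI_itv.
exact: (@cvg_unique _ (@Rhausdorff R) _ _ _ _ c1 c2).
Unshelve. all: by end_near. Qed.

End InverseCosine.

(** * Liftings and circle-valued maps *)

Section Fold.
Context {R : realType}.
Local Notation mu := (@lebesgue_measure R).
Local Notation meas D f := (@measurable_fun _ _ (measurableTypeR R) R D f).
Implicit Types f g m : R -> R.

Lemma measurable_funV d (T : measurableType d) (D : set T) (f : T -> R) :
  measurable_fun D f -> measurable_fun D (fun x => (f x)^-1).
Proof.
move=> mf.
have -> : (fun x => (f x)^-1) = (fun x => f x * powR (f x ^+ 2) (- 1)).
  apply/funext => x; rewrite powR_inv1 ?sqr_ge0//.
  have [->|f0] := eqVneq (f x) 0; first by rewrite invr0 mul0r.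
  by field.
apply: measurable_funM => //; apply: (measurableT_comp (measurable_powR _)).
exact: measurable_funX.
Qed.

Lemma sqint_le f g : meas Iopen f -> meas Iopen g ->
  {ae mu, forall x, Iopen x -> f x ^+ 2 <= g x ^+ 2} -> (sqint f <= sqint g)%E.
Proof.
move=> mf mg fg; apply: ae_ge0_le_integral; first exact: measurable_Iopen.
- by move=> x _; rewrite lee_fin sqr_ge0.
- by apply/measurable_EFinP; exact: measurable_funX.
- by move=> x _; rewrite lee_fin sqr_ge0.
- by apply/measurable_EFinP; exact: measurable_funX.
- by apply: aeS fg => x h Ix; rewrite lee_fin; exact: h.
Qed.

Lemma L2_le f g : meas Iopen f -> L2 g ->
  {ae mu, forall x, Iopen x -> f x ^+ 2 <= g x ^+ 2} -> L2 f.
Proof.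
move=> mf /L2E[mg gf] fg; apply/L2E; split => //.
exact: le_lt_trans (sqint_le mf mg fg) gf.
Qed.

Lemma sqintD f g : meas Iopen f -> meas Iopen g ->
  (sqint f + sqint g = \int[mu]_(x in Iopen) (f x ^+ 2 + g x ^+ 2)%:E)%E.
Proof.
move=> mf mg; rewrite /sqint -ge0_integralD//.
- exact: measurable_Iopen.
- by move=> x _; rewrite lee_fin sqr_ge0.
- by apply/measurable_EFinP; exact: measurable_funX.
- by move=> x _; rewrite lee_fin sqr_ge0.
- by apply/measurable_EFinP; exact: measurable_funX.
Qed.

Lemma sqintD_le f g h : meas Iopen f -> meas Iopen g -> meas Iopen h ->
  {ae mu, forall x, Iopen x -> f x ^+ 2 + g x ^+ 2 <= h x ^+ 2} ->
  (sqint f + sqint g <= sqint h)%E.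
Proof.
move=> mf mg mh fgh; rewrite sqintD//; apply: ae_ge0_le_integral; first exact: measurable_Iopen.
- by move=> x _; rewrite lee_fin addr_ge0 ?sqr_ge0.
- by apply/measurable_EFinP; apply: measurable_funD; exact: measurable_funX.
- by move=> x _; rewrite lee_fin sqr_ge0.
- by apply/measurable_EFinP; exact: measurable_funX.
- by apply: aeS fgh => x hx Ix; rewrite lee_fin; exact: hx.
Qed.

Lemma prim_cos f g : prim f g -> prim (cos \o f) (fun x => - sin (f x) * g x).
Proof.
move=> pf; have [M hM] := cont11_bounded (prim_cont pf).
apply: (@prim_chain R f g (- (M + 1)) (M + 1) (@cos R) (fun u => - sin u)); first exact: pf.
- by move=> x /hM; rewrite -ltr_norml => h; apply: le_lt_trans h _; lra.
- by move=> u _; apply: cvgN; exact: continuous_sin.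
Qed.

Lemma prim_sin f g : prim f g -> prim (sin \o f) (fun x => cos (f x) * g x).
Proof.
move=> pf; have [M hM] := cont11_bounded (prim_cont pf).
apply: (@prim_chain R f g (- (M + 1)) (M + 1) (@sin R) (@cos R)) => //.
- by move=> x /hM; rewrite -ltr_norml => h; apply: le_lt_trans h _; lra.
- by move=> u _; exact: continuous_cos.
Qed.

(** In terms of a lifting the exchange energy density is the square of its
    derivative, because sin^2 + cos^2 = 1. *)
Lemma energy_liftE alpha eps f g : prim f g -> L2 g ->
  energy_lift alpha eps f =
  ((eps / 2)%:E * sqint g + half_seminorm alpha (cos \o f))%E.
Proof.
move=> pf lg.
have mg : meas Iopen g by case/L2E: lg.
have pc := prim_cos pf; have ps := prim_sin pf.
have mc : meas Iopen (fun x => - sin (f x) * g x) by case: pc => /intI_measurable.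
have ms : meas Iopen (fun x => cos (f x) * g x) by case: ps => /intI_measurable.
have lc : L2 (fun x => - sin (f x) * g x).
  apply: (L2_le mc lg); apply: aeW => x _; rewrite exprMn sqrrN.
  by rewrite ler_piMl ?sqr_ge0// -(cos2Dsin2 (f x)) lerDr sqr_ge0.
have ls : L2 (fun x => cos (f x) * g x).
  apply: (L2_le ms lg); apply: aeW => x _; rewrite exprMn.
  by rewrite ler_piMl ?sqr_ge0// -(cos2Dsin2 (f x)) lerDl sqr_ge0.
rewrite /energy_lift (energyE _ _ pc lc ps ls); congr (_ * _ + _)%E.
rewrite sqintD//; apply: eq_integral => x _; congr EFin.
by rewrite !exprMn sqrrN -mulrDl addrC cos2Dsin2 mul1r.
Qed.

Lemma H1_cos_sin f : H1 f -> H1_circle (cos \o f) (sin \o f).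
Proof.
move=> /H1P[g pf lg].
have mg : meas Iopen g by case/L2E: lg.
have pc := prim_cos pf; have ps := prim_sin pf.
split; last by move=> x _ /=; rewrite cos2Dsin2.
- apply/H1P; eexists; first exact: pc.
  have mc : meas Iopen (fun x => - sin (f x) * g x) by case: pc => /intI_measurable.
  apply: (L2_le mc lg); apply: aeW => x _; rewrite exprMn sqrrN.
  by rewrite ler_piMl ?sqr_ge0// -(cos2Dsin2 (f x)) lerDr sqr_ge0.
- apply/H1P; eexists; first exact: ps.
  have ms : meas Iopen (fun x => cos (f x) * g x) by case: ps => /intI_measurable.
  apply: (L2_le ms lg); apply: aeW => x _; rewrite exprMn.
  by rewrite ler_piMl ?sqr_ge0// -(cos2Dsin2 (f x)) lerDl sqr_ge0.
Qed.

(** The velocity of a curve on the circle is tangential. *)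
Lemma circle_derivative m1 g1 m2 g2 : prim m1 g1 -> prim m2 g2 ->
  (forall x, Iclosed x -> m1 x ^+ 2 + m2 x ^+ 2 = 1) ->
  {ae mu, forall x, Iopen x -> m1 x * g1 x + m2 x * g2 x = 0}.
Proof.
move=> p1 p2 h.
have p := primD (prim_sqr p1) (prim_sqr p2).
have p0 : prim (fun x => m1 x * m1 x + m2 x * m2 x) (cst 0).
  apply: prim_ext (prim_cst 1) => // x Ix.
  by rewrite -!expr2 h.
apply: aeS (prim_unique p p0) => x e Ix; have := e Ix => /=; lra.
Qed.

(** Folding a circle-valued map onto the upper half circle, by way of
    acos (lambda m1) with lambda < 1, which avoids the singularities of acos. *)
Lemma prim_acos m1 g1 m2 g2 : prim m1 g1 -> prim m2 g2 ->
  (forall x, Iclosed x -> m1 x ^+ 2 + m2 x ^+ 2 = 1) ->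
  prim (acos \o m1) (fun x => - g1 x / `|m2 x|) /\
  {ae mu, forall x, Iopen x -> (- g1 x / `|m2 x|) ^+ 2 <= g1 x ^+ 2 + g2 x ^+ 2}.
Proof.
move=> p1 p2 h.
have ort := circle_derivative p1 p2 h.
have m2E x : Iclosed x -> 1 - m1 x ^+ 2 = m2 x ^+ 2 by move=> /h <-; rewrite addrAC subrr add0r.
have m11 x : Iclosed x -> -1 <= m1 x <= 1.
  move=> /m2E e; rewrite -ler_norml -(@ler_sqr R) ?nnegrE// expr1n.
  by rewrite real_normK ?num_real//; have := sqr_ge0 (m2 x); lra.
have bnd x : Iopen x -> m1 x * g1 x + m2 x * g2 x = 0 ->
    g1 x ^+ 2 = m2 x ^+ 2 * (g1 x ^+ 2 + g2 x ^+ 2).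
  move=> /Iopen_closed/h h1 h0.
  have e : m1 x * g1 x = - (m2 x * g2 x) by lra.
  rewrite mulrDr -exprMn -[X in _ = _ + X]exprMn -[X in _ = _ + X]sqrrN -e exprMn.
  by rewrite [X in _ = _ + X]exprMn -mulrDl addrC h1 mul1r.
have bnd2 x : Iopen x -> m1 x * g1 x + m2 x * g2 x = 0 ->
    (- g1 x / `|m2 x|) ^+ 2 <= g1 x ^+ 2 + g2 x ^+ 2.
  move=> Ix h0; rewrite exprMn sqrrN exprVn real_normK ?num_real//.
  have [->|m20] := eqVneq (m2 x) 0; first by rewrite expr0n invr0 mulr0 addr_ge0 ?sqr_ge0.
  by rewrite {1}(bnd x Ix h0) mulrAC mulfV ?mul1r// expf_eq0.
split; last by apply: aeS ort => x e Ix; apply: bnd2 => //; exact: e.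
pose l (n : nat) : R := n.+1%:R / n.+2%:R.
have l0 n : 0 < l n by rewrite divr_gt0.
have l1 n : l n < 1 by rewrite ltr_pdivrMr// mul1r ltr_nat.
have cl : l n @[n --> \oo] --> (1 : R).
  have -> : l = (fun n => 1 - n.+2%:R^-1).
    apply/funext => n; rewrite /l.
    have -> : n.+1%:R = n.+2%:R - 1 :> R by rewrite -(natr1 n.+1) addrK.
    by rewrite mulrBl mulfV ?mul1r// pnatr_eq0.
  rewrite -[X in _ --> X]subr0; apply: cvgB; first exact: cvg_cst.
  have := @cvg_harmonic R.
  by rewrite -(@cvg_shiftS R^o (fun n => n.+1%:R^-1) (nbhs (0 : R))).
clearbody l.
have lm n x : Iclosed x -> -1 < l n * m1 x < 1.
  move=> /m11 m; rewrite -ltr_norml normrM (gtr0_norm (l0 n)).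
  apply: le_lt_trans (l1 n); rewrite ler_piMr// ?ler_norml//; exact: ltW.
pose dn n x := - l n / Num.sqrt (1 - (l n * m1 x) ^+ 2) * g1 x.
have pn n : prim (fun x => acos (l n * m1 x)) (dn n).
  have := @prim_chain R _ _ (-1) 1 acos (fun u => - (Num.sqrt (1 - u ^+ 2))^-1) (primZ (l n) p1)
      (lm n).
  move=> /(_ (fun u hu => is_derive1_acos hu)) H.
  have : prim (acos \o (fun x => l n * m1 x)) (fun x => - (Num.sqrt (1 - (l n * m1 x) ^+ 2))^-1 *
      (l n * g1 x)).
    apply: H => u hu; apply: cvgN; apply: cvgV.
      by rewrite sqrtr_eq0 -ltNge subr_gt0 -real_normK ?num_real// expr_lt1 ?ltr_norml.
    apply: (continuous_comp (f := fun u : R => 1 - u ^+ 2)); last exact: sqrt_continuous.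
    apply: cvgB; first exact: cvg_cst.
    by apply: cvgM; exact: cvg_id.
  by apply: prim_ext => // x _; rewrite /dn; ring.
have pos n x : Iclosed x -> m2 x ^+ 2 <= 1 - (l n * m1 x) ^+ 2.
  move=> Ix; rewrite -m2E// lerD2l lerN2 exprMn ler_piMl ?sqr_ge0//.
  by rewrite expr_le1 ?ltW.
apply: (@prim_limit R (fun n x => acos (l n * m1 x)) dn _ _ (fun x => `|g1 x| + `|g2 x|) pn).
- case: p1 => /intI_measurable mg1 _.
  apply: measurable_funM; first exact: measurable_funN.
  apply: measurable_funV; apply: measurableT_comp; first exact: normr_measurable.
  by apply: cont11_meas; exact: prim_cont p2.
- have i1 : intI (fun x => `|g1 x|) by apply: integrable_norm; case: p1.
  have i2 : intI (fun x => `|g2 x|) by apply: integrable_norm; case: p2.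
  exact: intID i1 i2.
- move=> x Ix; apply/cvgrPdist_lt => e e0.
  have : l n * m1 x @[n --> \oo] --> 1 * m1 x by apply: cvgM => //; exact: cvg_cst.
  move=> /cvgrPdist_lt/(_ (e ^+ 2 / 8)) H.
  have {}H := H (divr_gt0 (exprn_gt0 2 e0) (ltr0n _ 8)).
  near=> n.
  have hn : `|1 * m1 x - l n * m1 x| < e ^+ 2 / 8 by near: n.
  rewrite -(@ltr_sqr R) ?nnegrE// ?(ltW e0)// real_normK ?num_real//.
  have /andP[/ltW u1 /ltW u2] := lm n x Ix.
  have lmn : -1 <= l n * m1 x <= 1 by rewrite u1 u2.
  apply: (le_lt_trans (acos_dist (m11 x Ix) lmn)).
  by rewrite mulrC -ltr_pdivlMr// -{1}(mul1r (m1 x)).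
- apply: aeS ort => x e0 Ix; have e := e0 Ix.
  have Ix' := Iopen_closed Ix.
  have [m20|m20] := eqVneq (m2 x) 0.
    have g10 : g1 x = 0.
      by apply/eqP; rewrite -sqrf_eq0 (bnd x Ix e) m20 expr0n mul0r.
    rewrite /dn g10 oppr0 mul0r.
    by under eq_fun do rewrite mulr0; exact: cvg_cst.
  have -> : - g1 x / `|m2 x| = - 1 / Num.sqrt (1 - (1 * m1 x) ^+ 2) * g1 x.
    by rewrite mul1r m2E// sqrtr_sqr; ring.
  apply: cvgM; last exact: cvg_cst.
  apply: cvgM; first exact: cvgN.
  apply: cvgV.
    by rewrite mul1r m2E// sqrtr_sqr normr_eq0.
  apply: (@cvg_comp _ _ _ (fun n => 1 - (l n * m1 x) ^+ 2) Num.sqrt); last exact: sqrt_continuous.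
  apply: cvgB; first exact: cvg_cst.
  by apply: cvgM; apply: cvgM => //; exact: cvg_cst.
- apply: aeS ort => x e0 Ix n; have e := e0 Ix.
  have Ix' := Iopen_closed Ix.
  rewrite -(@ler_sqr R) ?nnegrE ?addr_ge0// real_normK ?num_real//.
  apply: (@le_trans _ _ (g1 x ^+ 2 + g2 x ^+ 2)); last first.
    rewrite -[X in X + _]real_normK ?num_real// -[X in _ + X]real_normK ?num_real//.
    by rewrite sqrrD -addrA lerD2l lerDr -mulr_natr !mulr_ge0.
  have p0 : 0 < 1 - (l n * m1 x) ^+ 2.
    by rewrite subr_gt0 -real_normK ?num_real// expr_lt1 ?ltr_norml//; exact: lm.
  rewrite /dn 2!exprMn sqrrN exprVn sqr_sqrtr ?(ltW p0)//.
  have bx := bnd x Ix e; set S := g1 x ^+ 2 + g2 x ^+ 2 in bx *.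
  have S0 : 0 <= S by rewrite addr_ge0 ?sqr_ge0.
  have l2 : l n ^+ 2 <= 1 by rewrite expr_le1 ?ltW.
  rewrite mulrAC ler_pdivrMr// bx mulrA [leRHS]mulrC; apply: ler_wpM2r => //.
  by apply: le_trans (pos n x Ix'); rewrite ler_piMl// sqr_ge0.
Unshelve. all: by end_near. Qed.

End Fold.

(** * Truncation of primitives *)

Section AbsoluteValue.
Context {R : realType}.
Local Notation mu := (@lebesgue_measure R).
Local Notation meas D f := (@measurable_fun _ _ (measurableTypeR R) R D f).
Implicit Types f g : R -> R.

Definition smooth_abs (n : nat) (x : R) := Num.sqrt (x * x + n.+1%:R^-1).

Lemma smooth_abs_gt0 n x : 0 < smooth_abs n x.
Proof. by rewrite sqrtr_gt0 ltr_wpDl ?invr_gt0// -expr2 sqr_ge0. Qed.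

Lemma is_derive_smooth_abs n (x : R) :
  is_derive x (1 : R) (smooth_abs n) (x / smooth_abs n x).
Proof.
have x0 : 0 < x * x + n.+1%:R^-1 by rewrite ltr_wpDl ?invr_gt0// -expr2 sqr_ge0.
have d1 : is_derive x (1 : R) (fun x : R => x * x + n.+1%:R^-1) (2 * x).
  have h := is_deriveD (is_deriveM (is_derive_id x (1 : R)) (is_derive_id x (1 : R)))
      (is_derive_cst (n.+1%:R^-1 : R) x (1 : R)).
  by apply: (is_derive_eq h); rewrite addr0 /GRing.scale/=; ring.
have d2 := @is_derive1_comp _ (@Num.sqrt R) (fun x : R => x * x + n.+1%:R^-1) x _ _
    (is_derive1_sqrt x0) d1.
apply: (is_derive_eq d2).
rewrite /GRing.scale/= -/(smooth_abs n x) invfM; have := smooth_abs_gt0 n x.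
by move: (smooth_abs n x) => y y0; field; rewrite gt_eqF.
Qed.

Lemma smooth_abs_ge n x : `|x| <= smooth_abs n x.
Proof.
rewrite /smooth_abs -sqrtr_sqr ler_sqrt; last by rewrite addr_ge0// -expr2 sqr_ge0.
by rewrite expr2 lerDl.
Qed.

Lemma smooth_abs_derive_le n x : `|x / smooth_abs n x| <= 1.
Proof.
have y0 := smooth_abs_gt0 n x.
by rewrite normrM normfV (gtr0_norm y0) ler_pdivrMr// mul1r smooth_abs_ge.
Qed.

Lemma cvg_smooth_abs x : smooth_abs n x @[n --> \oo] --> `|x|.
Proof.
rewrite -sqrtr_sqr.
apply: (@continuous_cvg _ _ _ _ _ (fun n => x * x + n.+1%:R^-1) (@Num.sqrt R)).
  exact: sqrt_continuous.
rewrite -[X in _ --> X]addr0 expr2; apply: cvgD; first exact: cvg_cst.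
exact: cvg_harmonic.
Qed.

Lemma continuous_smooth_abs n : continuous (smooth_abs n).
Proof.
move=> x; apply: differentiable_continuous; apply/derivable1_diffP.
by case: (is_derive_smooth_abs n x).
Qed.

(** With the convention 0 / 0 = 0 the derivative at zeros of f is 0, the limit of
    the derivatives of the smooth approximations. *)
Lemma prim_norm f g : prim f g -> prim (fun x => `|f x|) (fun x => f x / `|f x| * g x).
Proof.
move=> fg; have cf := prim_cont fg; have gi := fg.1.
have cont n : continuous (fun x : R => x / smooth_abs n x).
  move=> x; apply: cvgM; first exact: cvg_id.
  by apply: cvgV; [rewrite gt_eqF// smooth_abs_gt0 | exact: continuous_smooth_abs].
have [M hM] := cont11_bounded cf.
have mf := cont11_meas cf.
apply: (@prim_limit _ (fun n x => smooth_abs n (f x)) (fun n x => f x / smooth_abs n (f x) * g x)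
    _ _ (fun x => `|g x|)).
- move=> n; apply: (@prim_chain _ f g (- (M + 1)) (M + 1) (smooth_abs n) (fun x => x / smooth_abs
    n x) fg).
  + by move=> x /hM; rewrite ler_norml => /andP[h1 h2]; apply/andP; split; lra.
  + by move=> u _; exact: is_derive_smooth_abs.
  + by move=> u _; exact: cont.
- apply: measurable_funM; last exact: intI_measurable gi.
  apply: measurable_funM => //; apply: measurable_funV.
  exact: measurableT_comp (@normr_measurable _ _) mf.
- exact: integrable_norm.
- by move=> x _; exact: cvg_smooth_abs.
- apply: aeW => x _; apply: cvgMl; have [->|f0] := eqVneq (f x) 0.
    by under eq_fun do rewrite mul0r; rewrite mul0r; exact: cvg_cst.
  apply: cvgM; first exact: cvg_cst.
  by apply: cvgV; [rewrite normr_eq0|exact: cvg_smooth_abs].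
- apply: aeW => x _ n; rewrite normrM -[leRHS]mul1r; apply: ler_wpM2r => //.
  exact: smooth_abs_derive_le.
Qed.

(** Truncating at alpha from above and from below splits the derivative. *)
Lemma prim_split f g (alpha : R) : prim f g ->
  exists g1 g2 : R -> R, [/\ prim (fun x => Num.min (f x) alpha) g1,
    prim (fun x => Num.max (f x) alpha) g2 &
    forall x, g1 x ^+ 2 + g2 x ^+ 2 <= g x ^+ 2].
Proof.
move=> fg.
have fa : prim (fun x => f x - alpha) g.
  have := primB fg (prim_cst alpha).
  by apply: prim_ext => x _ //=; rewrite subr0.
have na := prim_norm fa.
pose s x := (f x - alpha) / `|f x - alpha|.
have sa : prim (fun x => f x + alpha) g.
  have := primD fg (prim_cst alpha).
  by apply: prim_ext => x _ //=; rewrite addr0.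
exists (fun x => 2^-1 * (g x - s x * g x)), (fun x => 2^-1 * (g x + s x * g x)).
split.
- have := primZ 2^-1 (primB sa na).
  by apply: prim_ext => x _ //=; rewrite mulrC; exact/esym/minr_absE.
- have := primZ 2^-1 (primD sa na).
  by apply: prim_ext => x _ //=; rewrite mulrC; exact/esym/maxr_absE.
- move=> x.
  have s1 : s x ^+ 2 <= 1.
    rewrite /s; have [->|h] := eqVneq (f x - alpha) 0; first by rewrite mul0r expr0n/=.
    by rewrite expr_div_n real_normK ?num_real// divff// expf_neq0.
  rewrite [leLHS](_ : _ = g x ^+ 2 * ((1 + s x ^+ 2) / 2)); last by field.
  rewrite -[leRHS]mulr1; apply: ler_wpM2l; first exact: sqr_ge0.
  by lra.
Qed.

End AbsoluteValue.

(** * Measures with densities *)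

Section Density.
Context {R : realType}.
Local Notation mu := (@lebesgue_measure R).
Local Notation T := (measurableTypeR R).

Definition density (v : T -> R) (v0 : forall x, 0 <= v x)
  (vi : mu.-integrable setT (EFin \o v)) (A : set T) : \bar R :=
  (\int[mu]_(x in A) (v x)%:E)%E.

Section DensityMeasure.
Variables (v : T -> R) (v0 : forall x, 0 <= v x).
Variable (vi : mu.-integrable setT (EFin \o v)).
Local Notation nu := (density v0 vi).

Let nu_set0 : nu set0 = 0%E.
Proof. by rewrite /density integral_set0. Qed.

Let nu_ge0 A : (0 <= nu A)%E.
Proof. by apply: integral_ge0 => x _; rewrite lee_fin. Qed.

Let nu_additive : semi_sigma_additive nu.
Proof.
move=> A mA tA mUA; rewrite /density integral_bigcup//; last exact: integrableS vi.
by apply: is_cvg_ereal_nneg_natsum_cond => n _ _; exact: nu_ge0.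
Qed.

HB.instance Definition _ := isMeasure.Build _ _ _ nu nu_set0 nu_ge0 nu_additive.

Let nu_finite : fin_num_fun nu.
Proof.
move=> A mA; apply: integrable_fin_num => //.
by apply: integrableS vi.
Qed.

HB.instance Definition _ := @Measure_isFinite.Build _ _ _ nu nu_finite.

Lemma density_dominates : nu `<< mu.
Proof.
apply/null_content_dominatesP => A mA A0; rewrite /density.
apply: null_set_integral => //.
by move: (integrableS measurableT mA (@subsetT _ _) vi) => /integrableP[].
Qed.

Lemma integral_density (G : T -> \bar R) : measurable_fun setT G ->
  (forall x, 0 <= G x)%E ->
  (\int[nu]_x G x = \int[mu]_x (G x * (v x)%:E))%E.
Proof.
move=> mG G0; have dom := density_dominates.
rewrite -(Radon_Nikodym_SigmaFinite.change_of_variables dom)//.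
have fi := Radon_Nikodym_SigmaFinite.f_integrable dom.
have mf : measurable_fun setT (Radon_Nikodym_SigmaFinite.f nu mu).
  by move: fi => /integrableP[].
have mv : measurable_fun setT (EFin \o v) by move: vi => /integrableP[].
apply: ge0_ae_eq_integral => //.
- exact: emeasurable_funM.
- exact: emeasurable_funM.
- by move=> x _; rewrite mule_ge0// Radon_Nikodym_SigmaFinite.f_ge0.
- by move=> x _; rewrite mule_ge0// lee_fin.
have h : ae_eq mu setT (Radon_Nikodym_SigmaFinite.f nu mu) (EFin \o v).
  apply: integral_ae_eq => // E _ mE.
  by rewrite -Radon_Nikodym_SigmaFinite.f_integral.
by apply: aeS h => x e _; rewrite e.
Qed.

End DensityMeasure.
End Density.

(** * Diffeomorphisms of the interval *)

Section ChangeOfVariables.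
Context {R : realType}.
Local Notation mu := (@lebesgue_measure R).
Local Notation T := (measurableTypeR R).
Local Notation meas D f := (@measurable_fun _ _ (measurableTypeR R) R D f).
Implicit Types f g psi w : R -> R.

Definition diffeo psi w :=
  [/\ forall x : R, is_derive x (1 : R) psi (w x), continuous w,
      forall x, Iclosed x -> 0 < w x, psi (-1) = -1 & psi 1 = 1].

Lemma diffeo_id : diffeo id (cst 1).
Proof.
split => //; [by move=> x; exact: is_derive_id | by move=> x; exact: cvg_cst].
Qed.

Lemma diffeo_continuous psi w : diffeo psi w -> continuous psi.
Proof.
move=> [d _ _ _ _] x; apply: differentiable_continuous; apply/derivable1_diffP.
by case: (d x).
Qed.

Lemma diffeo_lt psi w (x y : R) : diffeo psi w -> -1 <= x -> x < y -> y <= 1 ->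
  psi x < psi y.
Proof.
move=> dp x1 xy y1; have [d _ w0 _ _] := dp.
have [|c] := @MVT R psi w x y xy (fun t _ => d t).
  exact/continuous_subspaceT/diffeo_continuous/dp.
rewrite in_itv/= => /andP[xc cy] e.
rewrite -subr_gt0 e mulr_gt0 ?subr_gt0// w0// IclosedE.
by rewrite (le_trans x1 (ltW xc)) (le_trans (ltW cy) y1).
Qed.

Lemma diffeo_lt_mono psi w : diffeo psi w ->
  {in Iclosed &, {mono psi : x y / x < y}}.
Proof.
move=> dp x y; rewrite !inE !IclosedE => /andP[x0 x1] /andP[y0 y1].
have [xy|yx|->] := ltgtP x y; last by rewrite !ltxx.
- by rewrite (diffeo_lt dp).
- by apply/negbTE; rewrite -leNgt ltW// (diffeo_lt dp).
Qed.

Lemma diffeo_le_mono psi w : diffeo psi w ->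
  {in Iclosed &, {mono psi : x y / x <= y}}.
Proof. by move=> dp x y Ix Iy; rewrite !leNgt (diffeo_lt_mono dp Iy Ix). Qed.

Lemma diffeo_Iopen psi w x : diffeo psi w -> Iclosed x -> Iopen (psi x) <-> Iopen x.
Proof.
move=> dp Ix; have [_ _ _ p0 p1] := dp.
have I0 : -1 \in @Iclosed R by rewrite inE IclosedE; lra.
have I1 : 1 \in @Iclosed R by rewrite inE IclosedE; lra.
have Ixx : x \in @Iclosed R by rewrite inE.
have a := diffeo_lt_mono dp I0 Ixx; have b := diffeo_lt_mono dp Ixx I1.
by rewrite p0 in a; rewrite p1 in b; rewrite !IopenE a b.
Qed.

Lemma diffeo_Iclosed psi w x : diffeo psi w -> Iclosed x -> Iclosed (psi x).
Proof.
move=> dp Ix; have [_ _ _ p0 p1] := dp.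
have I0 : -1 \in @Iclosed R by rewrite inE IclosedE; lra.
have I1 : 1 \in @Iclosed R by rewrite inE IclosedE; lra.
have Ixx : x \in @Iclosed R by rewrite inE.
have a := diffeo_le_mono dp I0 Ixx; have b := diffeo_le_mono dp Ixx I1.
by rewrite p0 in a; rewrite p1 in b; rewrite IclosedE a b -IclosedE.
Qed.

Lemma diffeo_surj psi w y : diffeo psi w -> Iclosed y ->
  exists2 x, Iclosed x & psi x = y.
Proof.
move=> dp; have [_ _ _ p0 p1] := dp; rewrite IclosedE => /andP[y0 y1].
have c : {within `[-1, 1], continuous psi}.
  exact/continuous_subspaceT/diffeo_continuous/dp.
have hy : Num.min (psi (-1)) (psi 1) <= y <= Num.max (psi (-1)) (psi 1).
  by rewrite p0 p1 ge_min le_max y0 y1 orbT.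
have [x hx e] := IVT (ltac:(lra) : (-1 : R) <= 1) c hy.
by exists x => //; rewrite IclosedE; move: hx; rewrite in_itv.
Qed.

(** Truncation to [-1, 1] reduces statements on arbitrary intervals to intervals
    between points of [-1, 1]. *)
Definition clip (x : R) : R := Num.max (-1) (Num.min 1 x).

Lemma clip_Iclosed x : Iclosed (clip x).
Proof.
by rewrite IclosedE /clip le_max lexx ge_max ge_min lexx/= andbT; lra.
Qed.

Lemma clip_lt x t : Iopen t -> (clip x < t) = (x < t).
Proof.
rewrite IopenE => /andP[t0 t1]; rewrite /clip gt_max gt_min t0/=.
by case: (ltP 1 t) => //= h; have := lt_trans t1 (lt_le_trans h (lexx _)); rewrite ltxx.
Qed.

Lemma clip_ge x t : Iopen t -> (t <= clip x) = (t <= x).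
Proof. by move=> It; rewrite leNgt clip_lt// -leNgt. Qed.

Lemma clip_homo x y : x <= y -> clip x <= clip y.
Proof.
move=> xy; rewrite /clip ge_max le_max lexx/= le_max.
apply/orP; right; by rewrite le_min !ge_min lexx xy/= orbT.
Qed.

(** By monotonicity the preimage of an interval is an interval, on which w
    integrates to an increment of psi. *)
Lemma integral_preimage_itv psi w (a b : R) : diffeo psi w -> a <= b ->
  (\int[mu]_(x in psi @^-1` `]a, b]) ((w \_ Iopen) x)%:E = (clip b - clip a)%:E)%E.
Proof.
move=> dp ab; have [d cw w0 p0 p1] := dp.
have [x Ix ex] := diffeo_surj dp (clip_Iclosed a).
have [y Iy ey] := diffeo_surj dp (clip_Iclosed b).
have xy : x <= y.
  by rewrite -(diffeo_le_mono dp) ?inE// ex ey clip_homo.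
transitivity (\int[mu]_(t in `]x, y]) ((w \_ Iopen) t)%:E)%E.
  rewrite integral_mkcond [RHS]integral_mkcond; apply: eq_integral => t _.
  rewrite !patchE; have [It|nIt] := pselect (Iopen t); last first.
    by rewrite (memNset nIt); case: ifP => _; case: ifP.
  have It' := Iopen_closed It; have Ipt : Iopen (psi t) by apply/(diffeo_Iopen dp It').
  have e1 := clip_lt a Ipt; have e2 := clip_ge b Ipt.
  rewrite -ex (diffeo_lt_mono dp) ?inE// in e1.
  rewrite -ey (diffeo_le_mono dp) ?inE// in e2.
  congr (if _ then _ else _); apply/idP/idP; rewrite !inE /= !in_itv/= e1 e2; exact.
have Ixy : (-1 <= x) /\ (y <= 1) by move: Ix Iy; rewrite !IclosedE => /andP[-> _] /andP[_ ->].
have ecw : {in `]x, y[%classic, (fun t => ((w \_ Iopen) t)%:E) =1 EFin \o w}.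
  by move=> t; rewrite inE => /(itv_oo_Iopen Ixy.1 Ixy.2) It; rewrite patchE mem_set.
rewrite -integral_itv_bndo_bndc; last first.
  apply/measurable_EFinP; apply: (eq_measurable_fun w).
    by move=> t ht; have [] := ecw t ht.
  by apply: continuous_meas => //; exact: measurable_itv.
rewrite (_ : (\int[mu]_(t in _) _)%E = (\int[mu]_(t in `]x, y[) (w t)%:E)%E); last first.
  by apply: eq_integral => t ht; exact: ecw.
rewrite -ey -ex -(integral_itv_derive xy d cw) /Rintegral fineK//.
apply: integrable_fin_num => //; apply: intI_itv => //; try by case: Ixy.
exact: intI_continuous.
Qed.

(** The pushforward of w dx under psi is dx, because both measures give the
    same mass to half-open intervals; general integrands then follow by viewing
    w as a Radon-Nikodym derivative. *)
Lemma change_of_variables psi w (G : R -> \bar R) : diffeo psi w ->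
  @measurable_fun _ _ T _ Iopen G ->
  (forall x, Iopen x -> 0 <= G x)%E ->
  (\int[mu]_(x in Iopen) G x = \int[mu]_(x in Iopen) (G (psi x) * (w x)%:E))%E.
Proof.
move=> dp mG G0; have [d cw w0 p0 p1] := dp.
have mI := @measurable_Iopen R.
have wI x : Iopen x -> 0 <= w x by move=> /Iopen_closed/w0/ltW.
pose v : T -> R := w \_ Iopen.
have v0 x : 0 <= v x by rewrite /v patchE; case: ifP => //; rewrite inE; exact: wI.
have vi : mu.-integrable setT (EFin \o v).
  rewrite (_ : EFin \o v = (EFin \o w) \_ Iopen); last by rewrite restrict_EFin.
  by rewrite -integrable_mkcond//; exact: intI_continuous.
have mv : measurable_fun setT v by move: vi => /integrableP[/measurable_EFinP].
have cpsi := diffeo_continuous dp.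
have mpsi : @measurable_fun _ _ T T setT psi by exact: continuous_meas.
pose m1_ : {measure set T -> \bar R} := pushforward (density v0 vi) (psi : T -> T).
pose m1 := m1_ mpsi.
pose m2 : {measure set T -> \bar R} := mrestr mu (measurableC mI).
have m2E (A : set T) : m2 A = mu (A `&` ~` Iopen) by [].
have itvE (a b : R) : mu (`]a, b]%classic `&` Iopen) = m1 `]a, b]%classic.
  have [ab|/ltW ba] := leP a b; last first.
    by rewrite set_itv_ge ?bnd_simp -?leNgt// set0I !measure0.
  transitivity (\int[mu]_(x in psi @^-1` `]a, b]%classic) ((w \_ Iopen) x)%:E)%E; last by [].
  rewrite (integral_preimage_itv dp ab).
  rewrite -(integral_preimage_itv diffeo_id ab) preimage_id.
  rewrite setIC -integral_indic//.
  rewrite integral_mkcond [RHS]integral_mkcond; apply: eq_integral => x _.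
  rewrite !patchE indicE.
  by case: (x \in Iopen); case: (x \in `]a, b]%classic).
have key (A : set T) : measurable A -> A `<=` Iopen -> mu A = m1 A.
  move=> mA AI.
  have := @lebesgue_measure_unique R (measure_add m1 m2) _ A mA.
  move=> ->.
    transitivity (m1 A + m2 A)%E; first exact: measure_addE.
    rewrite m2E (_ : A `&` ~` Iopen = set0) ?measure0 ?adde0//.
    by apply/seteqP; split => // x [/AI].
  move=> _ [[a b] _ <-] /=.
  transitivity (m1 `]a, b]%classic + m2 `]a, b]%classic)%E; last first.
    exact/esym/measure_addE.
  rewrite -itvE m2E -measureU//.
  - by rewrite -setIUr setUv setIT.
  - by apply: measurableI => //; exact: measurable_itv.
  - by apply: measurableI; [exact: measurable_itv | exact: measurableC].
  - by rewrite setIACA setICr setI0.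
rewrite (@eq_measure_integral _ T R _ m1 mu) => [|A mA AI]; last by rewrite -key.
rewrite (@ge0_integral_pushforward _ _ T T R psi mpsi (density v0 vi))//; last first.
  by move=> x; rewrite inE; exact: G0.
rewrite integral_mkcond integral_density.
- rewrite [RHS]integral_mkcond; apply: eq_integral => x _.
  rewrite !patchE /v patchE; case: (boolP (x \in Iopen)) => [|]; last by rewrite mule0.
  rewrite inE => Ix; rewrite mem_set//=.
  exact/(diffeo_Iopen dp (Iopen_closed Ix)).
- apply/(measurable_restrictT _ _).1 => //.
    by have := mpsi measurableT Iopen mI; rewrite setTI.
  apply: (measurable_comp mI) => //; first by move=> _ [x + <-].
  exact: measurable_funTS.
- by move=> x; rewrite patchE; case: ifP => //; rewrite inE => /G0.
Qed.

Lemma diffeo_comp_meas psi w g : diffeo psi w -> meas Iopen g -> meas Iopen (g \o psi).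
Proof.
move=> dp mg; apply: (measurable_comp (@measurable_Iopen R)) mg _.
  by move=> _ [x Ix <-]; apply/(diffeo_Iopen dp (Iopen_closed Ix)).
apply: continuous_meas; [exact: measurable_Iopen | exact: diffeo_continuous dp].
Qed.

Lemma change_of_variables_R psi w g : diffeo psi w -> intI g ->
  intI (fun x => g (psi x) * w x) /\
  \int[mu]_(x in Iopen) (g (psi x) * w x) = \int[mu]_(x in Iopen) g x.
Proof.
move=> dp gi; have [d cw w0 p0 p1] := dp.
have mg := intI_measurable gi; have mI := @measurable_Iopen R.
have mgw : meas Iopen (fun x => g (psi x) * w x).
  by apply: measurable_funM; [exact: diffeo_comp_meas dp mg | exact: continuous_meas].
have wI x : Iopen x -> 0 <= w x by move=> /Iopen_closed/w0/ltW.
have part (h : R -> R) : meas Iopen h -> (forall x, Iopen x -> 0 <= h x) ->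
    (\int[mu]_(x in Iopen) (h (psi x) * w x)%:E = \int[mu]_(x in Iopen) (h x)%:E)%E.
  move=> mh h0; rewrite (@change_of_variables psi w (EFin \o h) dp)//.
  exact/measurable_EFinP.
split.
  apply/integrableP; split; first exact/measurable_EFinP.
  have ma : meas Iopen (fun x => `|g x|).
    by apply: measurableT_comp => //; exact: normr_measurable.
  have := part (fun x => `|g x|) ma (fun x _ => normr_ge0 _).
  move: gi => /integrableP[_ gf] e.
  rewrite (_ : (\int[mu]_(x in Iopen) _)%E = (\int[mu]_(x in Iopen) `|g x|%:E)%E)// -e.
  by apply: eq_integral => x; rewrite inE => Ix /=; rewrite normrM (ger0_norm (wI x Ix)).
congr fine.
have mp : meas Iopen (fun x => Num.max (g x) 0) by exact: measurable_maxr.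
have mn : meas Iopen (fun x => Num.max (- g x) 0).
  by apply: measurable_maxr => //; exact: measurable_funN.
have ep := part _ mp (fun x _ => ltac:(by rewrite le_max lexx orbT)).
have en := part _ mn (fun x _ => ltac:(by rewrite le_max lexx orbT)).
rewrite integralE [RHS]integralE; congr (_ - _)%E.
- transitivity (\int[mu]_(x in Iopen) (Num.max (g (psi x)) 0 * w x)%:E)%E.
    apply: eq_integral => x; rewrite inE => Ix; rewrite unlock -EFin_max.
    by rewrite maxr_pMl ?mul0r// wI.
  by rewrite ep; apply: eq_integral => x _; rewrite unlock -EFin_max.
- transitivity (\int[mu]_(x in Iopen) (Num.max (- g (psi x)) 0 * w x)%:E)%E.
    apply: eq_integral => x; rewrite inE => Ix; rewrite unlock -EFinN -EFin_max.
    by rewrite maxr_pMl ?mul0r ?mulNr// wI.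
  by rewrite en; apply: eq_integral => x _; rewrite unlock -EFinN -EFin_max.
Qed.

Lemma prim_comp psi w f g : diffeo psi w -> prim f g ->
  prim (f \o psi) (fun x => g (psi x) * w x).
Proof.
move=> dp [gi hf]; have [gwi _] := change_of_variables_R dp gi.
split => // x y x1 xy y1.
have Ix : Iclosed x by rewrite IclosedE x1 (le_trans xy y1).
have Iy : Iclosed y by rewrite IclosedE y1 (le_trans x1 xy).
have := diffeo_Iclosed dp Ix; have := diffeo_Iclosed dp Iy.
rewrite !IclosedE => /andP[_ py1] /andP[px1 _].
rewrite /= hf//; last by rewrite (diffeo_le_mono dp) ?inE.
pose h := g \_ `]psi x, psi y[.
have hi : intI h.
  rewrite /intI (_ : EFin \o h = (EFin \o g) \_ `]psi x, psi y[); last by rewrite restrict_EFin.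
  apply/integrable_restrict; [exact: measurable_itv | exact: measurable_Iopen|].
  by rewrite setIC (setIidl (itv_oo_Iopen px1 py1)); exact: intI_itv.
have [_] := change_of_variables_R dp hi.
rewrite -Rintegral_mkcondl (setIidl (itv_oo_Iopen px1 py1)) => <-.
rewrite -(setIidl (itv_oo_Iopen x1 y1)) Rintegral_mkcondl.
apply: eq_Rintegral => t; rewrite inE => It; have It' := Iopen_closed It.
rewrite /h !patchE; case: ifPn => ht; case: ifPn => ht'; rewrite ?mul0r//; exfalso.
  move: ht ht'; rewrite inE notin_setE /= !in_itv/= => /andP[h1 h2]; apply.
  rewrite !(diffeo_lt_mono dp) ?inE// in h1 h2.
  by rewrite h1 h2.
move: ht ht'; rewrite inE notin_setE /= !in_itv/= => ht /andP[h1 h2]; apply: ht.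
by rewrite !(diffeo_lt_mono dp) ?inE// h1 h2.
Qed.

Lemma sqint_comp psi w g (M : R) : diffeo psi w -> meas Iopen g ->
  (forall x, Iopen x -> w x <= M) ->
  (sqint (fun x => g (psi x) * w x)%R <= M%:E * sqint g)%E.
Proof.
move=> dp mg wM; have [d cw w0 p0 p1] := dp; have mI := @measurable_Iopen R.
have wI x : Iopen x -> 0 <= w x by move=> /Iopen_closed/w0/ltW.
have M0 : 0 <= M by apply: le_trans (wI 0 _) (wM 0 _); rewrite IopenE; lra.
have mgp := diffeo_comp_meas dp mg.
have mw : meas Iopen w by exact: continuous_meas.
rewrite /sqint (@change_of_variables psi w (fun x => (g x ^+ 2)%:E) dp); last 2 first.
- by apply/measurable_EFinP; exact: measurable_funX.
- by move=> x _; rewrite lee_fin sqr_ge0.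
rewrite -ge0_integralZl_EFin//; last 2 first.
- by move=> x Ix; rewrite -EFinM lee_fin mulr_ge0 ?sqr_ge0 ?wI.
- apply/measurable_EFinP; apply: measurable_funM => //.
  by apply: (@measurable_funX _ _ _ _ (g \o psi)).
apply: ge0_le_integral => //.
- by move=> x _; rewrite lee_fin sqr_ge0.
- by apply/measurable_EFinP; apply: measurable_funX; exact: measurable_funM.
- apply/measurable_EFinP; apply: measurable_funM => //; apply: measurable_funM => //.
  by apply: (@measurable_funX _ _ _ _ (g \o psi)).
- move=> x Ix; rewrite -!EFinM lee_fin exprMn expr2.
  rewrite [leLHS](_ : _ = w x * (g (psi x) * g (psi x) * w x)); last by ring.
  apply: ler_wpM2r; last exact: wM.
  by rewrite mulr_ge0 ?wI// -expr2 sqr_ge0.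
Qed.

End ChangeOfVariables.

(** * Deformations of the kernel *)

Section Tame.
Context {R : realType}.
Local Notation mu := (@lebesgue_measure R).
Local Notation T := (measurableTypeR R).
Local Notation meas2 q := (@measurable_fun _ _ (T * T)%type R setT (fun z => q z.1 z.2)).

Definition sep_continuous (q : R -> R -> R) :=
  forall u : R, continuous (q u) /\ continuous (q ^~ u).

Definition bounded2 (q : R -> R -> R) (B : R) :=
  forall u v, Iclosed u -> Iclosed v -> `|q u v| <= B.

(** Iterated divided differences, as polynomials have them: q is the divided
    difference of p, r that of q at a double point, and s that of the
    antisymmetric part of r.  The kernel defect is a rational expression in
    these. *)
Record tame (p : R -> R) (q r s : R -> R -> R) : Prop := Tame {
  tame_q : forall u v, p u - p v = (u - v) * q u v;
  tame_r : forall u v, q u u - q u v = (u - v) * r u v;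
  tame_s : forall u v, r u v - r v u = (u - v) * s u v;
  tame_sym : forall u v, q u v = q v u;
  tame_meas : [/\ meas2 q, meas2 r & meas2 s];
  tame_cont : [/\ sep_continuous q, sep_continuous r & sep_continuous s];
  tame_bound : exists B : R, [/\ bounded2 q B, bounded2 r B & bounded2 s B] }.

Lemma tame_derive p q r s : tame p q r s ->
  forall x : R, is_derive x (1 : R) p (q x x).
Proof.
move=> t x.
have h : h^-1 *: ((p \o shift x) (h *: (1 : R)) - p x) @[h --> 0^'] --> q x x.
  have -> : (fun h => h^-1 *: ((p \o shift x) (h *: (1 : R)) - p x)) =
            (fun h => h^-1 * (h * q (h + x) x)).
    apply/funext => h; rewrite /GRing.scale/= mulr1 (tame_q t).
    by rewrite addrK.
  have c : q (h + x) x @[h --> 0^'] --> q x x.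
    have [/(_ x)[_ /(_ x) cq] _ _] := tame_cont t.
    apply: (@cvg_comp _ _ _ (fun h : R => h + x) (fun y => q y x) _ (nbhs x) _ _ cq).
    have c0 : h + x @[h --> (0 : R)^'] --> 0 + x.
      by apply: cvgD; [exact: cvg_within | exact: cvg_cst].
    by rewrite add0r in c0.
  apply: cvg_trans c; apply: near_eq_cvg; near=> h.
  by rewrite mulKf//; near: h; exact: nbhs_dnbhs_neq.
apply: DeriveDef; first by apply/cvg_ex; exists (q x x).
exact/cvg_lim.
Unshelve. all: by end_near. Qed.

Lemma tame_continuous p q r s : tame p q r s -> continuous p.
Proof.
move=> t x; apply: differentiable_continuous; apply/derivable1_diffP.
by case: (tame_derive t x).
Qed.

Lemma tame_diag_continuous p q r s : tame p q r s -> continuous (fun x => q x x).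
Proof.
move=> t x.
have e y : q y y = q x x - (x - y) * (r x y + r y x).
  have h1 := tame_r t x y; have h2 := tame_r t y x; rewrite (tame_sym t y x) in h2.
  by rewrite mulrDr -h1 -(opprB y x) mulNr -h2; ring.
have [_ /(_ x)[c1 c2] _] := tame_cont t.
have c : q x x - (x - y) * (r x y + r y x) @[y --> x] --> q x x - 0 * (r x x + r x x).
  apply: cvgB; first exact: cvg_cst.
  apply: cvgM; last by apply: cvgD; [exact: c1 | exact: c2].
  have c0 : x - y @[y --> x] --> x - x by apply: cvgB; [exact: cvg_cst | exact: cvg_id].
  by rewrite subrr in c0.
rewrite mul0r subr0 in c.
change (q y y @[y --> x] --> q x x).
by rewrite (_ : (fun y => q y y) = (fun y => q x x - (x - y) * (r x y + r y x))) //; apply/funext.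
Qed.

Lemma tame_cst (c : R) : tame (cst c) (fun _ _ => 0) (fun _ _ => 0) (fun _ _ => 0).
Proof.
split.
- by move=> u v; rewrite subrr mulr0.
- by move=> u v; rewrite subrr mulr0.
- by move=> u v; rewrite subrr mulr0.
- by [].
- by split; exact: measurable_cst.
- by split; split; exact: cst_continuous.
- by exists 0; split => u v _ _; rewrite normr0.
Qed.

Lemma sep_continuousD q q' : sep_continuous q -> sep_continuous q' ->
  sep_continuous (fun u v => q u v + q' u v).
Proof.
move=> c c' u; have [c1 c2] := c u; have [c3 c4] := c' u.
by split => x; apply: cvgD; [exact: c1|exact: c3|exact: c2|exact: c4].
Qed.

Lemma sep_continuousM q q' : sep_continuous q -> sep_continuous q' ->
  sep_continuous (fun u v => q u v * q' u v).
Proof.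
move=> c c' u; have [c1 c2] := c u; have [c3 c4] := c' u.
by split => x; apply: cvgM; [exact: c1|exact: c3|exact: c2|exact: c4].
Qed.

Lemma sep_continuous_fst (f : R -> R) : continuous f -> sep_continuous (fun u _ => f u).
Proof. by move=> cf u; split=> [|//]; exact: cst_continuous. Qed.

Lemma sep_continuous_snd (f : R -> R) : continuous f -> sep_continuous (fun _ v => f v).
Proof. by move=> cf u; split=> [//|]; exact: cst_continuous. Qed.

Lemma sep_continuous_swap q : sep_continuous q -> sep_continuous (fun u v => q v u).
Proof. by move=> c u; have [c1 c2] := c u. Qed.

Lemma meas2_fst (f : R -> R) : continuous f -> meas2 (fun u _ => f u).
Proof.
move=> cf; apply: (@measurableT_comp _ _ _ _ _ _ (f : T -> R)); last exact: measurable_fst.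
by apply: continuous_meas.
Qed.

Lemma meas2_snd (f : R -> R) : continuous f -> meas2 (fun _ v => f v).
Proof.
move=> cf; apply: (@measurableT_comp _ _ _ _ _ _ (f : T -> R)); last exact: measurable_snd.
by apply: continuous_meas.
Qed.

Lemma meas2_swap q : meas2 q -> meas2 (fun u v => q v u).
Proof.
move=> mq; apply: (@measurableT_comp _ _ _ _ _ _ (fun z : T * T => q z.1 z.2) _ (fun z : T * T =>
    (z.2, z.1))) => //.
exact: measurable_swap.
Qed.

Lemma bounded2D q q' B B' : bounded2 q B -> bounded2 q' B' ->
  bounded2 (fun u v => q u v + q' u v) (B + B').
Proof.
move=> b b' u v Iu Iv; apply: (le_trans (ler_normD _ _)).
by apply: lerD; [exact: b | exact: b'].
Qed.

Lemma bounded2M q q' B B' : bounded2 q B -> bounded2 q' B' ->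
  bounded2 (fun u v => q u v * q' u v) (B * B').
Proof.
move=> b b' u v Iu Iv; rewrite normrM.
by apply: ler_pM => //; [exact: b | exact: b'].
Qed.

Lemma bounded2W q B B' : B <= B' -> bounded2 q B -> bounded2 q B'.
Proof. by move=> BB b u v Iu Iv; apply: le_trans BB; exact: b. Qed.

Lemma bounded2_ge0 q B : bounded2 q B -> 0 <= B.
Proof.
move=> b; apply: le_trans (normr_ge0 (q 0 0)) (b 0 0 _ _); rewrite IclosedE; lra.
Qed.

Lemma cont_bounded2 (f : R -> R) : continuous f -> exists B : R,
  bounded2 (fun u _ => f u) B /\ bounded2 (fun _ v => f v) B.
Proof.
move=> cf; have [M hM] := cont11_bounded (cont11_continuous cf).
by exists M; split => u v Iu Iv; exact: hM.
Qed.

Lemma tame_lin (a b : R) p q r s p' q' r' s' : tame p q r s -> tame p' q' r' s' ->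
  tame (fun u => a * p u + b * p' u) (fun u v => a * q u v + b * q' u v)
    (fun u v => a * r u v + b * r' u v) (fun u v => a * s u v + b * s' u v).
Proof.
move=> t t'.
have [mq mr ms] := tame_meas t; have [mq' mr' ms'] := tame_meas t'.
have [cq cr cs] := tame_cont t; have [cq' cr' cs'] := tame_cont t'.
have [B [bq br bs]] := tame_bound t; have [B' [bq' br' bs']] := tame_bound t'.
have mlin k k' : meas2 k -> meas2 k' -> meas2 (fun u v => a * k u v + b * k' u v).
  by move=> mk mk'; apply: measurable_funD; apply: measurable_funM => //; exact: measurable_cst.
have clin k k' : sep_continuous k -> sep_continuous k' -> sep_continuous (fun u v => a * k u v +
    b * k' u v).
  move=> ck ck'; apply: sep_continuousD; apply: sep_continuousM => //.
    by apply: sep_continuous_fst; exact: cst_continuous.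
  by apply: sep_continuous_fst; exact: cst_continuous.
have ba (e : R) : bounded2 (fun _ _ => e) `|e| by move=> u v _ _.
have blin k k' : bounded2 k B -> bounded2 k' B' -> bounded2 (fun u v => a * k u v + b * k' u v)
    (`|a| * B + `|b| * B').
  by move=> bk bk'; apply: bounded2D; apply: bounded2M => //; exact: ba.
split.
- move=> u v; have h1 := tame_q t u v; have h2 := tame_q t' u v.
  by rewrite mulrDr !(mulrCA (u - v)) -h1 -h2; ring.
- move=> u v; have h1 := tame_r t u v; have h2 := tame_r t' u v.
  by rewrite mulrDr !(mulrCA (u - v)) -h1 -h2; ring.
- move=> u v; have h1 := tame_s t u v; have h2 := tame_s t' u v.
  by rewrite mulrDr !(mulrCA (u - v)) -h1 -h2; ring.
- by move=> u v; rewrite (tame_sym t) (tame_sym t').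
- by split; exact: mlin.
- by split; exact: clin.
- by exists (`|a| * B + `|b| * B'); split; exact: blin.
Qed.

(** Multiplication by linear factors generates all polynomials. *)
Lemma tame_mulX (c : R) p q r s : tame p q r s ->
  tame (fun u => (u - c) * p u) (fun u v => (u - c) * q u v + p v)
    (fun u v => (u - c) * r u v + q u v) (fun u v => (u - c) * s u v + r v u).
Proof.
move=> t; have cp := tame_continuous t.
have [mq mr ms] := tame_meas t; have [cq cr cs] := tame_cont t.
have [B [bq br bs]] := tame_bound t.
have cX : continuous (fun u : R => u - c).
  by move=> x; apply: cvgB; [exact: cvg_id | exact: cvg_cst].
have [B1 [b1 _]] := cont_bounded2 cX; have [B2 [_ b2]] := cont_bounded2 cp.
have m k k' : meas2 k -> meas2 k' -> meas2 (fun u v => (u - c) * k u v + k' u v).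
  move=> mk mk'; apply: measurable_funD; last exact: mk'.
  by apply: measurable_funM; [exact: (meas2_fst cX) | exact: mk].
have co k k' : sep_continuous k -> sep_continuous k' -> sep_continuous (fun u v => (u - c) * k u
    v + k' u v).
  by move=> ck ck'; apply: sep_continuousD => //; apply: sep_continuousM => //; exact:
      sep_continuous_fst.
split.
- by move=> u v; have h := tame_q t u v; rewrite mulrDr mulrCA -h; ring.
- move=> u v; have h := tame_r t u v; have h' := tame_q t u v.
  by rewrite mulrDr mulrCA -h -h'; ring.
- move=> u v; have h := tame_s t u v; rewrite mulrDr mulrCA -h (tame_sym t v u).
  by ring.
- move=> u v; have h := tame_q t u v; rewrite (tame_sym t v u).
  by rewrite -[p v]opprK -[in LHS](subKr (p u) (p v)) h; ring.
- split; [apply: (m _ (fun _ v => p v)) | apply: m | apply: (m _ (fun u v => r v u))] => //.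
    exact: meas2_snd.
  exact: (meas2_swap mr).
- split; apply: co => //; [exact: sep_continuous_snd | exact: sep_continuous_swap].
- exists (B1 * B + Num.max B B2).
  have bd k k' B' : bounded2 k B -> bounded2 k' B' -> B' <= Num.max B B2 ->
      bounded2 (fun u v => (u - c) * k u v + k' u v) (B1 * B + Num.max B B2).
    move=> bk bk' le; apply: bounded2D; last exact: bounded2W bk'.
    exact: bounded2M.
  have l1 : B <= Num.max B B2 by rewrite le_max lexx.
  have l2 : B2 <= Num.max B B2 by rewrite le_max lexx orbT.
  split.
  - exact: (bd _ (fun _ v => p v) B2).
  - exact: (bd _ _ B).
  - by apply: (bd _ (fun u v => r v u) B) => // u v Iu Iv; exact: br.
Qed.

Lemma tame_diffeo p q r s : tame p q r s -> p (-1) = 0 -> p 1 = 0 ->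
  bounded2 q (2^-1) -> diffeo (fun u => u + p u) (fun u => 1 + q u u).
Proof.
move=> t p0 p1 bq; split.
- by move=> x; apply: is_deriveD; exact: tame_derive t x.
- move=> x; apply: cvgD; first exact: cvg_cst.
  exact: (tame_diag_continuous t).
- move=> x Ix; have := bq x x Ix Ix; rewrite ler_norml => /andP[h _]; lra.
- by rewrite p0 addr0.
- by rewrite p1 addr0.
Qed.

(** The defect of invariance of the kernel 1 / (u - v)^2 under id + p. *)
Definition kernel_defect (q r s : R -> R -> R) (u v : R) : R :=
  ((1 + q u v) * s u v - r u v * r v u) / (1 + q u v) ^+ 2.

(** Write psi(u) - psi(v) = (u - v) (1 + q(u, v)) and expand the derivatives
    1 + q(u, u) and 1 + q(v, v) at q(u, v); the pole of first order cancels
    because r(u, v) - r(v, u) is divisible by u - v. *)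
Lemma kernel_transform p q r s u v : tame p q r s -> u != v -> 1 + q u v != 0 ->
  (1 + q u u) * (1 + q v v) / ((u + p u) - (v + p v)) ^+ 2 =
  1 / (u - v) ^+ 2 + kernel_defect q r s u v.
Proof.
move=> t uv q0.
have uv0 : u - v != 0 by rewrite subr_eq0.
have h1 := tame_q t u v; have h2 := tame_r t u v; have h3 := tame_r t v u.
have h4 := tame_s t u v; rewrite (tame_sym t v u) in h3.
have e1 : q u u = q u v + (u - v) * r u v by lra.
have e2 : q v v = q u v + (v - u) * r v u by lra.
have e3 : (u + p u) - (v + p v) = (u - v) * (1 + q u v).
  by rewrite mulrDr mulr1 -h1; ring.
have e4 : s u v = (r u v - r v u) / (u - v) by rewrite h4 mulrAC mulfV ?mul1r.
rewrite e3 e1 e2 /kernel_defect e4.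
by field; rewrite q0 uv0.
Qed.

Lemma bounded2_1Dq q u v : bounded2 q (2^-1) -> Iclosed u -> Iclosed v ->
  2^-1 <= 1 + q u v.
Proof. by move=> b Iu Iv; have := b u v Iu Iv; rewrite ler_norml => /andP[h _]; lra. Qed.

Lemma integral_itv_derive_oo (F f : R -> R) (x y : R) : x <= y ->
  (forall t : R, x < t < y -> is_derive t (1 : R) F (f t)) ->
  {within `[x, y], continuous f} -> {within `[x, y], continuous F} ->
  (\int[mu]_(t in `]x, y[) f t) = F y - F x.
Proof.
move=> + dF cf cF.
rewrite le_eqVlt => /predU1P[->|xy]; first by rewrite subrr set_itvoo0 Rintegral_set0.
have := @continuous_FTC2 R f F x y xy cf.
have mf : @measurable_fun _ _ T T `[x, y]%classic f.
  by apply: subspace_continuous_measurable_fun => //; exact: measurable_itv.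
rewrite /Rintegral -(integral_itv_bndoo true false); last first.
  apply/measurable_EFinP; apply: measurable_funS mf; first exact: measurable_itv.
  exact: subset_itv_oo_cc.
have [_ c1 c2] := (continuous_within_itvP F xy).1 cF.
move=> -> //.
  by split => // t; rewrite in_itv/= => /dF[].
by move=> t; rewrite in_itv/= => /dF d; rewrite derive1E; case: d.
Qed.

(** The integral of 1 / (u - t)^2 over t outside (-1, 1). *)
Definition boundary_weight (u : R) : R := (1 - u)^-1 + (1 + u)^-1.

(** The defect has the primitive r(u, v) / (1 + q(u, v)) in v, which for v <> u is
    the difference of psi'(u) / (psi(u) - psi(v)) and 1 / (u - v). *)
Lemma integral_kernel_defect p q r s u : tame p q r s -> p (-1) = 0 -> p 1 = 0 ->
  bounded2 q (2^-1) -> Iopen u ->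
  (\int[mu]_(v in Iopen) kernel_defect q r s u v) =
  boundary_weight u - boundary_weight (u + p u) * (1 + q u u).
Proof.
move=> t p0 p1 bq Iu; have Iu' := Iopen_closed Iu.
have [cq cr cs] := tame_cont t.
have [u1 u2] : -1 < u /\ u < 1 by move: Iu; rewrite IopenE => /andP.
pose F v := r u v / (1 + q u v).
have pos v : -1 <= v <= 1 -> 0 < 1 + q u v.
  by rewrite -IclosedE => Iv; have := bounded2_1Dq bq Iu' Iv; lra.
have cF v : -1 <= v <= 1 -> {for v, continuous F}.
  move=> /pos v0; apply: cvgM; first by have [c _] := cr u; exact: c.
  apply: cvgV; first by rewrite gt_eqF.
  by apply: cvgD; [exact: cvg_cst | have [c _] := cq u; exact: c].
have ck v : -1 <= v <= 1 -> {for v, continuous (kernel_defect q r s u)}.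
  move=> /pos v0.
  have [c1 _] := cq u; have [c2 c3] := cr u; have [c4 _] := cs u.
  have c5 : {for v, continuous (fun v => 1 + q u v)}.
    by apply: cvgD; [exact: cvg_cst | exact: c1].
  apply: cvgM.
    apply: cvgB; first by apply: cvgM; [exact: c5 | exact: c4].
    by apply: cvgM; [exact: c2 | exact: c3].
  apply: cvgV; first by rewrite expf_neq0// gt_eqF.
  by apply: cvgM; exact: c5.
have FE v : v != u -> 1 + q u v != 0 -> F v = (1 + q u u) * ((u + p u) - (v + p v))^-1 - (u - v)^-1.
  move=> vu q0; have uv0 : u - v != 0 by rewrite subr_eq0 eq_sym.
  have h1 := tame_q t u v; have h2 := tame_r t u v.
  rewrite /F; have -> : (u + p u) - (v + p v) = (u - v) * (1 + q u v).
    by rewrite mulrDr mulr1 -h1; ring.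
  have -> : q u u = q u v + (u - v) * r u v by lra.
  by field; rewrite q0 uv0.
have dF v : -1 <= v <= 1 -> v != u -> is_derive v (1 : R) F (kernel_defect q r s u v).
  move=> hv vu; have q0 := pos v hv.
  have uv0 : u - v != 0 by rewrite subr_eq0 eq_sym.
  have h1 := tame_q t u v.
  have e1 : (u + p u) - (v + p v) = (u - v) * (1 + q u v).
    by rewrite mulrDr mulr1 -h1; ring.
  have pv0 : (u + p u) - (v + p v) != 0 by rewrite e1 mulf_neq0// gt_eqF.
  have d1 : is_derive v (1 : R) (fun v => (u + p u) - (v + p v)) (- (1 + q v v)).
    have := is_deriveB (is_derive_cst (u + p u) v (1 : R)) (is_deriveD (is_derive_id v (1 : R))
        (tame_derive t v)).
    by move=> h; apply: (is_derive_eq h); rewrite sub0r.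
  have d2 : is_derive v (1 : R) (fun v => u - v) (- 1).
    have := is_deriveB (is_derive_cst u v (1 : R)) (is_derive_id v (1 : R)).
    by move=> h; apply: (is_derive_eq h); rewrite sub0r.
  have d3 := is_deriveB (is_deriveZ (1 + q u u) (@is_deriveV _ (fun v => (u + p u) - (v + p v)) v
      _ 1 pv0 d1))
     (@is_deriveV _ (fun v => u - v) v _ 1 uv0 d2).
  have d4 : is_derive v (1 : R) (fun v => (1 + q u u) * ((u + p u) - (v + p v))^-1 - (u - v)^-1)
      (kernel_defect q r s u v).
    apply: (is_derive_eq d3).
    have uv : u != v by rewrite eq_sym.
    have := kernel_transform t uv (lt0r_neq0 q0).
    move=> h; have {h} : kernel_defect q r s u v =
        (1 + q u u) * (1 + q v v) / (u + p u - (v + p v)) ^+ 2 - 1 / (u - v) ^+ 2.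
      by rewrite h addrAC subrr add0r.
    by rewrite /GRing.scale/= => ->; field; rewrite uv0 pv0.
  apply: near_eq_is_derive d4; near=> v'.
  have n1 : v' - u != 0.
    near: v'; apply: (cvgr_neq0 (v - u)); last by rewrite subr_eq0.
    by apply: cvgB; [exact: cvg_id | exact: cvg_cst].
  have n2 : 1 + q u v' != 0.
    near: v'; apply: (cvgr_neq0 (1 + q u v)); last by rewrite gt_eqF.
    by apply: cvgD; [exact: cvg_cst | have [c _] := cq u; exact: c].
  by rewrite FE// -subr_eq0.
have sub (x y : R) (f : R -> R) : -1 <= x -> y <= 1 ->
    (forall v, -1 <= v <= 1 -> {for v, continuous f}) -> {within `[x, y], continuous f}.
  move=> x1 y1 cf; apply: continuous_in_subspaceT => v; rewrite inE /= in_itv/= => /andP[xv vy].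
  by apply: cf; rewrite (le_trans x1 xv) (le_trans vy y1).
have kI : intI (kernel_defect q r s u).
  apply/L2_intI/cont11_L2.
  exact: sub ck.
rewrite -/Iopen (_ : Iopen = `]-1, 1[%classic)//.
rewrite (integral_itv_add kI _ (ltW u1) (ltW u2))//.
have e1 : (\int[mu]_(v in `]-1, u[) kernel_defect q r s u v)%R = F u - F (-1).
  apply: integral_itv_derive_oo; [exact: ltW| |exact: sub (ltW u2) ck|exact: sub (ltW u2) cF].
  move=> v /andP[h1 h2]; apply: dF; last by rewrite lt_eqF.
  by rewrite (ltW h1) (ltW (lt_trans h2 u2)).
have e2 : (\int[mu]_(v in `]u, 1[) kernel_defect q r s u v)%R = F 1 - F u.
  apply: integral_itv_derive_oo; [exact: ltW| |exact: sub (ltW u1) _ ck|exact: sub (ltW u1) _ cF].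
  move=> v /andP[h1 h2]; apply: dF; last by rewrite gt_eqF.
  by rewrite (ltW h2) (ltW (lt_trans u1 h1)).
rewrite e1 e2.
have a1 : 1 + q u 1 != 0 by rewrite gt_eqF// pos//; lra.
have a2 : 1 + q u (-1) != 0 by rewrite gt_eqF// pos//; lra.
rewrite addrC subrKA (FE 1)// ?gt_eqF// (FE (-1))// ?lt_eqF//.
rewrite p0 p1 !addr0 /boundary_weight.
have Ipu : Iopen (u + p u).
  by have [_ h] := diffeo_Iopen (tame_diffeo t p0 p1 bq) Iu'; exact: h.
move: Ipu; rewrite IopenE => /andP[h1 h2].
set w := u + p u in h1 h2 *.
field; rewrite !andbA; repeat (apply/andP; split); rewrite ?subr_eq0 ?addr_eq0.
all: try (by rewrite ?gt_eqF ?lt_eqF); try lra.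
Unshelve. all: by end_near. Qed.

End Tame.

(** * The seminorm on the square and outside *)

Section Square.
Context {R : realType}.
Local Notation mu := (@lebesgue_measure R).
Local Notation T := (measurableTypeR R).
Local Notation meas2 q := (@measurable_fun _ _ (T * T)%type R setT (fun z => q z.1 z.2)).
Local Notation N := (mu \x mu)%E.

Lemma measure_Iopen : mu (Iopen : set T) = 2%:E.
Proof.
rewrite /Iopen lebesgue_measure_itv/= lte_fin ifT; last lra.
by rewrite -EFinB; congr EFin; ring.
Qed.

Lemma integral_norm_le (f : R -> R) (M : R) : intI f -> (forall x, Iopen x -> `|f x| <= M) ->
  `|\int[mu]_(x in Iopen) f x| <= M * 2.
Proof.
move=> fi fM; have mI := @measurable_Iopen R.
apply: le_trans (le_normr_Rintegral mI fi) _.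
have -> : M * 2 = \int[mu]_(x in Iopen) (cst M) x.
  by rewrite Rintegral_cst//= measure_Iopen.
apply: (le_Rintegral mI) => //; first exact: integrable_norm.
exact: intI_cst.
Qed.

Lemma boundary_weight_ge0 (s : R) : Iopen s -> 0 <= boundary_weight s.
Proof. by rewrite IopenE => /andP[s1 s2]; apply: addr_ge0; rewrite invr_ge0; lra. Qed.

Lemma measurable_boundary_weight : measurable_fun (setT : set T) (@boundary_weight R).
Proof.
apply: measurable_funD; apply: measurable_funV.
  by apply: measurable_funB; [exact: measurable_cst|exact: measurable_id].
by apply: measurable_funD; [exact: measurable_cst|exact: measurable_id].
Qed.

Definition increment (f : T -> R) (z : T * T) : \bar R :=
  ((f z.1 - f z.2) ^+ 2 / (z.1 - z.2) ^+ 2)%:E.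

Lemma increment_ge0 f z : (0 <= increment f z)%E.
Proof. by rewrite lee_fin divr_ge0// sqr_ge0. Qed.

Lemma measurable_increment f : measurable_fun setT f -> measurable_fun setT (increment f).
Proof.
move=> mf; apply/measurable_EFinP; apply: measurable_funM.
  apply: measurable_funX; apply: measurable_funB.
    exact: (measurableT_comp mf measurable_fst).
  exact: (measurableT_comp mf measurable_snd).
apply: measurable_funV; apply: measurable_funX.
by apply: measurable_funB; [exact: measurable_fst|exact: measurable_snd].
Qed.

Lemma patch_setX (U : pointedType) (A B : set T) (G : T * T -> U) u v :
  (G \_ (A `*` B)) (u, v) = if u \in A then ((fun v => G (u, v)) \_ B) v else point.
Proof. by rewrite /patch in_setX /=; case: (u \in A). Qed.

Lemma integral_setX (A B : set T) (G : T * T -> \bar R) : measurable A -> measurable B ->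
  measurable_fun setT G -> (forall z, 0 <= G z)%E ->
  (\int[N]_(z in A `*` B) G z = \int[mu]_(u in A) \int[mu]_(v in B) G (u, v))%E.
Proof.
move=> mA mB mG G0.
have mG' : measurable_fun setT (G \_ (A `*` B)).
  apply/(measurable_restrictT _ (measurableX mA mB)).
  exact: measurable_funS mG.
have G0' z : (0 <= (G \_ (A `*` B)) z)%E by rewrite /patch; case: ifP.
rewrite integral_mkcond (fubini_tonelli1 _ mG' G0').
rewrite [in RHS]integral_mkcond; apply: eq_integral => u _.
rewrite /fubini_F; under eq_integral do rewrite patch_setX.
rewrite [in RHS]/patch; case: ifP => Iu; last by rewrite integral0.
by rewrite -integral_mkcond.
Qed.

Lemma integral_setX2 (A B : set T) (G : T * T -> \bar R) : measurable A -> measurable B ->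
  measurable_fun setT G -> (forall z, 0 <= G z)%E ->
  (\int[N]_(z in A `*` B) G z = \int[mu]_(v in B) \int[mu]_(u in A) G (u, v))%E.
Proof.
move=> mA mB mG G0.
have mG' : measurable_fun setT (G \_ (A `*` B)).
  apply/(measurable_restrictT _ (measurableX mA mB)).
  exact: measurable_funS mG.
have G0' z : (0 <= (G \_ (A `*` B)) z)%E by rewrite /patch; case: ifP.
rewrite integral_mkcond (fubini_tonelli2 _ mG' G0').
rewrite [in RHS]integral_mkcond; apply: eq_integral => v _.
rewrite /fubini_G; under eq_integral do rewrite patch_setX.
rewrite [in RHS]/patch; case: ifP => Iv; last first.
  rewrite integral0_eq// => u _; case: ifP => // _.
  by rewrite /patch Iv.
rewrite [in RHS]integral_mkcond; apply: eq_integral => u _.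
by rewrite /patch; case: ifP => // _; rewrite Iv.
Qed.

Lemma measurable_inner_integral (A : set T) (F : T * T -> \bar R) : measurable A ->
  measurable_fun setT F -> (forall z, 0 <= F z)%E ->
  measurable_fun setT (fun s => \int[mu]_(t in A) F (s, t))%E.
Proof.
move=> mA mF F0; under eq_fun do rewrite integral_mkcond.
have mFA : measurable_fun setT (F \_ (setT `*` A)).
  apply/(measurable_restrictT _ (measurableX (@measurableT _ T) mA)).
  exact: measurable_funS mF.
have FA0 z : (0 <= (F \_ (setT `*` A)) z)%E by rewrite /patch; case: ifP.
have h := @measurable_fun_fubini_tonelli_F _ _ T T R mu _ mFA FA0.
apply: (eq_measurable_fun _ _ h) => s _; rewrite /fubini_F; apply: eq_integral => t _.
by rewrite patch_setX in_setT.
Qed.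

Definition square : set (T * T) := Iopen `*` Iopen.

Lemma measurable_square : measurable square.
Proof. by apply: measurableX; exact: (@measurable_Iopen R). Qed.

Lemma square_integrable (b : R -> R -> R) (B : R) : meas2 b ->
  (forall u v, Iopen u -> Iopen v -> `|b u v| <= B) ->
  N.-integrable square (fun z => (b z.1 z.2)%:E).
Proof.
move=> mb bB.
have I0 : Iopen (0 : R) by rewrite IopenE ltrN10 ltr01.
have B0 : 0 <= B by apply: le_trans (bB 0 0 I0 I0).
have mS := measurable_square.
apply: (@le_integrable _ _ _ N square mS _ (fun _ => B%:E)).
- by apply/measurable_EFinP; exact: measurable_funS mb.
- move=> [u v] [/= Iu Iv]; rewrite lee_fin [X in _ <= X]ger0_norm//.
  exact: bB.
- apply/integrableP; split; first exact: measurable_cst.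
  rewrite (_ : (fun _ => `|B%:E|)%E = cst B%:E) ?integral_cst//; last first.
    by apply/funext => z /=; rewrite ger0_norm.
  rewrite [X in (_ * X)%E](_ : _ = mu (Iopen : set T) * mu (Iopen : set T))%E; last first.
    by apply: product_measure1E; exact: (@measurable_Iopen R).
  rewrite measure_Iopen.
  by rewrite -!EFinM ltry.
Qed.

Lemma square_integral_real (b : R -> R -> R) (B : R) : meas2 b ->
  (forall u v, Iopen u -> Iopen v -> `|b u v| <= B) ->
  (\int[N]_(z in square) (b z.1 z.2)%:E = \int[mu]_(u in Iopen) \int[mu]_(v in Iopen) (b u v)%:E)%E.
Proof.
move=> mb bB; have := square_integrable mb bB.
move=> /(integrable_mkcond _ measurable_square) bI.
rewrite integral_mkcond -(integral12_prod_meas1 bI).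
rewrite [in RHS]integral_mkcond; apply: eq_integral => u _.
rewrite /fubini_F; under eq_integral do rewrite patch_setX.
rewrite [in RHS]/patch; case: ifP => Iu; last by rewrite integral0.
by rewrite -integral_mkcond.
Qed.

(** Together with square_integral_real this is Fubini's theorem for bounded
    integrands. *)
Lemma square_integral_real2 (b : R -> R -> R) (B : R) : meas2 b ->
  (forall u v, Iopen u -> Iopen v -> `|b u v| <= B) ->
  (\int[N]_(z in square) (b z.1 z.2)%:E = \int[mu]_(v in Iopen) \int[mu]_(u in Iopen) (b u v)%:E)%E.
Proof.
move=> mb bB; have := square_integrable mb bB.
move=> /(integrable_mkcond _ measurable_square) bI.
rewrite integral_mkcond -(integral12_prod_meas1 bI) (Fubini bI).
rewrite [in RHS]integral_mkcond; apply: eq_integral => v _.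
rewrite /fubini_G; under eq_integral do rewrite patch_setX.
rewrite [in RHS]/patch; case: ifP => Iv; last first.
  rewrite integral0_eq// => u _; case: ifP => // _.
  by rewrite /patch Iv.
rewrite [in RHS]integral_mkcond; apply: eq_integral => u _.
by rewrite /patch; case: ifP => // _; rewrite Iv.
Qed.

(** Both sides may be infinite, which is why b is integrated separately. *)
Lemma integral_perturbation d (X : measurableType d) (m : {measure set X -> \bar R})
    (D : set X) (f g b : X -> R) : measurable D ->
  measurable_fun D f -> measurable_fun D g ->
  (forall x, D x -> 0 <= f x) -> (forall x, D x -> 0 <= g x) ->
  m.-integrable D (EFin \o b) -> (forall x, D x -> f x = g x + b x) ->
  (\int[m]_(x in D) (f x)%:E = \int[m]_(x in D) (g x)%:E + \int[m]_(x in D) (b x)%:E)%E.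
Proof.
move=> mD mf mg f0 g0 bI fgb.
have mb : measurable_fun D (EFin \o b) by have /integrableP[] := bI.
have pI := integrable_funepos mD bI; have nI := integrable_funeneg mD bI.
have pf := integrable_fin_num mD pI; have nf := integrable_fin_num mD nI.
rewrite [X in (_ + X)%E]integralE.
have mp := measurable_funepos mb; have mn := measurable_funeneg mb.
have e : (\int[m]_(x in D) (f x)%:E + \int[m]_(x in D) (EFin \o b)^\- x =
    \int[m]_(x in D) (g x)%:E + \int[m]_(x in D) (EFin \o b)^\+ x)%E.
  rewrite -!ge0_integralD//; try by apply/measurable_EFinP.
  apply: eq_integral => x; rewrite inE => Dx.
  have /= := congr1 (fun h => h x) (funeposneg (EFin \o b)).
  have [p0 n0] : ((EFin \o b)^\+ x \is a fin_num)%E /\ ((EFin \o b)^\- x \is a fin_num)%E.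
    by rewrite funeposE funenegE /= -!EFin_max.
  rewrite fgb//; move: p0 n0.
  case: ((EFin \o b)^\+ x)%E => [p| |]// _; case: ((EFin \o b)^\- x)%E => [n| |]// _ [->].
  by congr EFin; ring.
rewrite addeA -[X in (_ = (X - _))%E]e addeK//.
Qed.

Lemma cvg_inv_shift (a : R) : (fun t : R => - (a + t)^-1) t @[t --> +oo] --> (0 : R).
Proof.
rewrite -[X in _ --> X]oppr0; apply: cvgN.
apply/gtr0_cvgV0; last exact: cvg_addrl.
by apply: filterS (nbhs_pinfty_gt (num_real (- a))) => t; lra.
Qed.

(** An improper integral with primitive - (a + t)^-1. *)
Lemma integral_tail (a : R) : -1 < a ->
  (\int[mu]_(t in `[1%R, +oo[) ((a + t) ^- 2)%:E = ((1 + a)^-1)%:E)%E.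
Proof.
move=> a1.
have d (t : R) : 1 <= t -> is_derive t (1 : R) (fun t => - (a + t)^-1) ((a + t) ^- 2).
  move=> t1.
  have at0 : a + t != 0 by rewrite gt_eqF//; lra.
  have d1 : is_derive t (1 : R) (fun t => a + t) 1.
    have := is_deriveD (is_derive_cst a t (1 : R)) (is_derive_id t (1 : R)).
    by move=> h; apply: (is_derive_eq h); rewrite add0r.
  have h := is_deriveN (@is_deriveV _ (fun t => a + t) t _ 1 at0 d1).
  by apply: (is_derive_eq h); rewrite scaleNr opprK /GRing.scale/= mulr1.
have cF (t : R) : 1 <= t -> {for t, continuous (fun t => - (a + t)^-1)}.
  move=> /d h; apply: differentiable_continuous; apply/derivable1_diffP.
  exact: (@ex_derive _ _ _ _ _ _ _ h).
rewrite (@ge0_continuous_FTC2y _ _ (fun t => - (a + t)^-1) 1 0).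
- by rewrite -EFinB sub0r opprK addrC.
- by move=> x _; rewrite invr_ge0 sqr_ge0.
- apply: continuous_in_subspaceT => t; rewrite inE /= in_itv/= andbT => t1.
  apply: cvgV; first by rewrite expf_neq0// gt_eqF//; lra.
  apply: (@cvg_comp _ _ _ (fun t => a + t) (fun t => t ^+ 2)); last exact: exprn_continuous.
  by apply: cvgD; [exact: cvg_cst | exact: cvg_id].
- exact: cvg_inv_shift.
- move=> t t1; exact: (@ex_derive _ _ _ _ _ _ _ (d t (ltW t1))).
- apply: cvg_at_right_filter; exact: cF.
- move=> t; rewrite in_itv/= andbT => t1; rewrite derive1E.
  by apply: (@derive_val _ _ _ _ _ _ _ (d t (ltW t1))).
Qed.

Lemma setC_Iopen : ~` (Iopen : set R) = `]-oo, (- 1)%R] `|` `[1%R, +oo[.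
Proof.
apply/seteqP; split => x /=; rewrite /Iopen /= !in_itv/= andbT.
  by move=> h; case: (leP x (-1)) => h1; [left|right]; case: (leP 1 x) => // h2; exfalso; apply:
      h; rewrite h1 h2.
by move=> h /andP[h1 h2]; case: h => h; lra.
Qed.

Lemma integral_outside (s : R) : Iopen s ->
  (\int[mu]_(t in ~` Iopen) ((s - t) ^- 2)%:E = (boundary_weight s)%:E)%E.
Proof.
rewrite IopenE => /andP[s1 s2].
have m2 : measurable_fun (setT : set T) (fun t : R => ((s - t) ^- 2)%:E).
  apply/measurable_EFinP; apply: measurable_funV; apply: measurable_funX.
  by apply: measurable_funB; [exact: measurable_cst | exact: measurable_id].
rewrite setC_Iopen (@ge0_integral_setU _ T) //=; last 3 first.
- exact: measurable_funS m2.
- by move=> x _; rewrite lee_fin invr_ge0 sqr_ge0.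
- apply/disj_setPLR => x /=; rewrite !in_itv/= andbT => h1; lra.
have -> : (\int[mu]_(t in `]-oo, (- 1)%R]) ((s - t) ^- 2)%:E = ((1 + s)^-1)%:E)%E.
  rewrite (@ge0_integration_by_substitutionNy _ (fun t => (s - t) ^- 2)).
  - rewrite -integral_tail//; apply: eq_integral => t _ /=.
    by rewrite opprK.
  - apply: continuous_in_subspaceT => t; rewrite inE /= in_itv/= => t1.
    apply: cvgV; first by rewrite expf_neq0// gt_eqF//; lra.
    apply: (@cvg_comp _ _ _ (fun t => s - t) (fun t => t ^+ 2)); last exact: exprn_continuous.
    by apply: cvgB; [exact: cvg_cst | exact: cvg_id].
  - by move=> x _; rewrite invr_ge0 sqr_ge0.
have -> : (\int[mu]_(t in `[1%R, +oo[) ((s - t) ^- 2)%:E = ((1 - s)^-1)%:E)%E.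
  rewrite -integral_tail; last lra.
  by apply: eq_integral => t _; rewrite -sqrrN opprB addrC.
by rewrite -EFinD /boundary_weight addrC.
Qed.

(** If only one variable is outside (-1, 1), it can be integrated out. *)
Lemma seminorm_split (f : T -> R) : measurable_fun setT f -> (forall x, ~ Iopen x -> f x = 0) ->
  (\int[mu]_s \int[mu]_t ((f s - f t) ^+ 2 / (s - t) ^+ 2)%:E =
   \int[N]_(z in square) ((f z.1 - f z.2) ^+ 2 / (z.1 - z.2) ^+ 2)%:E +
   2%:E * \int[mu]_(s in Iopen) ((f s) ^+ 2 * boundary_weight s)%:E)%E.
Proof.
move=> mf f0; pose F := increment f.
have mI := @measurable_Iopen R; have mIC := measurableC mI.
have mF : measurable_fun setT F := measurable_increment mf.
have F0 : forall z, (0 <= F z)%E := increment_ge0 f.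
have mF1 s : measurable_fun setT (fun t => F (s, t)) by exact: measurableT_comp mF
    (measurable_pair1 s).
have mF2 s : measurable_fun setT (fun t => F (t, s)) by exact: measurableT_comp mF
    (measurable_pair2 s).
have mG : measurable_fun setT (fun s => \int[mu]_t F (s, t))%E.
  exact: (measurable_fun_fubini_tonelli_F _ mF F0).
have mG' (A : set T) : measurable A -> measurable_fun setT (fun s => \int[mu]_(t in A) F (s, t))%E.
  by move=> mA; exact: measurable_inner_integral.
have split (g : T -> \bar R) : measurable_fun setT g -> (forall x, 0 <= g x)%E ->
   (\int[mu]_x g x = \int[mu]_(x in Iopen) g x + \int[mu]_(x in ~` Iopen) g x)%E.
  move=> mg g0; rewrite -(setUv (Iopen : set T)) ge0_integral_setU//.
    by rewrite setUv.
  by apply/disj_setPS; rewrite setICr.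
transitivity (\int[mu]_s \int[mu]_t F (s, t))%E; first by [].
rewrite split//; last by move=> s; exact: integral_ge0.
have w0 := boundary_weight_ge0.
have mw : measurable_fun Iopen (fun s : T => ((f s) ^+ 2 * boundary_weight s)%:E).
  apply/measurable_EFinP; apply: measurable_funM.
    by apply: measurable_funX; exact: measurable_funS mf.
  exact: measurable_funS measurable_boundary_weight.
have out s : Iopen s -> (\int[mu]_(t in ~` Iopen) F (s, t) = ((f s) ^+ 2 * boundary_weight s)%:E)%E.
  move=> Is; rewrite EFinM -integral_outside// -ge0_integralZl//; last 3 first.
  - apply/measurable_EFinP; apply: measurable_funV; apply: measurable_funX.
    by apply: measurable_funB; [exact: measurable_cst | exact: measurable_id].
  - by move=> t _; rewrite lee_fin invr_ge0 sqr_ge0.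
  - by rewrite lee_fin sqr_ge0.
  by apply: eq_integral => t; rewrite inE => /f0 ft; rewrite /F /increment /= ft subr0 EFinM.
have -> : (\int[mu]_(s in Iopen) \int[mu]_t F (s, t) = \int[N]_(z in square) F z +
    \int[mu]_(s in Iopen) ((f s) ^+ 2 * boundary_weight s)%:E)%E.
  rewrite integral_setX// -ge0_integralD//; last 3 first.
  - by move=> s _; exact: integral_ge0.
  - exact: measurable_funS (mG' _ mI).
  - by move=> s Is; rewrite lee_fin mulr_ge0 ?sqr_ge0 ?w0.
  by apply: eq_integral => s; rewrite inE => Is; rewrite split// out.
have -> : (\int[mu]_(s in ~` Iopen) \int[mu]_t F (s, t) = 
    \int[mu]_(s in Iopen) ((f s) ^+ 2 * boundary_weight s)%:E)%E.
  transitivity (\int[mu]_(s in ~` Iopen) \int[mu]_(t in Iopen) F (s, t))%E.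
    apply: eq_integral => s; rewrite inE => Is; rewrite split//.
    rewrite [X in (_ + X)%E]integral0_eq ?adde0// => t /f0 ft.
    by rewrite /F /increment/= ft f0// subr0 expr0n/= mul0r.
  rewrite -integral_setX// integral_setX2//.
  apply: eq_integral => s; rewrite inE => Is; rewrite -out//.
  by apply: eq_integral => t _; rewrite /F /increment/= -sqrrN opprB -[X in _ / X]sqrrN opprB.
rewrite -addeA; congr (_ + _)%E.
by rewrite mule_natl mule2n.
Qed.

End Square.

(** * The seminorm under a deformation *)

Section Deformation.
Context {R : realType}.
Local Notation mu := (@lebesgue_measure R).
Local Notation T := (measurableTypeR R).
Local Notation meas2 q := (@measurable_fun _ _ (T * T)%type R setT (fun z => q z.1 z.2)).
Local Notation N := (mu \x mu)%E.
Variables (p : R -> R) (q r s : R -> R -> R).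
Hypotheses (t : tame p q r s) (p0 : p (-1) = 0) (p1 : p 1 = 0) (bq : bounded2 q (2^-1)).
Local Notation k := (kernel_defect q r s).

Lemma kernel_defect_sym u v : k u v = k v u.
Proof.
have [->//|uv] := eqVneq u v.
have uv0 : u - v != 0 by rewrite subr_eq0.
have h1 := tame_s t u v; have h2 := tame_s t v u.
have ss : s u v = s v u by apply: (mulfI uv0); lra.
by rewrite /kernel_defect (tame_sym t v u) ss (mulrC (r u v)).
Qed.

Lemma kernel_defect_bounded : exists B : R, bounded2 k B.
Proof.
have [B [_ br bs]] := tame_bound t.
have B0 : 0 <= B := bounded2_ge0 br.
exists ((2 * B + B * B) * 4) => u v Iu Iv.
have h := bounded2_1Dq bq Iu Iv; have h' := bq Iu Iv.
have h2 : 1 + q u v <= 2 by move: h'; rewrite ler_norml => /andP[_]; lra.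
rewrite /kernel_defect normrM; apply: ler_pM => //.
  apply: le_trans (ler_normB _ _) _; rewrite !normrM; apply: lerD.
    apply: ler_pM => //; last exact: bs.
    by rewrite ger0_norm//; lra.
  by apply: ler_pM => //; exact: br.
rewrite normfV ger0_norm ?sqr_ge0// -[4]invrK lef_pV2 ?posrE ?exprn_gt0 ?invr_gt0//; last lra.
rewrite expr2; apply: le_trans (_ : 2^-1 * 2^-1 <= _); last by apply: ler_pM => //; lra.
by rewrite -invfM -natrM.
Qed.

Lemma meas2_kernel_defect : meas2 k.
Proof.
have [mq mr ms] := tame_meas t.
have m1 : meas2 (fun u v => 1 + q u v).
  by apply: measurable_funD => //; exact: measurable_cst.
apply: measurable_funM.
  apply: measurable_funB; apply: measurable_funM => //.
  exact: (meas2_swap mr).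
by apply: measurable_funV; exact: measurable_funX.
Qed.

Lemma intI_kernel_defect u : Iopen u -> intI (k u).
Proof.
move=> Iu; have [B kB] := kernel_defect_bounded.
have mk := measurableT_comp meas2_kernel_defect (measurable_pair1 u).
apply: L2_intI; apply: (@L2_bounded _ _ B); first exact: measurable_funS mk.
by move=> v Iv; apply: kB; exact: Iopen_closed.
Qed.

Variables (f g : R -> R) (B : R).
Hypotheses (mf : @measurable_fun _ _ T R setT f) (fB : forall x, `|f x| <= B).
Hypotheses (f0 : forall x, ~ Iopen x -> f x = 0) (g0 : forall x, ~ Iopen x -> g x = 0).
Hypothesis gf : forall u, Iopen u -> g u = f (u + p u).

Local Notation psi := (fun u => u + p u).
Local Notation w := (fun u => 1 + q u u).

Lemma deformed_meas : @measurable_fun _ _ T R setT g.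
Proof.
have dp := tame_diffeo t p0 p1 bq.
have -> : g = (fun u => \1_Iopen u * f (psi u)).
  apply/funext => u; rewrite indicE; case: (boolP (u \in Iopen)) => [|]; rewrite ?inE ?notin_setE
      => Iu.
    by rewrite mul1r gf.
  by rewrite mul0r g0.
apply: measurable_funM.
  apply: measurable_indic; exact: (@measurable_Iopen R).
apply: (measurableT_comp mf).
by apply: continuous_meas => //; exact: diffeo_continuous dp.
Qed.

Lemma deformed_bounded x : `|g x| <= B.
Proof.
have [Ix|nIx] := pselect (Iopen x); first by rewrite gf.
by rewrite g0// normr0; apply: le_trans (fB x).
Qed.

(** Expanding the square leaves the product g u * g v: the squares only see the
    integrals of the kernel defect, which are changes of boundary weight. *)
Lemma seminorm_transform :
  (\int[mu]_s \int[mu]_t ((g s - g t) ^+ 2 / (s - t) ^+ 2)%:E =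
   \int[mu]_s \int[mu]_t ((f s - f t) ^+ 2 / (s - t) ^+ 2)%:E +
   2%:E * \int[N]_(z in square) (g z.1 * g z.2 * k z.1 z.2)%:E)%E.
Proof.
have mI := @measurable_Iopen R.
have mg := deformed_meas; have gB := deformed_bounded.
have B0 : 0 <= B := le_trans (normr_ge0 _) (fB 0).
have [Bk kB] := kernel_defect_bounded.
have Bk0 := bounded2_ge0 kB.
have kB' u v : Iopen u -> Iopen v -> `|k u v| <= Bk.
  by move=> Iu Iv; apply: kB; exact: Iopen_closed.
have mk := meas2_kernel_defect.
have dp := tame_diffeo t p0 p1 bq.
have cpsi := diffeo_continuous dp; have [_ cw _ _ _] := dp.
have mpsi : @measurable_fun _ _ T T setT psi by exact: continuous_meas.
have mw : @measurable_fun _ _ T T setT w by exact: continuous_meas.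
have mg1 : meas2 (fun u v => g u) by exact: measurableT_comp mg measurable_fst.
have mg2 : meas2 (fun u v => g v) by exact: measurableT_comp mg measurable_snd.
have w0 u : Iopen u -> 0 <= w u.
  move=> /Iopen_closed Iu; have := bounded2_1Dq bq Iu Iu; lra.
rewrite !seminorm_split//.
pose X u v := (g u - g v) ^+ 2 * (`|w u| * `|w v| / (psi u - psi v) ^+ 2).
pose b u v := (g u - g v) ^+ 2 * k u v.
pose F := increment f.
have mF : measurable_fun setT F := measurable_increment mf.
have F0 : forall z, (0 <= F z)%E := increment_ge0 f.
have mgg : meas2 (fun u v => (g u - g v) ^+ 2).
  by apply: measurable_funX; exact: measurable_funB.
have mX : meas2 X.
  apply: measurable_funM; first exact: mgg.
  apply: measurable_funM.
    have mnw : @measurable_fun _ _ T T setT (fun u => `|w u|) by exact: measurableT_comp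
        (@normr_measurable _ _) mw.
    by apply: measurable_funM; [exact: measurableT_comp mnw measurable_fst|exact:
        measurableT_comp mnw measurable_snd].
  apply: measurable_funV; apply: measurable_funX.
  by apply: measurable_funB; [exact: measurableT_comp mpsi measurable_fst|exact: measurableT_comp
      mpsi measurable_snd].
have mS : meas2 (fun u v => (g u - g v) ^+ 2 / (u - v) ^+ 2).
  by apply/measurable_EFinP; exact: measurable_increment mg.
have Qf : (\int[N]_(z in square) F z = \int[N]_(z in square) (X z.1 z.2)%:E)%E.
  have mX' : measurable_fun setT (fun z : T * T => (X z.1 z.2)%:E) by exact/measurable_EFinP.
  have X0 (z : T * T) : (0 <= (X z.1 z.2)%:E)%E.
    by rewrite lee_fin mulr_ge0 ?sqr_ge0// divr_ge0 ?sqr_ge0// mulr_ge0.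
  rewrite (integral_setX mI mI mF F0) (integral_setX mI mI mX' X0).
  have mH : measurable_fun Iopen (fun u => \int[mu]_(v in Iopen) F (u, v))%E.
    exact: measurable_funS (measurable_inner_integral mI mF F0).
  rewrite (change_of_variables dp mH); last by move=> x _; exact: integral_ge0.
  apply: eq_integral => u; rewrite inE => Iu.
  have Ipu : Iopen (psi u) by apply/(diffeo_Iopen dp (Iopen_closed Iu)).
  have mF1 : measurable_fun setT (fun v => F (psi u, v)) by exact: measurableT_comp mF
      (measurable_pair1 (psi u)).
  rewrite (change_of_variables dp (measurable_funS _ _ mF1))//.
  rewrite muleC -ge0_integralZl//; last 3 first.
  - apply: emeasurable_funM.
      apply: (measurableT_comp (f := fun v => F (psi u, v))) mF1 _.
      exact: measurable_funS mpsi.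
    by apply/measurable_EFinP; exact: measurable_funS mw.
  - by move=> v Iv; rewrite mule_ge0// lee_fin w0.
  - by rewrite lee_fin w0.
  apply: eq_integral => v; rewrite inE => Iv.
  by rewrite /F /increment /X/= !gf// !ger0_norm ?w0// -!EFinM; congr EFin; ring.
have bI : N.-integrable square (EFin \o (fun z => b z.1 z.2)).
  apply: (@square_integrable _ _ ((B + B) * (B + B) * Bk)).
    exact: measurable_funM.
  move=> u v Iu Iv; rewrite normrM; apply: ler_pM => //; last exact: kB'.
  rewrite expr2 normrM; apply: ler_pM => //; apply: le_trans (ler_normB _ _) _; exact: lerD.
have Xe : (\int[N]_(z in square) (X z.1 z.2)%:E = 
  \int[N]_(z in square) ((g z.1 - g z.2) ^+ 2 / (z.1 - z.2) ^+ 2)%:E + 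
  \int[N]_(z in square) (b z.1 z.2)%:E)%E.
  apply: (integral_perturbation measurable_square _ _ _ _ bI).
  - exact: measurable_funS mX.
  - exact: measurable_funS mS.
  - move=> [u v] [/= Iu Iv]; rewrite mulr_ge0 ?sqr_ge0// divr_ge0 ?sqr_ge0//.
  - by move=> z _; rewrite divr_ge0// sqr_ge0.
  - move=> [u v] [/= Iu Iv]; rewrite /X /b /= !ger0_norm ?w0//.
    have [->|uv] := eqVneq u v; first by rewrite subrr expr0n/= !mul0r addr0.
    rewrite (kernel_transform t uv); first by ring.
    by rewrite gt_eqF//; have := bounded2_1Dq bq (Iopen_closed Iu) (Iopen_closed Iv); lra.
pose K u := boundary_weight u - boundary_weight (psi u) * w u.
have kI u : Iopen u -> (\int[mu]_(v in Iopen) (k u v)%:E = (K u)%:E)%E.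
  move=> Iu; have ki := intI_kernel_defect Iu.
  have fin := integrable_fin_num mI ki.
  rewrite -[LHS]fineK//; congr EFin.
  exact: (integral_kernel_defect t p0 p1 bq Iu).
have sqB x : `|(g x) ^+ 2| <= B * B by rewrite expr2 normrM; apply: ler_pM.
have KB u : Iopen u -> `|K u| <= Bk * 2.
  move=> Iu; rewrite /K -(integral_kernel_defect t p0 p1 bq Iu).
  have ki := intI_kernel_defect Iu.
  by apply: integral_norm_le => // v Iv; exact: kB'.
have gKI : intI (fun u => (g u) ^+ 2 * K u).
  have mK : @measurable_fun _ _ T R Iopen K.
    have mbw := @measurable_boundary_weight R.
    apply: (measurable_funS measurableT) => //.
    apply: measurable_funB => //; apply: measurable_funM => //.
    exact: (measurableT_comp mbw mpsi).
  apply: L2_intI; apply: (@L2_bounded _ _ (B * B * (Bk * 2))).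
    apply: measurable_funM => //; apply: measurable_funX; exact: measurable_funS mg.
  by move=> u Iu; rewrite normrM; apply: ler_pM => //; exact: KB.
have mg2k1 : meas2 (fun u v => (g u) ^+ 2 * k u v).
  by apply: measurable_funM => //; exact: measurable_funX.
have mg2k2 : meas2 (fun u v => (g v) ^+ 2 * k u v).
  by apply: measurable_funM => //; exact: measurable_funX.
have mggk : meas2 (fun u v => g u * g v * k u v).
  by apply: measurable_funM => //; exact: measurable_funM.
have b1 u v : Iopen u -> Iopen v -> `|(g u) ^+ 2 * k u v| <= B * B * Bk.
  by move=> Iu Iv; rewrite normrM; apply: ler_pM => //; exact: kB'.
have b2 u v : Iopen u -> Iopen v -> `|(g v) ^+ 2 * k u v| <= B * B * Bk.
  by move=> Iu Iv; rewrite normrM; apply: ler_pM => //; exact: kB'.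
have b3 u v : Iopen u -> Iopen v -> `|g u * g v * k u v| <= B * B * Bk.
  move=> Iu Iv; rewrite normrM; apply: ler_pM => //; last exact: kB'.
  by rewrite normrM; exact: ler_pM.
have gk1 : (\int[N]_(z in square) ((g z.1) ^+ 2 * k z.1 z.2)%:E = \int[mu]_(u in Iopen) ((g u) ^+
    2 * K u)%:E)%E.
  rewrite (square_integral_real mg2k1 b1).
  apply: eq_integral => u; rewrite inE => Iu.
  by rewrite EFinM -kI// -integralZl//; exact: intI_kernel_defect.
have gk2 : (\int[N]_(z in square) ((g z.2) ^+ 2 * k z.1 z.2)%:E = \int[mu]_(u in Iopen) ((g u) ^+
    2 * K u)%:E)%E.
  rewrite (square_integral_real2 mg2k2 b2).
  apply: eq_integral => u; rewrite inE => Iu.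
  rewrite EFinM -kI// -integralZl//; last exact: intI_kernel_defect.
  by apply: eq_integral => v _; rewrite kernel_defect_sym.
have i1 := square_integrable mg2k1 b1; have i2 := square_integrable mg2k2 b2.
have i3 := square_integrable mggk b3.
pose c := \int[mu]_(u in Iopen) ((g u) ^+ 2 * K u).
have cE : (\int[mu]_(u in Iopen) ((g u) ^+ 2 * K u)%:E = c%:E)%E.
  by rewrite /c /Rintegral fineK//; exact: integrable_fin_num gKI.
pose G := fine (\int[N]_(z in square) (g z.1 * g z.2 * k z.1 z.2)%:E)%E.
have GE : (\int[N]_(z in square) (g z.1 * g z.2 * k z.1 z.2)%:E = G%:E)%E.
  by rewrite /G fineK//; exact: (integrable_fin_num measurable_square i3).
have bE : (\int[N]_(z in square) (b z.1 z.2)%:E = (2 * c - 2 * G)%:E)%E.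
  transitivity (\int[N]_(z in square) (((g z.1) ^+ 2 * k z.1 z.2)%:E + ((g z.2) ^+ 2 * k z.1
      z.2)%:E + ((-2)%:E * (g z.1 * g z.2 * k z.1 z.2)%:E)))%E.
    by apply: eq_integral => z _; rewrite -EFinM -!EFinD; congr EFin; rewrite /b; ring.
  have i12 := integrableD measurable_square i1 i2.
  have i3' := integrableZl measurable_square (-2) i3.
  rewrite (integralD measurable_square i12 i3') (integralD measurable_square i1 i2).
  rewrite (integralZl measurable_square i3).
  by rewrite gk1 gk2 cE GE -EFinM -!EFinD; congr EFin; ring.
have bw0 := @boundary_weight_ge0 R.
have mgI : @measurable_fun _ _ T R Iopen g by exact: measurable_funS mg.
have mfI : @measurable_fun _ _ T R Iopen f by exact: measurable_funS mf.
have mbw := @measurable_boundary_weight R.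
have mbwI : @measurable_fun _ _ T R Iopen (@boundary_weight R) by exact: measurable_funS mbw.
have Ipsi u : Iopen u -> Iopen (psi u) by move=> Iu; apply/(diffeo_Iopen dp (Iopen_closed Iu)).
have Pe : (\int[mu]_(u in Iopen) ((g u) ^+ 2 * boundary_weight u)%:E =
   \int[mu]_(u in Iopen) ((f u) ^+ 2 * boundary_weight u)%:E + c%:E)%E.
  have mG : @measurable_fun _ _ T _ Iopen (fun u => ((f u) ^+ 2 * boundary_weight u)%:E).
    apply/measurable_EFinP; apply: measurable_funM => //; exact: measurable_funX.
  rewrite (change_of_variables dp mG); last first.
    by move=> u Iu; rewrite lee_fin mulr_ge0 ?sqr_ge0 ?bw0.
  under [X in (_ = X + _)%E]eq_integral do rewrite -EFinM.
  rewrite -cE; apply: (integral_perturbation mI _ _ _ _ gKI).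
  - by apply: measurable_funM => //; exact: measurable_funX.
  - apply: measurable_funM; last exact: measurable_funS mw.
    apply: measurable_funM.
      apply: measurable_funX; exact: measurable_funS (measurableT_comp mf mpsi).
    exact: measurable_funS (measurableT_comp mbw mpsi).
  - by move=> u Iu; rewrite mulr_ge0 ?sqr_ge0 ?bw0.
  - move=> u Iu; have Ipu := Ipsi u Iu.
    by apply: mulr_ge0; [apply: mulr_ge0; [exact: sqr_ge0|exact: bw0]|exact: w0].
  - by move=> u Iu; rewrite /K gf//; ring.
rewrite Pe GE Qf Xe bE.
have S0 : (0 <= \int[N]_(z in square) ((g z.1 - g z.2) ^+ 2 / (z.1 - z.2) ^+ 2)%:E)%E.
  by apply: integral_ge0 => z _; rewrite lee_fin divr_ge0// sqr_ge0.
have P0 : (0 <= \int[mu]_(u in Iopen) ((f u) ^+ 2 * boundary_weight u)%:E)%E.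
  by apply: integral_ge0 => u /bw0 h; rewrite lee_fin mulr_ge0// sqr_ge0.
clearbody c G.
move: S0 P0; move: (integral _ square _) => S; set P := (integral _ _ _); move: P => P.
case: S => [x| |]//; case: P => [y| |]// _ _.
- by rewrite -?EFinM -?EFinD -?EFinM -?EFinD; congr EFin; ring.
- rewrite -?EFinM -?EFinD ?(addye, addey, gt0_muley)//= ?lte_fin//.
- rewrite -?EFinM -?EFinD ?(addye, addey, gt0_muley)//= ?lte_fin//.
Qed.

(** Only the product g u * g v enters, so a one-sided bound on it against the
    kernel defect is enough; a negative constant c is a gain. *)
Lemma seminorm_deformation (c : R) :
  (forall u v, Iopen u -> Iopen v -> g u * g v * k u v <= c * (`|g u| * `|g v|)) ->
  (sqr_seminorm_Hhalf g <= sqr_seminorm_Hhalf f + (c / pi * (\int[mu]_(u in Iopen) `|g u|) ^+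
      2)%:E)%E.
Proof.
move=> hc; have mI := @measurable_Iopen R.
have mg := deformed_meas; have gB := deformed_bounded.
have B0 : 0 <= B := le_trans (normr_ge0 _) (fB 0).
have [Bk kB] := kernel_defect_bounded.
have mg1 : meas2 (fun u v => g u) by exact: measurableT_comp mg measurable_fst.
have mg2 : meas2 (fun u v => g v) by exact: measurableT_comp mg measurable_snd.
have mng : @measurable_fun _ _ T R setT (fun u => `|g u|).
  exact: measurableT_comp (@normr_measurable _ _) mg.
have mnn : meas2 (fun u v => c * (`|g u| * `|g v|)).
  apply: measurable_funM; first exact: measurable_cst.
  by apply: measurable_funM; [exact: measurableT_comp mng measurable_fst|exact: measurableT_comp
      mng measurable_snd].
have mgk : meas2 (fun u v => g u * g v * k u v).
  by apply: measurable_funM; [exact: measurable_funM|exact: meas2_kernel_defect].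
have b1 u v : Iopen u -> Iopen v -> `|g u * g v * k u v| <= B * B * Bk.
  move=> Iu Iv; rewrite normrM; apply: ler_pM => //; last by apply: kB; exact: Iopen_closed.
  by rewrite normrM; exact: ler_pM.
have b2 u v : Iopen u -> Iopen v -> `|c * (`|g u| * `|g v|)| <= `|c| * (B * B).
  move=> Iu Iv; rewrite normrM; apply: ler_pM => //.
  by rewrite normrM !normr_id; exact: ler_pM.
have gI : intI (fun u => `|g u|).
  apply: L2_intI; apply: (@L2_bounded _ _ B); first exact: measurable_funS mng.
  by move=> u _; rewrite normr_id.
have gE : (\int[mu]_(u in Iopen) (`|g u|)%:E = (\int[mu]_(u in Iopen) `|g u|)%:E)%E.
  by rewrite /Rintegral fineK//; exact: (integrable_fin_num mI gI).
have le : (\int[N]_(z in square) (g z.1 * g z.2 * k z.1 z.2)%:E <=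
    (c * (\int[mu]_(u in Iopen) `|g u|) ^+ 2)%:E)%E.
  apply: (@le_trans _ _ (\int[N]_(z in square) (c * (`|g z.1| * `|g z.2|))%:E)%E).
    apply: (le_integral measurable_square (square_integrable mgk b1) (square_integrable mnn b2)).
    by move=> [u v]; rewrite inE => -[/= Iu Iv]; rewrite lee_fin; exact: hc.
  rewrite (square_integral_real mnn b2).
  move: gE; set J := (\int[mu]_(u in Iopen) `|g u|)%R => gE.
  have inner u : (\int[mu]_(v in Iopen) (c * (`|g u| * `|g v|))%:E = (c * J)%:E * (`|g u|)%:E)%E.
    under eq_integral => v _ do rewrite mulrA EFinM.
    by rewrite (integralZl mI gI) gE -!EFinM; congr EFin; ring.
  under eq_integral => u _ do rewrite inner.
  by rewrite (integralZl mI gI) gE -!EFinM lee_fin expr2 mulrA.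
rewrite /sqr_seminorm_Hhalf seminorm_transform.
have H0 : (0 <= \int[mu]_s \int[mu]_t ((f s - f t) ^+ 2 / (s - t) ^+ 2)%:E)%E.
  by apply: integral_ge0 => u _; apply: integral_ge0 => v _; rewrite lee_fin divr_ge0// sqr_ge0.
have pi0 := pi_gt0 R.
have fG := integrable_fin_num measurable_square (square_integrable mgk b1).
have [G GE] : exists G, (\int[N]_(z in square) (g z.1 * g z.2 * k z.1 z.2)%:E = G%:E)%E.
  by exists (fine (\int[N]_(z in square) (g z.1 * g z.2 * k z.1 z.2)%:E)%E); rewrite fineK.
rewrite GE lee_fin in le; rewrite GE -EFinM muleDr//; last by rewrite fin_num_adde_defl.
rewrite leeD2l// -EFinM lee_fin.
have -> : c / pi * (\int[mu]_(u in Iopen) `|g u|) ^+ 2 = (2 * pi)^-1 * (2 * (c * (\int[mu]_(u in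
    Iopen) `|g u|) ^+ 2)).
  move: (Rintegral _ _ _) => J; have e : (2 : R)^-1 * 2 = 1 by rewrite mulVf.
  rewrite invfM [RHS](_ : _ = (2^-1 * 2) * (c * pi^-1 * J ^+ 2)); last by ring.
  by rewrite e mul1r.
by rewrite ler_pM2l ?invr_gt0 ?mulr_gt0// ler_pM2l.
Qed.

End Deformation.

(** * Asymptotics of the logarithm *)

Section Asymptotics.
Context {R : realType}.
Implicit Types (eps : R).

Lemma remainderP (r : R -> R) : remainder r <->
  forall c : R, 0 < c -> \forall eps \near (0 : R)^'+, `|r eps| <= c / logdelta eps ^+ 2.
Proof.
rewrite /remainder; split.
  move=> /eqoP h c c0; have := h c c0; apply: filterS => eps.
  by rewrite [X in _ <= _ * X -> _]ger0_norm ?divr_ge0 ?sqr_ge0// mul1r.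
move=> h; apply/eqoP => c c0; have := h c c0; apply: filterS => eps.
by rewrite [X in _ -> _ <= _ * X]ger0_norm ?divr_ge0 ?sqr_ge0// mul1r.
Qed.

Lemma near0P (P : R -> Prop) : (\forall eps \near (0 : R)^'+, P eps) <->
  exists2 X : R, 0 < X & forall eps, 0 < eps < X -> P eps.
Proof.
split => [[X /= X0 h]|[X X0 h]].
  exists X => // eps /andP[e0 eX]; apply: h => //=.
  by rewrite sub0r normrN gtr0_norm.
near=> eps; apply: h; apply/andP; split.
  by near: eps; exact: nbhs_right_gt.
by near: eps; exact: nbhs_right_lt.
Unshelve. all: by end_near. Qed.

Lemma lnN_expR (x eps : R) : 0 < eps < expR (- x) -> x < ln (1 / eps).
Proof.
move=> /andP[e0 ex]; rewrite div1r lnV ?posrE//.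
by rewrite -ltrN2 opprK -ltr_expR lnK ?posrE.
Qed.

(** Square the inequality x / 2 <= exp (x / 2). *)
Lemma ln_growth (x : R) : 0 < x -> x * x <= 4 * expR x.
Proof.
move=> x0; have h : x / 2 <= expR (x / 2).
  by apply: le_trans (expR_ge1Dx _); rewrite lerDr.
have -> : expR x = expR (x / 2) * expR (x / 2) by rewrite -expRD -splitr.
have : x / 2 * (x / 2) <= expR (x / 2) * expR (x / 2).
  by apply: ler_pM => //; rewrite divr_ge0// ltW.
by lra.
Qed.

(** With y = log (1 / eps), delta is y exp (- y), which is at most 4 / y. *)
Lemma delta_bounds (x eps : R) : 0 < x -> 0 < eps < expR (- x) ->
  0 < delta eps <= 4 / x.
Proof.
move=> x0 h; have l := lnN_expR h; have [e0 _] := andP h.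
set y := ln (1 / eps) in l; have y0 : 0 < y := lt_trans x0 l.
rewrite /delta -/y mulr_gt0//= (_ : eps = expR (- y)); last first.
  by rewrite /y div1r lnV ?posrE// opprK lnK ?posrE.
rewrite expRN mulrC ler_pdivrMr ?expR_gt0//.
rewrite mulrAC ler_pdivlMr//; apply: le_trans (ln_growth y0).
by apply: ler_wpM2l; exact: ltW.
Qed.

Lemma near_logdelta_ge (M : R) : \forall eps \near (0 : R)^'+, M <= logdelta eps.
Proof.
have e0 := expR_gt0 M.
have x0 : 0 < 4 * expR M by rewrite mulr_gt0.
apply/near0P; exists (expR (- (4 * expR M))); first exact: expR_gt0.
move=> eps h; have /andP[d0 d1] := delta_bounds x0 h.
rewrite /logdelta -ler_expR lnK ?posrE ?divr_gt0// ler_pdivlMr//.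
rewrite mulrC -ler_pdivlMr//; apply: le_trans d1 _.
by rewrite invfM mulrA divff// mul1r div1r.
Qed.

Lemma near_quarter (P : R -> Prop) : (\forall eps \near (0 : R)^'+, P eps) ->
  \forall eps \near (0 : R)^'+, P (eps / 4).
Proof.
move=> /near0P[X X0 h]; apply/near0P; exists X => // eps /andP[e0 eX].
by apply: h; rewrite divr_gt0//=; lra.
Qed.

(** The quantity delta (eps / 4) lies between delta eps / 4 and delta eps, and
    log 4 <= 2. *)
Lemma near_logdelta_quarter : \forall eps \near (0 : R)^'+,
  logdelta eps <= logdelta (eps / 4) <= logdelta eps + 2.
Proof.
apply/near0P; exists (expR (- 1)); first exact: expR_gt0.
move=> eps h; have h1 := lnN_expR h; have [e0 _] := andP h.
have l4 : ln (1 / (eps / 4)) = ln (1 / eps) + ln 4.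
  by rewrite !div1r invfM invrK lnM ?posrE ?invr_gt0.
have ln4 : 0 <= ln (4 : R) <= 2.
  rewrite ln_ge0//=; last lra.
  rewrite -ler_expR lnK ?posrE//.
  have := expR_ge1Dx (1 : R); rewrite -[X in _ -> _ <= expR X]/(1 + 1) expRD => h2.
  by apply: le_trans (_ : 2 * 2 <= _); [lra | apply: ler_pM; lra].
have [l40 l42] := andP ln4.
have d0 : 0 < delta eps by rewrite /delta mulr_gt0//; lra.
have d1 : 0 < delta (eps / 4) by rewrite /delta l4 mulr_gt0 ?divr_gt0//; lra.
rewrite /logdelta; apply/andP; split.
  rewrite ler_ln ?posrE ?divr_gt0// !div1r lef_pV2 ?posrE//.
  rewrite /delta l4 -mulrA; apply: ler_wpM2l; first exact: ltW.
  by lra.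
have -> : ln (1 / delta eps) + 2 = ln (expR 2 / delta eps).
  by rewrite lnM ?posrE ?expR_gt0 ?invr_gt0// expRK div1r addrC.
rewrite ler_ln ?posrE ?divr_gt0 ?expR_gt0// ler_pdivlMr// mulrAC ler_pdivrMr// mul1r.
have e4 : 4 <= expR (2 : R).
  by rewrite -[leLHS]lnK ?posrE// ler_expR.
apply: le_trans (_ : 4 * delta (eps / 4) <= _); last by apply: ler_wpM2r => //; exact: ltW.
rewrite /delta l4 mulrCA mulrA divfK//; apply: ler_wpM2l; first exact: ltW.
by lra.
Qed.

End Asymptotics.

(** * Step functions *)

Section Steps.
Context {R : realType}.
Local Notation mu := (@lebesgue_measure R).
Local Notation meas D f := (@measurable_fun _ _ (measurableTypeR R) R D f).
Implicit Types f g : R -> R.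

Definition after (a x : R) : R := if a < x then 1 else 0.

Lemma meas_after (a : R) : meas Iopen (after a).
Proof.
rewrite (_ : after a = \1_(`]a, +oo[%classic)); last first.
  by apply/funext => x; rewrite /after indicE mem_setE /= in_itv/= andbT; case: (a < x).
apply: measurable_indic; exact: measurable_itv.
Qed.

Lemma intI_after f (a : R) : intI f -> intI (fun x => f x * after a x).
Proof.
move=> fi; apply: (@intIM_bounded _ f (after a) 1 fi (meas_after a)).
by move=> x _; rewrite /after; case: (a < x); rewrite ?normr1 ?normr0.
Qed.

(** Switching on a primitive after the point a, without a jump. *)
Lemma prim_after f g (a : R) : prim f g -> -1 < a < 1 ->
  prim (fun x => (f x - f a) * after a x) (fun x => g x * after a x).
Proof.
move=> [gi hf] /andP[a1 a2]; split; first exact: intI_after.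
have E x : (f x - f a) * after a x = if a <= x then f x - f a else 0.
  by rewrite /after; case: ltgtP => [h|h|->]; rewrite ?mulr1 ?mulr0 ?subrr ?mul0r.
have low x y : y <= a -> \int[mu]_(t in `]x, y[) (g t * after a t) = 0.
  move=> ya; rewrite (@integral_eq_in _ x y _ (cst 0)); last first.
    by move=> t /andP[_ ty]; rewrite /after ltNge (le_trans (ltW ty) ya) mulr0.
  by rewrite Rintegral_cst ?mul0r.
have high x y : a <= x -> \int[mu]_(t in `]x, y[) (g t * after a t) = \int[mu]_(t in `]x, y[) g t.
  move=> ax; apply: integral_eq_in => t /andP[xt _].
  by rewrite /after (le_lt_trans ax xt) mulr1.
move=> x y x1 xy y1; rewrite !E.
have [ay|ya] := leP a y; last first.
  by rewrite leNgt (le_lt_trans xy ya)/= subr0 low// ltW.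
have [ax|xa] := leP a x.
  by rewrite high// -hf//; ring.
rewrite (integral_itv_add (intI_after a gi) x1 (ltW xa) ay y1) low// high//.
by rewrite add0r subr0 hf// ltW.
Qed.

Lemma intI_test f psi : intI f -> test_function psi -> intI (fun x => f x * derive1 psi x).
Proof.
move=> fi /test_function_smooth /smooth_derive1 /smooth_continuous /cont11_continuous c.
have [M hM] := cont11_bounded c.
exact: (@intIM_bounded _ f (derive1 psi) M fi (cont11_meas c) (fun x Ix => hM x (Iopen_closed Ix))).
Qed.

Definition step (N : nat) (c : R) (a w : 'I_N -> R) (x : R) : R :=
  c + \sum_(n < N) w n * after (a n) x.

(** The step function has the same distributional derivative, because switching
    on a test function at a_n leaves - psi(a_n) at the right end point. *)
Lemma step_ae (N : nat) (a w : 'I_N -> R) f : intI f ->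
  (forall n, -1 < a n < 1) -> derivative_is_dirac_sum f a w ->
  exists c, {ae mu, forall x, Iopen x -> f x = step c a w x}.
Proof.
move=> fi ha hf.
pose g x := \sum_(n < N) w n * after (a n) x.
have gi : intI g /\ forall psi, test_function psi -> \int[mu]_(x in Iopen) (g x * derive1 psi x)
    = - \sum_(n < N) w n * psi (a n).
  rewrite /g; elim: N a w ha {hf g} => [|N IH] a w ha.
    split; first by under eq_fun do rewrite big_ord0; exact: intI_cst.
    move=> psi _; rewrite big_ord0 oppr0; under eq_Rintegral do rewrite big_ord0 mul0r.
    by rewrite Rintegral_cst ?mul0r//; exact: measurable_Iopen.
  have [gi hg] := IH (fun n => a (widen_ord (leqnSn N) n)) (fun n => w (widen_ord (leqnSn N) n))
      (fun n => ha _).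
  have li : intI (fun x => w ord_max * after (a ord_max) x).
    apply: intIZ; have := intI_after (a ord_max) (intI_cst 1).
    by apply: eq_integrable; [exact: measurable_Iopen | move=> x _ /=; rewrite mul1r].
  split.
    have := intID gi li.
    by apply: eq_integrable; [exact: measurable_Iopen | move=> x _ /=; rewrite big_ord_recr].
  move=> psi tp; have pp := prim_test tp; have [p0 p1] := test_boundary tp.
  have [ppi _] := pp.
  have [M hM] := cont11_bounded (prim_cont (prim_test tp)).
  have [i1 h1] := prim_after pp (ha ord_max).
  have := h1 (-1) 1 (lexx _) ltac:(lra) (lexx _).
  have [a1 a2] := andP (ha ord_max).
  have A1 : after (a ord_max) 1 = 1 by rewrite /after a2.
  have A0 : after (a ord_max) (-1) = 0 by rewrite /after ltNge (ltW a1).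
  rewrite p0 p1 A1 A0 mulr1 mulr0 subr0 sub0r -/Iopen => e.
  have i2 : intI (fun x => (\sum_(n < N) w (widen_ord (leqnSn N) n) * after (a (widen_ord (leqnSn
      N) n)) x) * derive1 psi x).
    exact: intI_test gi tp.
  transitivity (\int[mu]_(x in Iopen) ((\sum_(n < N) w (widen_ord (leqnSn N) n) * after (a
      (widen_ord (leqnSn N) n)) x) * derive1 psi x +
     w ord_max * (derive1 psi x * after (a ord_max) x))).
    by apply: eq_Rintegral => x _; rewrite big_ord_recr/=; ring.
  rewrite RintegralD//; [|exact: measurable_Iopen|exact: intIZ].
  rewrite RintegralZl//; last exact: measurable_Iopen.
  by rewrite hg// -e big_ord_recr/=; ring.
have [gi' hg] := gi.
have [|c hc] := du_bois_reymond (intIB fi gi').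
  move=> psi tp.
  transitivity (\int[mu]_(x in Iopen) (f x * derive1 psi x - g x * derive1 psi x)).
    by apply: eq_Rintegral => x _; rewrite /= mulrBl.
  rewrite RintegralB; [|exact: measurable_Iopen|exact: intI_test|exact: intI_test].
  by rewrite hf// hg// subrr.
exists c; apply: aeS hc => x hx Ix; have := hx Ix; rewrite /step /= -/(g x) => <-.
by rewrite subrK.
Qed.

End Steps.

(** * Angles before and after a jump *)

Section JumpAngles.
Context {R : realType}.
Implicit Types (alpha u w x : R).

Lemma cos_2piZ (k : int) x : cos (2 * pi * k%:~R + x) = cos x.
Proof.
have h (n : nat) (y : R) : cos (y + 2 * pi * n%:R) = cos y.
  have := periodicn (@cosD2pi R) n y; rewrite -mulr_natr -mulr_natl => <-.
  by congr cos; ring.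
case: k => n; first by rewrite addrC -pmulrn h.
rewrite NegzE mulrNz -pmulrn -(h n.+1); congr cos; ring.
Qed.

Lemma cos_eq1 (x : R) : cos x = 1 -> in_2piZ_plus 0 x.
Proof.
move=> c1; have pi0 := pi_gt0 R; have p2 : 0 < 2 * pi :> R by rewrite mulr_gt0.
pose k := Num.floor (x / (2 * pi)); pose y := x - 2 * pi * k%:~R.
have /andP[k1 k2] := floor_itv (x / (2 * pi)); rewrite -/k in k1 k2.
have y0 : 0 <= y by rewrite /y subr_ge0 mulrC -ler_pdivlMr.
have y1 : y < 2 * pi.
  by rewrite /y ltrBlDl -[X in _ + X]mulr1 -mulrDr mulrC -ltr_pdivrMr// -[1]/(1%:~R) -intrD.
have cy : cos y = 1 by rewrite -(cos_2piZ k y) /y addrC subrK.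
have inj (z : R) : 0 <= z <= pi -> cos z = 1 -> z = 0.
  move=> hz cz; apply: (@cos_inj R); rewrite ?in_itv//= ?lexx ?ltW//.
  by rewrite cz cos0.
have y00 : y = 0.
  have [h|h] := leP y pi; first by apply: inj => //; rewrite y0.
  have : 2 * pi - y = 0.
    apply: inj; first by apply/andP; split; lra.
    have := cos_2piZ 1 (- y); rewrite mulr1 cosN => ->; exact: cy.
  by move=> e; exfalso; lra.
by exists k; rewrite addr0; move/eqP: y00; rewrite subr_eq0 => /eqP.
Qed.

Lemma in_2piZ_pm_cos alpha x : in_2piZ_pm alpha x -> cos x = cos alpha.
Proof. by move=> [] [k ->]; rewrite cos_2piZ// cosN. Qed.

(** A jump between two angles of the same cosine passes, half way, through a
    multiple of pi; its parity is the sign of the transition. *)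
Lemma jump_geometry alpha u w : 0 < alpha < pi -> cos u = cos alpha ->
  cos (u + w) = cos alpha -> jump_size alpha w ->
  exists b : bool, [/\ sin (u + w / 2) = 0, cos (u + w / 2) = pm b &
    `|w| = 2 * (if b then alpha else pi - alpha)].
Proof.
move=> /andP[a0 a1] cu cw js.
set T := u + w / 2; set h := w / 2.
have eu : u = T - h by rewrite /T addrK.
have ew : u + w = T + h by rewrite /T /h -addrA -splitr.
rewrite eu cosB in cu; rewrite ew cosD in cw.
have hh : `|h| = alpha \/ `|h| = pi - alpha.
  rewrite /h normrM normfV (@ger0_norm _ 2)//; case: js => ->; [left|right]; by field.
have h0 : 0 < `|h| < pi by apply/andP; case: hh => ->; split; lra.
have sh : sin `|h| != 0 by rewrite gt_eqF// sin_gt0_pi.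
have s0 : sin T = 0.
  apply: (mulIf sh); rewrite mul0r; have : sin T * sin h = 0 by lra.
  by case: (ger0P h) => // _; rewrite sinN mulrN => ->; rewrite oppr0.
have cTE : cos T * cos h = cos alpha by rewrite s0 mul0r addr0 in cu.
have chE : cos h = cos `|h| by case: (ger0P h) => // _; rewrite cosN.
have [/andP[h1 h2]] := h0.
have hin : `|h| \in `[0, pi] by rewrite in_itv/= !ltW.
have wh : `|w| = 2 * `|h|.
  by rewrite /h normrM normfV (@ger0_norm _ 2)// mulrC divfK.
have : `|cos T| = 1 by exact: sin0cos1.
case: (ger0P (cos T)) => _ cT.
  exists true; split => //; rewrite wh; congr (_ * _).
  apply: (@cos_inj R) => //; first by rewrite in_itv/= !ltW.
  by rewrite -chE -cTE cT mul1r.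
have {}cT : cos T = -1 by rewrite -cT opprK.
exists false; split => //; rewrite wh; congr (_ * _).
apply: (@cos_inj R) => //; first by rewrite in_itv/=; apply/andP; split; lra.
by rewrite -chE cosB cospi sinpi mul0r addr0 -cTE cT !mulN1r opprK.
Qed.

End JumpAngles.

(** * Values and limits of step functions *)

Section StepValues.
Context {R : realType}.
Local Notation mu := (@lebesgue_measure R).

(** Intervals are not null sets. *)
Lemma ae_point (P : R -> Prop) (l r : R) : -1 <= l -> l < r -> r <= 1 ->
  {ae mu, forall x, Iopen x -> P x} -> exists2 x, l < x < r & P x.
Proof.
move=> l1 lr r1 [N [mN N0 hN]]; apply: contrapT => nP.
have sub : `]l, r[%classic `<=` N.
  move=> t /= ht; apply: hN => /= h; apply: nP; exists t.
    by move: ht; rewrite in_itv.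
  by apply: h; apply: (itv_oo_Iopen l1 r1).
have : (mu `]l, r[%classic <= mu N)%E by apply: le_measure => //; rewrite inE.
by rewrite N0 lebesgue_measure_itv /= lte_fin lr -EFinD lee_fin subr_le0 leNgt lr.
Qed.

Variables (N : nat) (c : R) (a w : 'I_N -> R).
Local Notation st := (step c a w).

Lemma step_left (y : R) : exists2 h, 0 < h & forall x, y - h < x <= y -> st x = st y.
Proof.
suff : \forall h \near (0 : R)^'+, forall n : 'I_N, forall x, y - h < x <= y -> after (a n) x =
    after (a n) y.
  move=> /near0P[X X0 hX]; exists (X / 2); first by rewrite divr_gt0.
  move=> x hx; rewrite /step; congr (_ + _); apply: eq_bigr => n _; congr (_ * _).
  by apply: (hX (X / 2)) hx; lra.
apply: filter_forall => n; apply/near0P; exists (if a n < y then y - a n else 1).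
  by case: ifP => // h; rewrite subr_gt0.
move=> h; rewrite /after; case: ifP => ay /andP[h0 h1] x /andP[x1 x2].
  by rewrite ifT//; lra.
by rewrite ifF//; apply/negP => ax; move/negP: ay; apply; exact: lt_le_trans ax x2.
Qed.

Lemma step_right (y : R) : exists2 h, 0 < h & forall x, y < x < y + h ->
  st x = c + \sum_(n < N) w n * (if a n <= y then 1 else 0).
Proof.
suff : \forall h \near (0 : R)^'+, forall n : 'I_N, forall x, y < x < y + h ->
    after (a n) x = if a n <= y then 1 else 0.
  move=> /near0P[X X0 hX]; exists (X / 2); first by rewrite divr_gt0.
  move=> x hx; rewrite /step; congr (_ + _); apply: eq_bigr => n _; congr (_ * _).
  by apply: (hX (X / 2)) hx; lra.
apply: filter_forall => n; apply/near0P; exists (if a n <= y then 1 else a n - y).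
  by case: (leP (a n) y) => // h; rewrite subr_gt0.
move=> h; rewrite /after; case: (leP (a n) y) => ay /andP[h0 h1] x /andP[x1 x2].
  by rewrite ifT//; lra.
by rewrite ifF//; apply/negbTE; rewrite -leNgt; lra.
Qed.

Hypothesis oa : ordered_points a.

Lemma ordered_points_inj : injective a.
Proof.
have [_ lt] := oa; move=> i j e; apply: val_inj => /=.
by case: (ltngtP i j) => // /lt; rewrite e ltxx.
Qed.

(** Crossing the node a_n adds exactly the n-th jump, since the nodes are
    distinct. *)
Lemma step_after (n : 'I_N) : c + \sum_(m < N) w m * (if a m <= a n then 1 else 0) = st (a n) + w n.
Proof.
rewrite /step -addrA; congr (_ + _).
rewrite (bigD1 n)//= [in RHS](bigD1 n)//= /after lexx ltxx mulr1 mulr0 add0r addrC; congr (_ + _).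
apply: eq_bigr => m mn; congr (_ * _); rewrite [in RHS]lt_neqAle.
by rewrite (inj_eq ordered_points_inj) mn.
Qed.

Variables (alpha : R) (f : R -> R).
Hypothesis fst : {ae mu, forall x, Iopen x -> f x = st x}.
Hypothesis fpm : {ae mu, forall x, Iopen x -> in_2piZ_pm alpha (f x)}.

Lemma step_pm : {ae mu, forall x, Iopen x -> in_2piZ_pm alpha (st x)}.
Proof. by apply: aeS2 fst fpm => x h1 h2 Ix; rewrite -h1//; exact: h2. Qed.

Lemma step_value_left (y : R) : -1 < y <= 1 -> in_2piZ_pm alpha (st y).
Proof.
move=> /andP[y1 y2]; have [h h0 hh] := step_left y.
have l1 : -1 <= Num.max (-1) (y - h) by rewrite le_max lexx.
have l2 : Num.max (-1) (y - h) < y by rewrite gt_max y1/=; lra.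
have [x /andP[]] := ae_point l1 l2 y2 step_pm.
by rewrite gt_max => /andP[_ x1] x2; rewrite hh// x1 ltW.
Qed.

Lemma step_value_right (y : R) : -1 <= y < 1 ->
  in_2piZ_pm alpha (c + \sum_(n < N) w n * (if a n <= y then 1 else 0)).
Proof.
move=> /andP[y1 y2]; have [h h0 hh] := step_right y.
have l1 : Num.min 1 (y + h) <= 1 by rewrite ge_min lexx.
have l2 : y < Num.min 1 (y + h) by rewrite lt_min y2/=; lra.
have [x /andP[x1]] := ae_point y1 l2 l1 step_pm.
by rewrite lt_min => /andP[_ x2]; rewrite hh// x1.
Qed.

Lemma step_start : c + \sum_(n < N) w n * (if a n <= -1 then 1 else 0) = c.
Proof.
rewrite big1 ?addr0// => n _; have [/(_ n)/andP[h _] _] := oa.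
by rewrite leNgt h mulr0.
Qed.

Lemma step_left_limit (n : 'I_N) : left_limit f (a n) (st (a n)).
Proof.
move=> k k0; have [h h0 hh] := step_left (a n).
have [/(_ n)/andP[a1 a2] _] := oa.
exists (Num.min h (a n + 1)); first by rewrite lt_min h0; lra.
apply: aeS fst => x hx /andP[]; rewrite ltrBlDl -ltrBlDr lt_min => /andP[x1 x2] x3.
rewrite hx; last by rewrite IopenE; apply/andP; split; lra.
by rewrite hh ?subrr ?normr0//; apply/andP; split; lra.
Qed.

Lemma left_limit_step (n : 'I_N) (l : R) : left_limit f (a n) l -> l = st (a n).
Proof.
move=> hl; apply/eqP; rewrite eq_sym -subr_eq0 -normr_eq0; apply/negPn/negP => ne.
have k0 : 0 < `|st (a n) - l| by rewrite lt_neqAle eq_sym ne /=.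
have [h' h0' hh'] := hl _ k0; have [h h0 hh] := step_left (a n).
have [/(_ n)/andP[a1 a2] _] := oa.
have l1 : -1 <= Num.max (-1) (a n - Num.min h h') by rewrite le_max lexx.
have l2 : Num.max (-1) (a n - Num.min h h') < a n.
  by rewrite gt_max a1/= ltrBlDr ltrDl lt_min h0.
have ae : {ae mu, forall x, Iopen x -> (a n - h' < x < a n -> `|f x - l| < `|st (a n) - l|) /\ f
    x = st x}.
  by apply: aeS2 hh' fst => x h1 h2 Ix; split; [exact: h1|exact: h2].
have [x /andP[]] := ae_point l1 l2 (ltW a2) ae.
rewrite gt_max ltrBlDr -ltrBlDl lt_min => /andP[x1 /andP[x2 x3]] x4 [h1 h2].
have : `|f x - l| < `|st (a n) - l| by apply: h1; apply/andP; split; lra.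
by rewrite h2 hh ?ltxx//; apply/andP; split; lra.
Qed.

Lemma right_limit_step (l : R) : right_limit f (-1) l -> l = c.
Proof.
move=> hl; apply/eqP; rewrite eq_sym -subr_eq0 -normr_eq0; apply/negPn/negP => ne.
have k0 : 0 < `|c - l| by rewrite lt_neqAle eq_sym ne /=.
have [h' h0' hh'] := hl _ k0; have [h h0 hh] := step_right (-1).
have l1 : Num.min 1 (-1 + Num.min h h') <= 1 by rewrite ge_min lexx.
have l2 : -1 < Num.min 1 (-1 + Num.min h h').
  by rewrite lt_min ltrDl lt_min h0 h0'/= andbT; lra.
have ae : {ae mu, forall x, Iopen x -> (-1 < x < -1 + h' -> `|f x - l| < `|c - l|) /\ f x = st x}.
  by apply: aeS2 hh' fst => x h1 h2 Ix; split; [exact: h1|exact: h2].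
have [x /andP[x1]] := ae_point (lexx _) l2 l1 ae.
rewrite lt_min -ltrBlDl lt_min => /andP[x2 /andP[x3 x4]] [h1 h2].
have : `|f x - l| < `|c - l| by apply: h1; apply/andP; split; lra.
by rewrite h2 hh ?step_start ?ltxx//; apply/andP; split; lra.
Qed.

End StepValues.

(** * Transition profiles and jump representations *)

Section Profile.
Context {R : realType}.
Local Notation mu := (@lebesgue_measure R).

(** The jumps of a simple function, seen from the points half way up. *)
Definition jumps_at (alpha c : R) (N : nat) (a w : 'I_N -> R) (d : 'I_N -> bool) : Prop :=
  forall n, [/\ sin (step c a w (a n) + w n / 2) = 0,
    cos (step c a w (a n) + w n / 2) = pm (d n) &
    `|w n| = 2 * (if d n then alpha else pi - alpha)].

(** If alpha is not pi / 2, then the size of a jump determines its sign.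
    Otherwise a jump is positive if and only if it goes half way through 2 pi Z. *)
Lemma profile_step (alpha : R) (phi0 : R -> R) (N : nat) (a : 'I_N -> R) (d : 'I_N -> bool) :
  0 < alpha < pi -> Phi alpha phi0 -> transition_profile alpha phi0 a d ->
  exists c w, [/\ simple_representation alpha phi0 a w,
    {ae mu, forall x, Iopen x -> phi0 x = step c a w x} & jumps_at alpha c a w d].
Proof.
move=> ha [[fi _] fpm] [w rep [hd1 hd2]]; have [oa js dd] := rep.
have [aI _] := oa; have [c fst] := step_ae fi aI dd.
exists c, w; split => // n.
have [a1 a2] := andP (aI n); have [al0 al1] := andP ha.
have ul : in_2piZ_pm alpha (step c a w (a n)).
  by apply: (step_value_left fst fpm); rewrite a1 ltW.
have ur : in_2piZ_pm alpha (step c a w (a n) + w n).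
  rewrite -(step_after c w oa); apply: (step_value_right fst fpm); by rewrite a2 ltW.
have [b [s0 cb wb]] := jump_geometry ha (in_2piZ_pm_cos ul) (in_2piZ_pm_cos ur) (js n).
suff -> : d n = b by split.
have [ap|ap] := pselect (alpha = pi / 2); last first.
  have [h1 h2] := hd1 ap n; case: b wb {cb} => wb; first exact: h1.
  by apply: h2; rewrite wb; ring.
have [h1 h2] := hd2 ap n.
have wpi : `|w n| = pi by rewrite wb; case: (b); rewrite ap; field.
have sl := step_left_limit oa fst n.
have wcase : w n = pi \/ w n = - pi.
  by move: wpi; case: (ger0P (w n)) => _ <-; [left|right]; rewrite ?opprK.
case: b cb {wb} => cb.
  apply: h1; have [k hk] := cos_eq1 cb; rewrite addr0 in hk.
  case: wcase => wp; [left|right]; split => //; exists (step c a w (a n)) => //; exists k;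
    rewrite -hk wp; lra.
apply: h2 => pj; have : cos (step c a w (a n) + w n / 2) = 1.
  case: pj => -[[l ll [k hk]] wp]; rewrite -(left_limit_step oa fst ll) hk wp.
    by rewrite -addrA addNr addr0 -[X in cos X]addr0 cos_2piZ cos0.
  by rewrite mulNr -addrA subrr addr0 -[X in cos X]addr0 cos_2piZ cos0.
by rewrite cb /pm => h; exfalso; lra.
Qed.

(** A bump around x that is narrower than the distance to the other points. *)
Lemma test_separates (M : nat) (p : 'I_M -> R) (x : R) : Iopen x ->
  exists psi : R -> R, [/\ test_function psi, 0 < psi x & forall m, p m <> x -> psi (p m) = 0].
Proof.
rewrite IopenE => /andP[x1 x2].
have : \forall h \near (0 : R)^'+, -1 < x - h /\ (x + h < 1 /\ forall m, p m <> x -> h < `|p m -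
    x|).
  apply: filterS2 (_ : \forall h \near (0 : R)^'+, h < x + 1 /\ h < 1 - x) (_ : \forall h \near
      (0 : R)^'+, forall m, p m <> x -> h < `|p m - x|).
  - by move=> h [h1 h2] h3; split; [lra|split; [lra|]].
  - apply/near0P; exists (Num.min (x + 1) (1 - x)); first by rewrite lt_min; apply/andP; split; lra.
    by move=> h /andP[_]; rewrite lt_min => /andP[].
  - apply: filter_forall => m; have [->|pm] := eqVneq (p m) x.
      by apply/near0P; exists 1.
    apply/near0P; exists `|p m - x|; first by rewrite normr_gt0 subr_eq0.
    by move=> h /andP[].
move=> /near0P[X X0 hX]; have X2 : 0 < X / 2 < X by lra.
have [h1 [h2 h3]] := hX _ X2.
set h := X / 2 in h1 h2 h3; have h0 : 0 < h by rewrite divr_gt0.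
exists (bump (x - h) (x + h) 1); split.
- apply: (@smooth_test_function _ _ (x - h) (x + h)) => //; first exact: smooth_bump.
  by move=> y hy; apply: bump_out => // /andP[y1 y2]; apply: hy; rewrite !ltW.
- by apply: bump_gt0 => //; apply/andP; split; lra.
- move=> m /h3; rewrite ltNge => /negP hm; apply: bump_out => // /andP[m1 m2].
  by apply: hm; rewrite ltW// ltr_norml; apply/andP; split; lra.
Qed.

Lemma dirac_masses (f : R -> R) (L N : nat) (b s : 'I_L -> R) (a w : 'I_N -> R) :
  derivative_is_dirac_sum f b s -> derivative_is_dirac_sum f a w ->
  forall x, Iopen x -> \sum_(l < L | b l == x) s l = \sum_(n < N | a n == x) w n.
Proof.
move=> hb ha x Ix.
pose p (i : 'I_(L + N)) := match fintype.split i with inl l => b l | inr n => a n end.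
have [psi [tp psix p0]] := test_separates p Ix.
have pb l : psi (b l) = if b l == x then psi x else 0.
  case: eqP => [->//|bx]; have := p0 (lshift N l).
  by rewrite /p (unsplitK (inl l)) => ->.
have pa n : psi (a n) = if a n == x then psi x else 0.
  case: eqP => [->//|bx]; have := p0 (rshift L n).
  by rewrite /p (unsplitK (inr n)) => ->.
have /oppr_inj e : - (\sum_(l < L) s l * psi (b l)) = - (\sum_(n < N) w n * psi (a n)).
  by rewrite -hb// -ha.
apply: (mulIf (lt0r_neq0 psix)); rewrite !mulr_suml.
rewrite big_mkcond [RHS]big_mkcond /=.
transitivity (\sum_(l < L) s l * psi (b l)); last rewrite e.
  by apply: eq_bigr => l _; rewrite pb; case: ifP; rewrite ?mulr0.
by apply: eq_bigr => l _; rewrite pa; case: ifP; rewrite ?mulr0.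
Qed.

Lemma jump_size_bounds (alpha s : R) : 0 < alpha < pi -> jump_size alpha s -> 0 < `|s| < 2 * pi.
Proof. by move=> /andP[a0 a1] [] ->; apply/andP; split; lra. Qed.

(** Two jumps at one point have the same sign, so that a cluster of jumps adds
    up to at least 2 pi, more than a single jump. *)
Lemma jump_representation_inj (alpha : R) (f : R -> R) (N : nat) (a w : 'I_N -> R)
    (L : nat) (b s : 'I_L -> R) : 0 < alpha < pi ->
  simple_representation alpha f a w -> jump_representation alpha f b s -> injective b.
Proof.
move=> ha [oa js da] [db [bI bm jb bc]].
pose S x := \sum_(l < L | b l == x) s l.
have [al0 al1] := andP ha.
have small x : Iopen x -> `|S x| < 2 * pi.
  move=> Ix; rewrite /S (dirac_masses db da Ix).
  have [[n /eqP an]|no] := pselect (exists n, a n == x).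
    rewrite (bigD1 n) ?an//= big1 ?addr0; last first.
      move=> m /andP[/eqP am mn]; move: mn; rewrite (_ : m = n) ?eqxx//.
      by apply: (ordered_points_inj oa); rewrite am an.
    by have /andP[] := jump_size_bounds ha (js n).
  rewrite big_pred0 ?normr0 ?mulr_gt0 ?pi_gt0//.
  by move=> n; apply/negP => h; apply: no; exists n.
have same (i j : 'I_L) : j = i.+1 :> nat -> b i = b j -> `|s i + s j| = 2 * pi /\ 0 < s i * s j.
  move=> ij e; have h := bc i j ij e; split => //.
  have /andP[i0 i1] := jump_size_bounds ha (jb i); have /andP[j0 j1] := jump_size_bounds ha (jb j).
  rewrite ltNge; apply/negP => neg.
  move: h i0 i1 j0 j1 neg.
  case: (ger0P (s i)) => si; case: (ger0P (s j)) => sj; case: (ger0P (s i + s j)) => sij h i0 i1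
      j0 j1; try lra.
  - by rewrite leNgt mulr_gt0.
  - by rewrite leNgt nmulr_rgt0 ?sj.
move=> i0 j0 e0; apply/eqP; apply/negPn/negP => ne0.
pose x := b i0.
have [i bi imin] : exists2 i : 'I_L, b i = x & forall j : 'I_L, b j = x -> (i <= j)%N.
  have [i /eqP bi h] := @arg_minnP _ i0 (fun l => b l == x) (fun l : 'I_L => nat_of_ord l) (eqxx _).
  by exists i => // j /eqP; exact: h.
have [j bj ij] : exists2 j : 'I_L, b j = x & (i < j)%N.
  have [e|ne] := eqVneq i0 i.
    exists j0; first by rewrite -e0.
    rewrite ltn_neqAle (imin j0) ?andbT; last by rewrite -e0.
    by apply: contraNneq ne0 => ij; rewrite e; apply/eqP/val_inj.
  exists i0 => //; rewrite ltn_neqAle imin// andbT.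
  by apply: contraNneq ne => ij; apply/eqP/val_inj.
have iL : (i.+1 < L)%N := leq_ltn_trans ij (ltn_ord j).
pose i1 := Ordinal iL.
have bi1 : b i1 = x.
  by apply/eqP; rewrite eq_le -{1}bj bm//= -bi bm/=.
have sgn k (l : 'I_L) : (l = i + k :> nat)%N -> b l = x -> 0 < s i * s l.
  elim: k l => [|k IH] l lk bl.
    rewrite (_ : l = i) -?expr2; last by apply: val_inj; rewrite /= lk addn0.
    by rewrite exprn_even_gt0//= -normr_gt0; have /andP[] := jump_size_bounds ha (jb i).
  have kL : (i + k < L)%N by apply: leq_ltn_trans (ltn_ord l); rewrite lk leq_add2l.
  pose l' := Ordinal kL.
  have bl' : b l' = x by apply/eqP; rewrite eq_le -{1}bl bm ?lk ?leq_add2l//= -bi bm//= leq_addr.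
  have h1 := IH l' erefl bl'.
  have [|_ h2] := same l' l _ (etrans bl' (esym bl)); first by rewrite lk addnS.
  have h3 : 0 < (s i * s l') * (s l' * s l) by exact: mulr_gt0.
  have h4 : 0 < s l' ^+ 2.
    by rewrite exprn_even_gt0//= -normr_gt0; have /andP[] := jump_size_bounds ha (jb l').
  rewrite -(pmulr_rgt0 _ h4).
  by have -> : s l' ^+ 2 * (s i * s l) = s i * s l' * (s l' * s l) by ring.
have sgn' (l : 'I_L) : b l = x -> 0 < s i * s l.
  move=> bl; apply: (sgn (l - i)%N) => //; rewrite subnKC//; exact: imin.
have [e _] := same i i1 erefl (etrans bi (esym bi1)).
have Ix : Iopen x by rewrite /x; exact: bI.
have := small x Ix; rewrite ltNge => /negP; apply; rewrite -e.
have ni : i1 != i by rewrite -val_eqE /= gtn_eqF.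
rewrite /S (bigD1 i)/= ?bi// (bigD1 i1)/= ?bi1 ?eqxx// addrA.
set rest := \sum_(_ | _) _.
have r0 : 0 <= s i * rest.
  by rewrite mulr_sumr sumr_ge0// => l /andP[/andP[/eqP bl _] _]; rewrite ltW// sgn'.
have si1 := sgn' i1 bi1.
move: r0 si1; case: (ltgtP (s i) 0) => [si|si|->]; last by rewrite !mul0r ltxx.
  rewrite nmulr_rge0// nmulr_rgt0// => r0 s1.
  by rewrite !ler0_norm; lra.
rewrite pmulr_rge0// pmulr_rgt0// => r0 s1.
by rewrite !ger0_norm; lra.
Qed.

(** By dirac_masses the jumps are then matched one to one. *)
Lemma jump_sum_unique (alpha : R) (f : R -> R) (N : nat) (a w : 'I_N -> R)
    (L : nat) (b s : 'I_L -> R) (G : R -> R) : 0 < alpha < pi ->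
  simple_representation alpha f a w -> jump_representation alpha f b s ->
  \sum_(l < L) G (s l) = \sum_(n < N) G (w n).
Proof.
move=> ha rep rep'; have bi := jump_representation_inj ha rep rep'.
have [oa js da] := rep; have [db [bI bm jb bc]] := rep'.
have ai := ordered_points_inj oa; have [aI _] := oa.
have mass (x : R) : Iopen x -> \sum_(l < L | b l == x) s l = \sum_(n < N | a n == x) w n.
  exact: (dirac_masses db da).
have one (M : nat) (p : 'I_M -> R) (h : 'I_M -> R) m : injective p -> \sum_(l < M | p l == p m) h
    l = h m.
  move=> pI; rewrite (bigD1 m)//= big1 ?addr0// => l /andP[/eqP/pI ->].
  by rewrite eqxx.
have none (M : nat) (p : 'I_M -> R) (h : 'I_M -> R) x : ~ (exists m, p m = x) -> \sum_(l < M | p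
    l == x) h l = 0.
  by move=> no; rewrite big_pred0// => l; apply/negP => /eqP e; apply: no; exists l.
have n0 t : jump_size alpha t -> t <> 0.
  by move=> /(jump_size_bounds ha)/andP[+ _]; rewrite normr_gt0 => /eqP.
have ba l : exists n, a n = b l.
  apply: contrapT => no; have := mass (b l) (bI l).
  by rewrite one// none//; exact: n0.
have ab n : exists l, b l = a n.
  apply: contrapT => no; have := mass (a n) (aI n).
  by rewrite one// none// => /esym; exact: n0.
transitivity (\sum_(l < L) \sum_(n < N | a n == b l) G (s l)).
  apply: eq_bigr => l _; have [n <-] := ba l; by rewrite (one _ a (fun=> G (s l))).
rewrite (exchange_big_dep predT)//=; apply: eq_bigr => n _.
have [l e] := ab n.
rewrite -e (eq_bigl (fun j => b j == b l)); last by move=> j; rewrite eq_sym.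
rewrite (one _ b (fun j => G (s j)))//; congr G.
by have := mass (b l) (bI l); rewrite one// e one.
Qed.

(** The cosine of half the jump is cos alpha or - cos alpha, depending on d. *)
Lemma eta_jumps_simple (alpha c : R) (f : R -> R) (N : nat) (a w : 'I_N -> R)
    (d : 'I_N -> bool) : 0 < alpha < pi ->
  simple_representation alpha f a w -> jumps_at alpha c a w d ->
  eta_jumps alpha f = pi / 2 * \sum_(n < N) gamma alpha (d n) ^+ 2.
Proof.
move=> ha rep hj; have [oa js da] := rep; have [aI aord] := oa.
have rep' : jump_representation alpha f a w.
  split => //; split => //.
    by move=> i j; rewrite leq_eqVlt => /orP[/eqP/val_inj ->//|/aord/ltW].
  by move=> i j ij /(ordered_points_inj oa) e; move: ij; rewrite e => /n_Sn.
have val (L : nat) (b s : 'I_L -> R) : jump_representation alpha f b s ->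
    pi / 2 * \sum_(l < L) (1 - cos (s l / 2)) ^+ 2 = pi / 2 * \sum_(n < N) gamma alpha (d n) ^+ 2.
  move=> h; congr (_ * _).
  rewrite (jump_sum_unique (fun t => (1 - cos (t / 2)) ^+ 2) ha rep h).
  apply: eq_bigr => n _; have [_ _ wn] := hj n.
  have -> : cos (w n / 2) = cos (`|w n| / 2) by case: (ger0P (w n)) => // _; rewrite mulNr cosN.
  rewrite wn mulrAC divff// mul1r /gamma /pm; case: (d n) => //.
  by rewrite cosB cospi sinpi mul0r addr0; ring.
rewrite /eta_jumps; case: xgetP => [v -> [L [b [s [/val <- ->]]]]//|/(_ (pi / 2 * \sum_(n < N) (1
    - cos (w n / 2)) ^+ 2)) no].
by exfalso; apply: no; exists N, a, w.
Qed.

End Profile.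

(** * Competitors and the energy *)

Section EnergyComparison.
Context {R : realType}.
Local Notation mu := (@lebesgue_measure R).
Local Notation T := (measurableTypeR R).
Local Notation N2 := (mu \x mu)%E.
Variable alpha : R.

Lemma inf_energy_le eps (N : nat) (a : 'I_N -> R) (d : 'I_N -> bool) (f : R -> R) :
  H1 f -> cos (f (-1)) = cos alpha -> cos (f 1) = cos alpha ->
  (forall n, cos (f (a n)) = pm (d n)) ->
  (inf_energy alpha eps a d <= energy_lift alpha eps f)%E.
Proof.
move=> hf f0 f1 fa; apply: ereal_inf_lbound.
by exists (cos \o f, sin \o f) => //; split => //=; exact: H1_cos_sin.
Qed.

Lemma excess_meas (m : R -> R) : cont11 m -> @measurable_fun _ _ T R setT (excess alpha m).
Proof.
move=> cm; have mI := @measurable_Iopen R.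
have -> : excess alpha m = ((fun x => m x - cos alpha) : T -> R) \_ Iopen.
  apply/funext => x; rewrite /excess patchE.
  by rewrite (_ : (x \in Iopen) = (-1 < x < 1)) // /Iopen mem_setE in_itv.
apply/(measurable_restrictT _ mI).
by apply: measurable_funB; [exact: cont11_meas|exact: measurable_cst].
Qed.

(** Replacing a lifting by acos of its cosine, with values in [0, pi], changes
    neither the first component nor the bounds on the energy. *)
Lemma circle_fold (m1 m2 : R -> R) : H1_circle m1 m2 ->
  exists g, [/\ prim (acos \o m1) g, L2 g, forall x, Iclosed x -> 0 <= acos (m1 x) <= pi /\ cos
      (acos (m1 x)) = m1 x &
    forall eps, 0 <= eps -> ((eps / 2)%:E * sqint g + half_seminorm alpha m1 <= energy alpha eps
        m1 m2)%E].
Proof.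
move=> [/H1P[g1 p1 l1] /H1P[g2 p2 l2] circ].
have [pa ae] := prim_acos p1 p2 circ.
have m11 x : Iclosed x -> -1 <= m1 x <= 1.
  move=> /circ e; rewrite -ler_norml -(@ler_pXn2r _ 2) ?nnegrE// expr1n real_normK ?num_real//.
  by rewrite -e lerDl sqr_ge0.
have mg := intI_measurable pa.1.
have [mg1 _] := (L2E _).1 l1; have [mg2 _] := (L2E _).1 l2.
have sq : (sqint (fun x : R => (- g1 x / `|m2 x|)%R) <= sqint g1 + sqint g2)%E.
  rewrite sqintD//; apply: ae_ge0_le_integral => //.
  - exact: (@measurable_Iopen R).
  - by move=> x _; rewrite lee_fin sqr_ge0.
  - by apply/measurable_EFinP; exact: measurable_funX.
  - by move=> x _; rewrite lee_fin addr_ge0 ?sqr_ge0.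
  - by apply/measurable_EFinP; apply: measurable_funD; exact: measurable_funX.
exists (fun x => - g1 x / `|m2 x|); split => //.
- apply/L2E; split => //; apply: le_lt_trans sq _.
  by rewrite lte_add_pinfty//; [have [_] := (L2E _).1 l1|have [_] := (L2E _).1 l2].
- move=> x Ix; have h := m11 x Ix; split; last by rewrite acosK.
  by rewrite acos_ge0 ?acos_lepi.
- move=> eps e0; rewrite (energyE _ _ p1 l1 p2 l2) leeD2r//.
  by apply: lee_wpmul2l => //; rewrite lee_fin divr_ge0.
Qed.

Lemma excess_out (m : R -> R) x : ~ Iopen x -> excess alpha m x = 0.
Proof. by rewrite IopenE => /negP/negbTE h; rewrite /excess h. Qed.

Lemma excess_in (m : R -> R) x : Iopen x -> excess alpha m x = m x - cos alpha.
Proof. by rewrite IopenE => h; rewrite /excess h. Qed.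

Lemma cos_dist_le2 (u v : R) : `|cos u - cos v| <= 2.
Proof.
have h (t : R) : `|cos t| <= 1 by rewrite ler_norml cos_geN1 cos_le1.
by apply: le_trans (ler_normB _ _) _; rewrite -[2]/(1 + 1); exact: lerD.
Qed.

Lemma excess_cos_bounded (f : R -> R) x : `|excess alpha (cos \o f) x| <= 2.
Proof. by rewrite /excess; case: ifP => _; rewrite ?normr0//; exact: cos_dist_le2. Qed.

(** The deformed lifting is a competitor for the original nodes. *)
Lemma deformation_energy (p : R -> R) (q r s : R -> R -> R) (f g : R -> R) (eps M c : R)
    (N : nat) (a : 'I_N -> R) (d : 'I_N -> bool) :
  tame p q r s -> p (-1) = 0 -> p 1 = 0 -> bounded2 q (2^-1) ->
  (forall x, Iopen x -> 1 + q x x <= M) -> 0 <= eps ->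
  prim f g -> L2 g -> cos (f (-1)) = cos alpha -> cos (f 1) = cos alpha ->
  (forall n, cos (f (a n + p (a n))) = pm (d n)) ->
  (forall u v, Iopen u -> Iopen v ->
     (cos (f (u + p u)) - cos alpha) * (cos (f (v + p v)) - cos alpha) * kernel_defect q r s u v <=
     c * (`|cos (f (u + p u)) - cos alpha| * `|cos (f (v + p v)) - cos alpha|)) ->
  (inf_energy alpha eps a d <=
   (eps / 2 * M)%:E * sqint g + half_seminorm alpha (cos \o f) +
   (c / (2 * pi) * (\int[mu]_(u in Iopen) `|cos (f (u + p u)) - cos alpha|) ^+ 2)%:E)%E.
Proof.
move=> t p0 p1 bq wM e0 fg lg f0 f1 fa hk.
have dp := tame_diffeo t p0 p1 bq; have cf := prim_cont fg.
have mg := intI_measurable fg.1.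
have fg' := prim_comp dp fg.
have M0 : 0 <= M.
  have I0 : Iopen (0 : R) by rewrite IopenE; lra.
  have := wM 0 I0; have := bounded2_1Dq bq (Iopen_closed I0) (Iopen_closed I0); lra.
have sq : (sqint (fun x : R => (g (x + p x) * (1 + q x x))%R) <= M%:E * sqint g)%E.
  exact: (@sqint_comp _ _ _ g M dp mg wM).
have lg' : L2 (fun x => g (x + p x) * (1 + q x x)).
  apply/L2E; split; first exact: intI_measurable fg'.1.
  have [_ gfin] := (L2E _).1 lg; apply: le_lt_trans sq _.
  by apply: lte_mul_pinfty; rewrite ?lee_fin.
have hf' : H1 (f \o (fun u => u + p u)) by apply/H1P; eexists; [exact: fg'|].
apply: (@le_trans _ _ (energy_lift alpha eps (f \o (fun u => u + p u)))).
  by apply: inf_energy_le => //=; rewrite ?p0 ?p1 addr0.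
rewrite (energy_liftE _ _ fg' lg') -addeA; apply: leeD.
  rewrite (EFinM (eps / 2) M) -muleA; apply: lee_wpmul2l; first by rewrite lee_fin divr_ge0.
  exact: sq.
have ccf : cont11 (cos \o f) by apply: cont11_comp => // x _; exact: continuous_cos.
have gf u : Iopen u -> excess alpha (cos \o (f \o (fun u => u + p u))) u = excess alpha (cos \o
    f) (u + p u).
  move=> Iu; rewrite !excess_in//; by apply/(diffeo_Iopen dp (Iopen_closed Iu)).
have := @seminorm_deformation _ p q r s t p0 p1 bq (excess alpha (cos \o f))
  (excess alpha (cos \o (f \o (fun u => u + p u)))) 2 (excess_meas ccf)
  (excess_cos_bounded f) (@excess_out _) (@excess_out _) gf c.
move=> h; have {h} h := h _.
rewrite /half_seminorm.
apply: (@le_trans _ _ ((2^-1)%:E * (sqr_seminorm_Hhalf (excess alpha (cos \o f)) + (c / pi *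
    (\int[mu]_(u in Iopen) `|cos (f (u + p u)) - cos alpha|) ^+ 2)%:E)))%E.
  apply: lee_wpmul2l => //.
  rewrite (_ : (\int[mu]_(u in Iopen) `|cos (f (u + p u)) - cos alpha|) = (\int[mu]_(u in Iopen)
      `|excess alpha (cos \o (f \o (fun u => u + p u))) u|)); last first.
    by apply: eq_Rintegral => u; rewrite inE => Iu; rewrite excess_in.
  apply: h => u v Iu Iv; rewrite !excess_in//; exact: hk.
rewrite muleDr//; last by rewrite fin_num_adde_defl.
rewrite leeD2l// -EFinM lee_fin.
move: (Rintegral _ _ _) => J; rewrite le_eqVlt; apply/orP; left; apply/eqP.
by rewrite invfM; ring.
Qed.

Lemma sqr_seminormE (f : T -> R) : measurable_fun setT f ->
  sqr_seminorm_Hhalf f = (((2 * pi)^-1)%:E * \int[N2]_z increment f z)%E.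
Proof.
by move=> mf; rewrite (fubini_tonelli1 _ (measurable_increment mf) (increment_ge0 f)).
Qed.

Lemma cos_min (u : R) : 0 <= alpha <= pi -> 0 <= u <= pi ->
  cos (Num.min u alpha) = Num.max (cos u) (cos alpha).
Proof.
move=> ha hu; case: (leP u alpha) => h; [rewrite max_l|rewrite max_r] => //.
  by rewrite leNgt; apply/negP; rewrite ltr_cos ?in_itv//= ltNge h.
by rewrite leNgt; apply/negP; rewrite ltr_cos ?in_itv//= ltNge ltW.
Qed.

Lemma cos_max (u : R) : 0 <= alpha <= pi -> 0 <= u <= pi ->
  cos (Num.max u alpha) = Num.min (cos u) (cos alpha).
Proof.
move=> ha hu; case: (leP u alpha) => h; [rewrite min_r|rewrite min_l] => //.
  by rewrite leNgt; apply/negP; rewrite ltr_cos ?in_itv//= ltNge h.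
by rewrite leNgt; apply/negP; rewrite ltr_cos ?in_itv//= ltNge ltW.
Qed.

(** Positive and negative parts do not interact attractively. *)
Lemma half_seminorm_split (f : R -> R) : cont11 f -> 0 <= alpha <= pi ->
  (forall x, Iclosed x -> 0 <= f x <= pi) ->
  (half_seminorm alpha (cos \o (fun x => Num.min (f x) alpha)) +
   half_seminorm alpha (cos \o (fun x => Num.max (f x) alpha)) <=
   half_seminorm alpha (cos \o f))%E.
Proof.
move=> cf ha hf; have mI := @measurable_Iopen R.
set f1 := cos \o _; set f2 := cos \o _.
have E1 x : excess alpha f1 x = Num.max (excess alpha (cos \o f) x) 0.
  rewrite /excess; case: ifP => [/andP[x1 x2]|_]; last by rewrite maxxx.
  rewrite /f1/= cos_min//; last by apply: hf; rewrite IclosedE !ltW.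
  by case: leP => h; case: leP => h'; lra.
have E2 x : excess alpha f2 x = Num.min (excess alpha (cos \o f) x) 0.
  rewrite /excess; case: ifP => [/andP[x1 x2]|_]; last by rewrite minxx.
  rewrite /f2/= cos_max//; last by apply: hf; rewrite IclosedE !ltW.
  by case: leP => h; case: leP => h'; lra.
have mE : @measurable_fun _ _ T R setT (excess alpha (cos \o f)).
  by apply: excess_meas; apply: cont11_comp => // x _; exact: continuous_cos.
have m1 : @measurable_fun _ _ T R setT (excess alpha f1).
  rewrite (_ : excess alpha f1 = fun x => Num.max (excess alpha (cos \o f) x) 0); last by
      apply/funext.
  by apply: measurable_maxr => //; exact: measurable_cst.
have m2 : @measurable_fun _ _ T R setT (excess alpha f2).
  rewrite (_ : excess alpha f2 = fun x => Num.min (excess alpha (cos \o f) x) 0); last by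
      apply/funext.
  by apply: measurable_minr => //; exact: measurable_cst.
rewrite /half_seminorm (sqr_seminormE mE) (sqr_seminormE m1) (sqr_seminormE m2).
have mF := measurable_increment mE; have mF1 := measurable_increment m1; have mF2 :=
    measurable_increment m2.
have pp : 0 <= (2 * pi)^-1 :> R by rewrite invr_ge0 mulr_ge0 ?pi_ge0.
have ge0 (h : T -> R) : (0 <= \int[N2]_z increment h z)%E.
  by apply: integral_ge0 => z _; exact: increment_ge0.
rewrite -ge0_muleDr ?mule_ge0// -ge0_muleDr//.
apply: lee_wpmul2l => //; apply: lee_wpmul2l => //.
rewrite -ge0_integralD//; try by move=> z _; exact: increment_ge0.
apply: ge0_le_integral => //.
- by move=> z _; rewrite adde_ge0// increment_ge0.
- exact: emeasurable_funD.
- move=> z _; rewrite /increment -EFinD lee_fin -mulrDl; apply: ler_wpM2r; first by rewrite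
    invr_ge0 sqr_ge0.
  rewrite !E1 !E2; move: (excess _ _ _) (excess _ _ _) => x y.
  rewrite /Num.max /Num.min; case: (ltP x 0) => hx; case: (ltP y 0) => hy;
    rewrite ?subr0 ?sub0r ?subrr ?expr0n/= ?add0r ?addr0 ?sqrrN// !expr2.
  - have : 0 <= - x * y by rewrite mulr_ge0// oppr_ge0 ltW.
    by lra.
  - have : 0 <= x * - y by rewrite mulr_ge0// oppr_ge0 ltW.
    by lra.
Qed.

End EnergyComparison.

(** * Interpolating deformations *)

Section Interpolation.
Context {R : realType}.
Local Notation mu := (@lebesgue_measure R).

Lemma tame_eq p q r s p' q' r' s' : tame p q r s -> (forall u : R, p u = p' u) ->
  (forall u v : R, q u v = q' u v) -> (forall u v : R, r u v = r' u v) ->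
  (forall u v : R, s u v = s' u v) -> tame p' q' r' s'.
Proof.
move=> t /funext <- hq hr hs.
have <- : q = q' by apply/funext => u; apply/funext => v; exact: hq.
have <- : r = r' by apply/funext => u; apply/funext => v; exact: hr.
by have <- : s = s' by apply/funext => u; apply/funext => v; exact: hs.
Qed.

(** Given explicitly, because the sign of the last term - k is what matters. *)
Lemma tame_cubic (k : R) : tame (fun u => k * (u - u ^+ 3))
  (fun u v => k * (1 - u ^+ 2 - u * v - v ^+ 2)) (fun u v => - k * (2 * u + v)) (fun _ _ => - k).
Proof.
have := tame_lin (- k) 0 (tame_mulX (-1) (tame_mulX 1 (tame_mulX 0 (tame_cst 1)))) (tame_cst (0 :
    R)).
move=> t; apply: (tame_eq t) => u; [|move=> v..]; rewrite /cst/=; ring.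
Qed.

Lemma tame_sum (I : Type) (l : seq I) (h : I -> R) (p_ : I -> R -> R) (q_ r_ s_ : I -> R -> R ->
    R) :
  (forall i, tame (p_ i) (q_ i) (r_ i) (s_ i)) ->
  tame (fun u => \sum_(i <- l) h i * p_ i u) (fun u v => \sum_(i <- l) h i * q_ i u v)
    (fun u v => \sum_(i <- l) h i * r_ i u v) (fun u v => \sum_(i <- l) h i * s_ i u v).
Proof.
move=> t; elim: l => [|i l IH].
  by apply: tame_eq (tame_cst 0) _ _ _ _ => u; [|move=> v..]; rewrite big_nil.
by apply: tame_eq (tame_lin (h i) 1 (t i) IH) _ _ _ _ => u; [|move=> v..]; rewrite big_cons mul1r.
Qed.

Lemma tame_vanishing (l : seq R) : exists p q r s, tame p q r s /\ forall x, (p x == 0) = (x \in l).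
Proof.
elim: l => [|c l [p [q [r [s [t hp]]]]]].
  by do 4!eexists; split; [exact: (tame_cst 1)|move=> x; rewrite /= oner_eq0].
do 4!eexists; split; first exact: (tame_mulX c t).
by move=> x; rewrite mulf_eq0 subr_eq0 hp in_cons.
Qed.

(** Lagrange interpolation at the nodes, together with the end points. *)
Lemma tame_hats (N : nat) (a : 'I_N -> R) : ordered_points a ->
  exists (p_ : 'I_N -> R -> R) (q_ r_ s_ : 'I_N -> R -> R -> R) (B : R),
  [/\ forall n, tame (p_ n) (q_ n) (r_ n) (s_ n), forall n, p_ n (-1) = 0 /\ p_ n 1 = 0,
      forall n m, p_ n (a m) = (n == m)%:R &
      forall n, [/\ bounded2 (q_ n) B, bounded2 (r_ n) B & bounded2 (s_ n) B]].
Proof.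
move=> oa; have [aI _] := oa; have ai := ordered_points_inj oa.
have one n : exists z : (R -> R) * ((R -> R -> R) * ((R -> R -> R) * (R -> R -> R))),
    [/\ tame z.1 z.2.1 z.2.2.1 z.2.2.2, z.1 (-1) = 0 /\ z.1 1 = 0 &
     forall m, z.1 (a m) = (n == m)%:R].
  have [p [q [r [s [t hp]]]]] := tame_vanishing ([:: -1; 1] ++ [seq a m | m <- enum 'I_N & m != n]).
  have pan : p (a n) != 0.
    have /andP[a1 a2] := aI n.
    rewrite hp !inE gt_eqF//= lt_eqF//=; apply/negP => /mapP[m].
    by rewrite mem_filter => /andP[mn _] /ai e; move: mn; rewrite e eqxx.
  exists (fun u => (p (a n))^-1 * p u + 0 * 0, ((fun u v => (p (a n))^-1 * q u v + 0 * 0),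
    ((fun u v => (p (a n))^-1 * r u v + 0 * 0), (fun u v => (p (a n))^-1 * s u v + 0 * 0))));
        split => /=.
  - exact: (tame_lin (p (a n))^-1 0 t (tame_cst 0)).
  - have z x : p x == 0 -> (p (a n))^-1 * p x + 0 * 0 = 0 by move=> /eqP ->; rewrite !mulr0 addr0.
    by split; apply: z; rewrite hp !inE eqxx ?orbT.
  - move=> m; rewrite mul0r addr0; have [<-|nm] := eqVneq n m; first by rewrite mulVf.
    have /eqP -> : p (a m) == 0; last by rewrite mulr0.
    rewrite hp mem_cat; apply/orP; right; apply/mapP; exists m => //.
    by rewrite mem_filter eq_sym nm mem_enum.
have [z hz] := choice one.
have bd n : exists B, [/\ bounded2 (z n).2.1 B, bounded2 (z n).2.2.1 B & bounded2 (z n).2.2.2 B].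
  by have [t _ _] := hz n; exact: tame_bound t.
have [B hB] := choice bd.
exists (fun n => (z n).1), (fun n => (z n).2.1), (fun n => (z n).2.2.1), (fun n => (z n).2.2.2),
    (\sum_n `|B n|).
have le n : B n <= \sum_n `|B n|.
  by apply: le_trans (ler_norm _) _; rewrite (bigD1 n)//= lerDl sumr_ge0.
split => n; have [t z0 za] := hz n => //.
by have [b1 b2 b3] := hB n; split; apply: (bounded2W (le n)).
Qed.

Lemma bounded2_sum (N : nat) (h : 'I_N -> R) (q_ : 'I_N -> R -> R -> R) (B k : R) : 0 <= k ->
  (forall n, bounded2 (q_ n) B) -> (forall n, `|h n| <= k) ->
  bounded2 (fun u v => \sum_(n < N) h n * q_ n u v) (N%:R * (k * B)).
Proof.
move=> k0 hq hh u v Iu Iv; apply: le_trans (ler_norm_sum _ _ _) _.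
rewrite -[in leRHS](card_ord N) mulr_natl -sumr_const; apply: ler_sum => n _.
by rewrite normrM; apply: ler_pM => //; exact: hq.
Qed.

(** Small displacements of the nodes need small deformations only. *)
Lemma small_hats (N : nat) (q_ r_ s_ : 'I_N -> R -> R -> R) (B eta : R) : 0 < eta ->
  (forall n, [/\ bounded2 (q_ n) B, bounded2 (r_ n) B & bounded2 (s_ n) B]) ->
  exists2 k, 0 < k & forall h : 'I_N -> R, (forall n, `|h n| <= k) ->
   [/\ bounded2 (fun u v => \sum_(n < N) h n * q_ n u v) eta,
       bounded2 (fun u v => \sum_(n < N) h n * r_ n u v) eta &
       bounded2 (fun u v => \sum_(n < N) h n * s_ n u v) eta].
Proof.
move=> eta0 hb; pose K := N%:R * `|B| + 1; have K0 : 0 < K by rewrite ltr_wpDl// mulr_ge0.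
exists (eta / K); first by rewrite divr_gt0.
move=> h hh; have k0 : 0 <= eta / K by rewrite ltW// divr_gt0.
have hb' n : [/\ bounded2 (q_ n) `|B|, bounded2 (r_ n) `|B| & bounded2 (s_ n) `|B|].
  by have [h1 h2 h3] := hb n; split; apply: bounded2W (ler_norm B) _.
have le : N%:R * (eta / K * `|B|) <= eta.
  rewrite (_ : _ * _ = eta * (N%:R * `|B| / K)); last by ring.
  by rewrite -[leRHS]mulr1; apply: ler_wpM2l; [exact: ltW|rewrite ler_pdivrMr// mul1r lerDl].
by split; apply: bounded2W le _; apply: bounded2_sum => // n; have [] := hb' n.
Qed.

Lemma kernel_defect_small q r s (eta : R) u v : 0 <= eta <= 2^-1 ->
  bounded2 q eta -> bounded2 r eta -> bounded2 s eta -> Iclosed u -> Iclosed v ->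
  `|kernel_defect q r s u v| <= 8 * eta.
Proof.
move=> /andP[e0 e1] bq br bs Iu Iv.
have h1 := bq u v Iu Iv; have h2 := br u v Iu Iv; have h3 := br v u Iv Iu; have h4 := bs u v Iu Iv.
have h5 : 2^-1 <= 1 + q u v.
  by move: h1; rewrite ler_norml => /andP[h _]; lra.
have h6 : `|1 + q u v| <= 3 / 2.
  by move: h1; rewrite ler_norml => /andP[h h']; rewrite ger0_norm; lra.
rewrite /kernel_defect normrM normfV (ger0_norm (sqr_ge0 _)).
have h7 : 4^-1 <= (1 + q u v) ^+ 2.
  rewrite expr2; apply: le_trans (_ : 2^-1 * 2^-1 <= _); last by apply: ler_pM => //; lra.
  by rewrite -invfM -natrM.
have h8 : 0 < (1 + q u v) ^+ 2 by apply: lt_le_trans h7; rewrite invr_gt0.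
rewrite ler_pdivrMr//; apply: le_trans (ler_normB _ _) _; rewrite !normrM.
have m1 : `|1 + q u v| * `|s u v| <= 3 / 2 * eta by apply: ler_pM.
have m2 : `|r u v| * `|r v u| <= eta * 2^-1 by apply: ler_pM => //; exact: le_trans h3 e1.
have m3 : 8 * eta * 4^-1 <= 8 * eta * (1 + q u v) ^+ 2 by apply: ler_wpM2l => //; rewrite mulr_ge0.
by apply: le_trans m3; lra.
Qed.

(** For the cubic, S is of order - k and dominates the product r1 * r2, which is
    of order k^2. *)
Lemma kernel_defect_negative (k Q S r1 r2 : R) : 0 < k -> 128 * k <= 1 ->
  `|Q| <= 2^-1 -> S <= - (k / 2) -> `|r1| <= 4 * k -> `|r2| <= 4 * k ->
  ((1 + Q) * S - r1 * r2) / (1 + Q) ^+ 2 <= - (k / 32).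
Proof.
move=> k0 k1; rewrite ler_norml => /andP[q1 q2] S1 h1 h2.
have p1 : 0 < (1 + Q) ^+ 2 by rewrite exprn_gt0//; lra.
rewrite ler_pdivrMr//.
have : `|r1 * r2| <= (4 * k) * (4 * k) by rewrite normrM; apply: ler_pM.
rewrite ler_norml => /andP[+ _]; move: (r1 * r2) => rr r12.
have m1 : 2^-1 * (k / 2) <= (1 + Q) * - S by apply: ler_pM; lra.
have m2 : k / 32 * (1 + Q) ^+ 2 <= k / 32 * 4.
  apply: ler_wpM2l; first by rewrite divr_ge0// ltW.
  by rewrite expr2 (_ : 4 = 2 * 2) ?ler_pM//; lra.
have m3 : k * (128 * k) <= k * 1 by apply: ler_wpM2l => //; exact: ltW.
rewrite mulrN in m1; rewrite mulNr.
move: m1 m2; move: ((1 + Q) * S) (k / 32 * _) => X Y m1 m2.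
rewrite lerNr; apply: le_trans m2 _.
by lra.
Qed.

End Interpolation.

(** * Moving the nodes *)

Section MovingNodes.
Context {R : realType}.
Local Notation mu := (@lebesgue_measure R).
Variable alpha : R.

Lemma integral_comp_le psi w (F : R -> R) : diffeo psi w -> cont11 F ->
  (forall x, Iopen x -> 2^-1 <= w x <= 2) ->
  [/\ 0 <= \int[mu]_(x in Iopen) `|F x|, 0 <= \int[mu]_(x in Iopen) `|F (psi x)|,
  \int[mu]_(x in Iopen) `|F (psi x)| <= 2 * \int[mu]_(x in Iopen) `|F x| &
  \int[mu]_(x in Iopen) `|F x| <= 2 * \int[mu]_(x in Iopen) `|F (psi x)| ].
Proof.
move=> dp cF hw; have mI := @measurable_Iopen R.
have iF : intI (fun x => `|F x|).
  apply: integrable_norm; exact: L2_intI (cont11_L2 cF).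
have [M hM] := cont11_bounded cF.
have mFp := diffeo_comp_meas dp (cont11_meas cF).
have Ipsi x : Iopen x -> Iopen (psi x) by move=> Ix; apply/(diffeo_Iopen dp (Iopen_closed Ix)).
have iFp : intI (fun x => `|F (psi x)|).
  apply: integrable_norm; apply: L2_intI; apply: (@L2_bounded _ _ M mFp) => x Ix.
  by apply: hM; apply: Iopen_closed; exact: Ipsi.
have [iFw e] := change_of_variables_R dp iF.
split.
- by apply: Rintegral_ge0.
- by apply: Rintegral_ge0.
- rewrite -e -RintegralZl//; apply: le_Rintegral => //; first exact: intIZ.
  move=> x Ix; have /andP[h _] := hw x Ix.
  have := ler_wpM2l (normr_ge0 (F (psi x))) h; lra.
- rewrite -e -RintegralZl//; apply: le_Rintegral => //; first exact: intIZ.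
  move=> x Ix; have /andP[_ h] := hw x Ix.
  have := ler_wpM2l (normr_ge0 (F (psi x))) h; lra.
Qed.

Lemma cont11_excess (f : R -> R) : cont11 f -> cont11 (fun x => cos (f x) - cos alpha).
Proof.
move=> cf; apply: (@cont11_comp _ f (fun u => cos u - cos alpha) cf) => x _.
by apply: cvgB; [exact: continuous_cos|exact: cvg_cst].
Qed.

(** Interpolating the displacements of the nodes gives a deformation with small
    kernel defect of either sign. *)
Lemma moved_nodes_energy (N : nat) (a : 'I_N -> R) (d : 'I_N -> bool) (eta : R) :
  ordered_points a -> 0 < eta <= 2^-1 ->
  exists2 k, 0 < k & forall b : 'I_N -> R, (forall n, `|b n - a n| <= k) ->
  forall (f g : R -> R) (eps : R), 0 <= eps -> prim f g -> L2 g ->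
  cos (f (-1)) = cos alpha -> cos (f 1) = cos alpha -> (forall n, cos (f (b n)) = pm (d n)) ->
  (inf_energy alpha eps a d <=
   (eps / 2 * (1 + eta))%:E * sqint g + half_seminorm alpha (cos \o f) +
   (8 * eta * (\int[mu]_(u in Iopen) `|cos (f u) - cos alpha|) ^+ 2)%:E)%E.
Proof.
move=> oa /andP[e0 e1].
have [p_ [q_ [r_ [s_ [B [t p0 pa hB]]]]]] := tame_hats oa.
have [k k0 hk] := small_hats e0 hB.
exists k => // b hb f g eps eps0 fg lg f0 f1 fb.
have [bq br bs] := hk (fun n => b n - a n) hb.
have tS := tame_sum (index_enum 'I_N) (fun n => b n - a n) t.
set p := (fun u => _) in tS; set q := (fun u v => _) in tS; set r := (fun u v => _) in tS; set s
    := (fun u v => _) in tS.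
have pm1 : p (-1) = 0 by rewrite /p big1// => n _; have [-> _] := p0 n; rewrite mulr0.
have p1 : p 1 = 0 by rewrite /p big1// => n _; have [_ ->] := p0 n; rewrite mulr0.
have bq2 : bounded2 q 2^-1 by exact: bounded2W e1 bq.
have dp := tame_diffeo tS pm1 p1 bq2.
have wb x : Iopen x -> 1 + q x x <= 1 + eta.
  move=> /Iopen_closed Ix; rewrite lerD2l; apply: le_trans (ler_norm _) _; exact: bq.
have pan n : a n + p (a n) = b n.
  rewrite /p (bigD1 n)//= big1 => [|m mn]; last by rewrite pa (negbTE mn) mulr0.
  by rewrite pa eqxx mulr1 addr0; ring.
have := @deformation_energy _ alpha p q r s f g eps (1 + eta) (8 * eta) N a d tS pm1 p1 bq2 wb
    eps0 fg lg f0 f1.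
move=> h; have {h} h := h _ _.
have e01 : 0 <= eta <= 2^-1 by rewrite ltW.
apply: le_trans (h _ _) _.
- by move=> n; rewrite pan.
- move=> u v /Iopen_closed Iu /Iopen_closed Iv; apply: le_trans (ler_norm _) _.
  rewrite normrM (normrM (cos _ - _)) mulrC; apply: ler_wpM2r; first by rewrite mulr_ge0.
  exact: kernel_defect_small.
apply: leeD2l; rewrite lee_fin.
have hw x : Iopen x -> 2^-1 <= 1 + q x x <= 2.
  move=> Ix; rewrite (bounded2_1Dq bq2 (Iopen_closed Ix) (Iopen_closed Ix))/=.
  by apply: le_trans (wb x Ix) _; lra.
have [J0 J0' J1 _] := integral_comp_le dp (cont11_excess (prim_cont fg)) hw.
move: J0 J0' J1; move: (Rintegral _ _ _) (Rintegral _ _ _) => J' J J0 J0' J1.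
have pi2 := pi_ge2 R.
rewrite mulrAC; apply: (@le_trans _ _ (8 * eta * (2 * J) ^+ 2 / (2 * 2))); last first.
  rewrite le_eqVlt; apply/orP; left; apply/eqP; by field.
apply: ler_pM.
- by rewrite mulr_ge0 ?sqr_ge0// mulr_ge0// ltW.
- by rewrite invr_ge0 mulr_ge0//; lra.
- by apply: ler_wpM2l; [rewrite mulr_ge0// ltW|rewrite lerXn2r ?nnegrE ?mulr_ge0].
- by rewrite lef_pV2 ?posrE ?mulr_gt0//; [lra|lra].
Qed.

(** For u - u^3 the kernel defect is negative, which makes this deformation pay
    for the square of the integral of a one-signed excess. *)
Lemma contracted_nodes_energy (N : nat) (a : 'I_N -> R) : ordered_points a ->
  exists (a' : 'I_N -> R) (k K : R), [/\ ordered_points a', 0 < k, 0 < K &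
  forall b : 'I_N -> R, (forall n, `|b n - a n| <= k) ->
  forall (M : nat) (io : 'I_M -> 'I_N) (d : 'I_M -> bool) (f g : R -> R) (eps : R),
  0 <= eps -> prim f g -> L2 g ->
  cos (f (-1)) = cos alpha -> cos (f 1) = cos alpha -> (forall m, cos (f (b (io m))) = pm (d m)) ->
  (forall x y, Iopen x -> Iopen y -> 0 <= (cos (f x) - cos alpha) * (cos (f y) - cos alpha)) ->
  (inf_energy alpha eps (a' \o io) d <=
   eps%:E * sqint g + half_seminorm alpha (cos \o f) -
   ((\int[mu]_(u in Iopen) `|cos (f u) - cos alpha|) ^+ 2 / K)%:E)%E].
Proof.
(* Small enough for kernel_defect_negative. *)
move=> oa; pose k : R := 128^-1.
have k0 : 0 < k by rewrite invr_gt0.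
have k1 : 128 * k <= 1 by rewrite mulfV.
(* The fixed deformation u + k (u - u^3) determines the nodes a' = psi^-1(a); the
   hats at a' then move their images from a to b. *)
have t0 := tame_cubic k.
have cube (u v : R) : Iclosed u -> Iclosed v -> `|1 - u ^+ 2 - u * v - v ^+ 2| <= 2 /\ `|2 * u +
    v| <= 3.
  rewrite !IclosedE => /andP[u1 u2] /andP[v1 v2]; rewrite !ler_norml !expr2.
  have h1 : 0 <= (1 - u) * (1 + u) by apply: mulr_ge0; lra.
  have h2 : 0 <= (1 - v) * (1 + v) by apply: mulr_ge0; lra.
  have h3 : 0 <= (u + v) * (u + v) by rewrite -expr2 sqr_ge0.
  have h4 : 0 <= (u - v) * (u - v) by rewrite -expr2 sqr_ge0.
  by split; apply/andP; split; lra.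
have bq0 : bounded2 (fun u v => k * (1 - u ^+ 2 - u * v - v ^+ 2)) (2 * k).
  move=> u v Iu Iv; have [h _] := cube u v Iu Iv.
  by rewrite normrM (gtr0_norm k0) mulrC; apply: ler_wpM2r h; exact: ltW.
have br0 : bounded2 (fun u v => - k * (2 * u + v)) (3 * k).
  move=> u v Iu Iv; have [_ h] := cube u v Iu Iv.
  by rewrite normrM normrN (gtr0_norm k0) mulrC; apply: ler_wpM2r h; exact: ltW.
have z0 : k * (-1 - (-1) ^+ 3) = 0 by ring.
have z1 : k * (1 - 1 ^+ 3) = 0 by ring.
have k2 : 2 * k <= 2^-1 by lra.
have dp0 := tame_diffeo t0 z0 z1 (bounded2W k2 bq0).
have [aI aord] := oa.
have ex n : exists x, Iopen x /\ x + k * (x - x ^+ 3) = a n.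
  have Ia : Iopen (a n) by rewrite IopenE; exact: aI.
  have [x Ix e] := diffeo_surj dp0 (Iopen_closed Ia).
  by exists x; split => //; apply/(diffeo_Iopen dp0 Ix); rewrite /= e.
have [a' ha'] := choice ex.
have oa' : ordered_points a'.
  split; first by move=> n; rewrite -IopenE; have [] := ha' n.
  move=> i j /aord; have [Ii <-] := ha' i; have [Ij <-] := ha' j.
  by rewrite (diffeo_lt_mono dp0) ?inE//; exact: Iopen_closed.
have [p_ [q_ [r_ [s_ [B [t pz pa hB]]]]]] := tame_hats oa'.
have e0 : 0 < k / 2 by rewrite divr_gt0.
(* Displacements up to h0 change q, r and s by at most k / 2, which leaves half
   of the gain. *)
have [h0 h0pos hh0] := small_hats e0 hB.
exists a', h0, (4 * 128 * 32 * 2 * pi); split => //; first by rewrite mulr_gt0// pi_gt0.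
move=> b hb M io d f g eps eps0 fg lg f0 f1 fb sgn.
have [bq br bs] := hh0 (fun n => b n - a n) hb.
have tS := tame_sum (index_enum 'I_N) (fun n => b n - a n) t.
have tt := tame_lin 1 1 t0 tS.
set p := (fun u => _) in tt; set q := (fun u v => _) in tt; set r := (fun u v => _) in tt; set s
    := (fun u v => _) in tt.
have pm1 : p (-1) = 0.
  by rewrite /p z0 big1 ?mulr0 ?addr0// => n _; have [-> _] := pz n; rewrite mulr0.
have p1 : p 1 = 0.
  by rewrite /p z1 big1 ?mulr0 ?addr0// => n _; have [_ ->] := pz n; rewrite mulr0.
have bq' u v : Iclosed u -> Iclosed v -> `|q u v| <= 3 * k.
  move=> Iu Iv; rewrite /q !mul1r; apply: le_trans (ler_normD _ _) _.
  by have := bq0 u v Iu Iv; have := bq u v Iu Iv; lra.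
have br' u v : Iclosed u -> Iclosed v -> `|r u v| <= 4 * k.
  move=> Iu Iv; rewrite /r !mul1r; apply: le_trans (ler_normD _ _) _.
  by have := br0 u v Iu Iv; have := br u v Iu Iv; lra.
have bs' u v : Iclosed u -> Iclosed v -> s u v <= - (k / 2).
  move=> Iu Iv; rewrite /s !mul1r; have := bs u v Iu Iv.
  by rewrite ler_norml => /andP[_]; lra.
have k3 : 3 * k <= 2^-1 by lra.
have bq2 : bounded2 q 2^-1 by move=> u v Iu Iv; apply: le_trans (bq' u v Iu Iv) k3.
have dp := tame_diffeo tt pm1 p1 bq2.
have wb x : Iopen x -> 1 + q x x <= 2.
  move=> /Iopen_closed Ix; have := bq2 x x Ix Ix; rewrite ler_norml => /andP[_]; lra.
have pan n : a' n + p (a' n) = b n.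
  have [_ e] := ha' n.
  rewrite /p !mul1r addrA e (bigD1 n)//= big1 => [|m mn]; last by rewrite pa (negbTE mn) mulr0.
  by rewrite pa eqxx mulr1 addr0; ring.
have Ipsi u : Iopen u -> Iopen (u + p u) by move=> Iu; apply/(diffeo_Iopen dp (Iopen_closed Iu)).
have := @deformation_energy _ alpha p q r s f g eps 2 (- (k / 32)) M (a' \o io) d tt pm1 p1 bq2
    wb eps0 fg lg f0 f1.
move=> h; have {h} h := h _ _.
apply: le_trans (h _ _) _.
- by move=> m; rewrite /= pan.
- move=> u v Iu Iv; rewrite -normrM ger0_norm; last by apply: sgn; exact: Ipsi.
  rewrite mulrC; apply: ler_wpM2r; first by apply: sgn; exact: Ipsi.
  apply: kernel_defect_negative => //.
  + by apply: bq2; exact: Iopen_closed.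
  + by apply: bs'; exact: Iopen_closed.
  + by apply: br'; exact: Iopen_closed.
  + by apply: br'; exact: Iopen_closed.
rewrite divfK//; apply: leeD2l; rewrite -EFinN lee_fin.
have hw x : Iopen x -> 2^-1 <= 1 + q x x <= 2.
  move=> Ix; rewrite (bounded2_1Dq bq2 (Iopen_closed Ix) (Iopen_closed Ix))/=; exact: wb.
have [J0 J0' _ J1] := integral_comp_le dp (cont11_excess (prim_cont fg)) hw.
move: J0 J0' J1; move: (Rintegral _ _ _) (Rintegral _ _ _) => J' J J0 J0' J1.
have pi0 := pi_gt0 R.
have JJ : J ^+ 2 <= 4 * J' ^+ 2.
  have -> : 4 * J' ^+ 2 = (2 * J') ^+ 2 by ring.
  by rewrite lerXn2r ?nnegrE ?mulr_ge0.
have -> : - (k / 32) / (2 * pi) * J' ^+ 2 = - (J' ^+ 2 * 4 / (4 * 128 * 32 * 2 * pi)).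
  have e4 : (4 : R) * 4^-1 = 1 by rewrite mulfV.
  rewrite /k !invfM; move: (4^-1) (128^-1) (32^-1) (2^-1) (pi^-1) (J' ^+ 2) e4.
  move=> x4 x128 x32 x2 xpi X e4.
  transitivity (- (4 * x4) * (x128 * x32 * x2 * xpi * X)); last by ring.
  by rewrite e4; ring.
rewrite lerN2 mulrC [leRHS]mulrC ler_pM2l ?invr_gt0 ?mulr_gt0//.
by rewrite [leRHS]mulrC.
Qed.

End MovingNodes.

(** * Crossing points *)

Section Crossing.
Context {R : realType}.
Local Notation mu := (@lebesgue_measure R).
Local Notation meas D f := (@measurable_fun _ _ (measurableTypeR R) R D f).

(** Convergence in L^2 is more convenient in terms of the squared norm. *)
Lemma L2norm_lt (f : R -> R) (c : R) : 0 < c ->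
  (L2norm f < c%:E)%E <-> (sqint f < (c ^+ 2)%:E)%E.
Proof.
move=> c0; rewrite -L2norm_sqint.
have : (0 <= L2norm f)%E by exact: Lnorm_ge0.
case: (L2norm f) => [x| |]// ; last by rewrite poweRyr ?pnatr_eq0.
rewrite lee_fin => x0; rewrite poweR_EFin !lte_fin powR_mulrn// ltr_pXn2r ?nnegrE//.
exact: ltW.
Qed.

Lemma L2_convergesP (phi : R -> R -> R) (phi0 : R -> R) : L2_converges phi phi0 <->
  forall c : R, 0 < c -> \forall eps \near (0 : R)^'+,
    (sqint (fun x => phi eps x - phi0 x)%R < c%:E)%E.
Proof.
split => [h c c0|h].
  have s0 : 0 < Num.sqrt c by rewrite sqrtr_gt0.
  have hn : \forall eps \near (0 : R)^'+, (L2norm (fun x => phi eps x - phi0 x)%R < (Num.sqrt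
      c)%:E)%E.
    exact: h _ (@nbhs_open_ereal_lt R 0 (fun=> Num.sqrt c) s0).
  by apply: filterS hn => eps /(L2norm_lt _ s0); rewrite sqr_sqrtr// ltW.
move=> A /= [e /= e0 hA]; have e20 : 0 < e ^+ 2 by rewrite exprn_gt0.
apply: filterS (h _ e20) => eps /(L2norm_lt _ e0); rewrite /preimage/=.
have : (0 <= L2norm (fun x => phi eps x - phi0 x)%R)%E by exact: Lnorm_ge0.
case: (L2norm _) => [x| |]//; rewrite lee_fin lte_fin => x0 xe.
by apply: hA; rewrite /= sub0r normrN ger0_norm.
Qed.

Lemma sqint_itv_ge (f : R -> R) (l r m : R) : meas Iopen f -> -1 <= l -> l < r -> r <= 1 -> 0 <=
    m ->
  {ae mu, forall x, Iopen x -> l < x < r -> m <= `|f x|} ->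
  ((m ^+ 2 * (r - l))%:E <= sqint f)%E.
Proof.
move=> mf l1 lr r1 m0 ae.
have mI := @measurable_Iopen R.
have mJ : measurable (`]l, r[%classic : set (measurableTypeR R)) by exact: measurable_itv.
have JI := @itv_oo_Iopen R l r l1 r1.
apply: (@le_trans _ _ (\int[mu]_(x in `]l, r[%classic) ((f x) ^+ 2)%:E)%E); last first.
  apply: ge0_subset_integral => //; last by move=> x _; rewrite lee_fin sqr_ge0.
  by apply/measurable_EFinP; exact: measurable_funX.
apply: (@le_trans _ _ (\int[mu]_(x in `]l, r[%classic) (m ^+ 2)%:E)%E).
  by rewrite integral_cst//= lebesgue_measure_itv/= lte_fin lr -EFinD -EFinM.
apply: ae_ge0_le_integral => //.
- by move=> x _; rewrite lee_fin sqr_ge0.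
- by move=> x _; rewrite lee_fin sqr_ge0.
- by apply/measurable_EFinP; apply: measurable_funX; exact: measurable_funS mf.
apply: aeS ae => x h xJ; rewrite lee_fin -(real_normK (num_real (f x))).
rewrite lerXn2r ?nnegrE//; apply: h; first exact: JI.
by move: xJ; rewrite /= in_itv.
Qed.

(** A continuous function that stays on one side of the level v around a jump
    across v is far from the jump function on one of the two sides. *)
Lemma crossing (f f0 : R -> R) (y h u w : R) : 0 < h -> -1 <= y - h -> y + h <= 1 ->
  cont11 f -> meas Iopen f0 ->
  {ae mu, forall x, Iopen x -> y - h < x < y -> f0 x = u} ->
  {ae mu, forall x, Iopen x -> y < x < y + h -> f0 x = u + w} ->
  (sqint (fun x => f x - f0 x)%R < ((`|w| / 2) ^+ 2 * h)%:E)%E ->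
  exists2 b, `|b - y| <= h & f b = u + w / 2.
Proof.
move=> h0 l1 r1 cf mf0 ael aer sm; apply: contrapT => no.
have mf : meas Iopen (fun x => f x - f0 x) by apply: measurable_funB => //; exact: cont11_meas.
have cross (x z : R) : y - h <= x -> x <= z -> z <= y + h ->
    Num.min (f x) (f z) <= u + w / 2 <= Num.max (f x) (f z) -> False.
  move=> hx xz hz hv.
  have cxz : {within `[x, z], continuous f}.
    have sub (t : R) : x <= t <= z -> -1 <= t <= 1 by move=> /andP[t1 t2]; apply/andP; split; lra.
    by apply: continuous_subspaceW cf => t /=; rewrite /Iclosed /= !in_itv/=; exact: sub.
  have [b] := IVT xz cxz hv; rewrite in_itv/= => /andP[b1 b2] fb.
  apply: no; exists b => //; rewrite ler_norml; apply/andP; split; lra.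
have side : (forall x, y - h <= x <= y + h -> f x < u + w / 2) \/ (forall x, y - h <= x <= y + h
    -> u + w / 2 < f x).
  have [hl|hl] := ltP (f (y - h)) (u + w / 2); [left|right] => x /andP[x1 x2]; rewrite ltNge;
      apply/negP => hx.
    by apply: (cross (y - h) x) => //; rewrite ge_min (ltW hl)/= le_max hx orbT.
  by apply: (cross (y - h) x) => //; rewrite ge_min hx orbT/= le_max hl.
have L : (forall x, y - h < x < y -> `|w| / 2 <= `|f x - u|) -> False.
  move=> hL; move: sm; rewrite ltNge => /negP; apply.
  have -> : h = y - (y - h) by ring.
  apply: sqint_itv_ge => //; [lra|lra|].
  by apply: aeS ael => x e Ix hx; rewrite e//; exact: hL.
have Rr : (forall x, y < x < y + h -> `|w| / 2 <= `|f x - (u + w)|) -> False.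
  move=> hL; move: sm; rewrite ltNge => /negP; apply.
  have -> : h = (y + h) - y by ring.
  apply: sqint_itv_ge => //; [lra|lra|].
  by apply: aeS aer => x e Ix hx; rewrite e//; exact: hL.
case: side => sd; have [w0|w0] := leP 0 w.
- apply: Rr => x /andP[x1 x2]; have h1 : f x < u + w / 2 by apply: sd; lra.
  by rewrite ger0_norm// ler0_norm; lra.
- apply: L => x /andP[x1 x2]; have h1 : f x < u + w / 2 by apply: sd; lra.
  by rewrite (ltr0_norm w0) ler0_norm; lra.
- apply: L => x /andP[x1 x2]; have h1 : u + w / 2 < f x by apply: sd; lra.
  by rewrite (ger0_norm w0) ger0_norm; lra.
- apply: Rr => x /andP[x1 x2]; have h1 : u + w / 2 < f x by apply: sd; lra.
  by rewrite (ltr0_norm w0) ger0_norm; lra.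
Qed.

End Crossing.

(** * Control of the error terms *)

Section Dissipation.
Context {R : realType}.
Local Notation mu := (@lebesgue_measure R).
Local Notation meas D f := (@measurable_fun _ _ (measurableTypeR R) R D f).
Variables (alpha : R) (e : bool -> R).
Hypotheses (halpha : 0 < alpha < pi) (he : core_energy alpha e).

(** The enumeration of a set of ordinals is increasing. *)
Lemma ordered_enum_val (N : nat) (a : 'I_N -> R) (A : pred 'I_N) : ordered_points a ->
  ordered_points (a \o (@enum_val _ A)).
Proof.
move=> [aI aord]; split; first by move=> m; exact: aI.
move=> i j ij; apply: aord.
have su : sorted ltn (map val (enum A)).
  apply: (@subseq_sorted _ ltn ltn_trans _ (iota 0 N)); last exact: iota_ltn_sorted.
  rewrite -val_enum_ord; apply: map_subseq.
  have -> : enum A = seq.filter (mem A) (enum 'I_N) by rewrite enumT.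
  exact: filter_subseq.
have x0 := enum_default i.
rewrite !(enum_val_nth x0) -!(@nth_map _ x0 _ 0%N val) -?cardE//.
by apply: (sorted_ltn_nth ltn_trans) => //; rewrite inE size_map -cardE.
Qed.

(** Since 1/l - 1/l' <= 2/l^2, replacing l by l' costs only terms of order 1/l^2. *)
Lemma inv_log_shift (G B l l' r : R) : 0 <= G -> 1 <= l -> l <= l' -> l' <= l + 2 ->
  `|r| <= 1 / l' ^+ 2 -> G / (2 * l) - (G + `|B| + 1) / l ^+ 2 <= G / (2 * l') + B / l' ^+ 2 + r.
Proof.
move=> G0 l1 ll' ll2; have l0 : 0 < l by lra. have l'0 : 0 < l' by lra.
rewrite mul1r ler_norml => /andP[r1 _].
rewrite -!exprVn in r1 *; rewrite !invfM; set x := l^-1 in r1 *; set y := l'^-1 in r1 *.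
have x0 : 0 < x by rewrite invr_gt0. have y0 : 0 < y by rewrite invr_gt0.
have yx : y <= x by rewrite lef_pV2.
have xy : x - y <= 2 * x ^+ 2.
  have -> : x - y = x * y * (l' - l).
    by rewrite /x /y; field; rewrite !gt_eqF.
  apply: (@le_trans _ _ (x * y * 2)); first by apply: ler_wpM2l; [rewrite mulr_ge0// ltW|lra].
  rewrite mulrC expr2; apply: ler_wpM2l => //; apply: ler_wpM2l => //; exact: ltW.
have y2 : y ^+ 2 <= x ^+ 2 by rewrite lerXn2r ?nnegrE// ltW.
have h1 : G * (x - y) <= G * (2 * x ^+ 2) by apply: ler_wpM2l.
have h2 : - (`|B| * x ^+ 2) <= B * y ^+ 2.
  apply: (@le_trans _ _ (- (`|B| * y ^+ 2))).
    by rewrite lerN2; apply: ler_wpM2l.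
  by rewrite -mulNr; apply: ler_wpM2r; [exact: sqr_ge0|by rewrite lerNl -normrN; exact: ler_norm].
rewrite mulrBr in h1; move: h1 h2 r1 y2.
lra.
Qed.

(** The passage from eps to eps / 4 is hidden in the constant C. *)
Lemma inf_energy_quarter_ge (N : nat) (a : 'I_N -> R) (d : 'I_N -> bool) : ordered_points a ->
  exists2 C, 0 <= C & \forall eps \near (0 : R)^'+,
   ((pi * (\sum_(n < N) gamma alpha (d n) ^+ 2) / (2 * logdelta eps) - C / logdelta eps ^+ 2)%:E
     <= inf_energy alpha (eps / 4) a d)%E.
Proof.
move=> oa; have [r /remainderP hr hinf] := he d oa.
set G := \sum_(n < N) _; set B := W alpha a d + _ in hinf *.
exists (pi * G + `|B| + 1).
  have G0 : 0 <= G by apply: sumr_ge0 => n _; exact: sqr_ge0.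
  by rewrite !addr_ge0// mulr_ge0 ?pi_ge0.
near=> eps.
have -> : inf_energy alpha (eps / 4) a d = (pi * G / (2 * logdelta (eps / 4)) + B / logdelta (eps
    / 4) ^+ 2 + r (eps / 4))%:E.
  near: eps; exact: (near_quarter hinf).
have : `|r (eps / 4)| <= 1 / logdelta (eps / 4) ^+ 2.
  near: eps; exact: (near_quarter (hr 1 ltr01)).
have : logdelta eps <= logdelta (eps / 4) <= logdelta eps + 2.
  near: eps; exact: near_logdelta_quarter.
have : 1 <= logdelta eps by near: eps; exact: near_logdelta_ge.
move: (logdelta eps) (logdelta (eps / 4)) (r _) => l l' r' l1 /andP[ll' ll2] hr'.
have G0 : 0 <= pi * G by rewrite mulr_ge0 ?pi_ge0//; apply: sumr_ge0 => n _; exact: sqr_ge0.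
rewrite lee_fin; exact: inv_log_shift.
Unshelve. all: by end_near. Qed.

(** The two integrands on the right are the positive and the negative part. *)
Lemma excess_split (f : R -> R) : cont11 f -> (forall x, Iclosed x -> 0 <= f x <= pi) ->
  \int[mu]_(u in Iopen) `|cos (f u) - cos alpha| =
  \int[mu]_(u in Iopen) `|cos (Num.min (f u) alpha) - cos alpha| +
  \int[mu]_(u in Iopen) `|cos (Num.max (f u) alpha) - cos alpha|.
Proof.
move=> cf hf; have mI := @measurable_Iopen R.
have mc := cont11_meas (cont11_excess cf).
have int (F : R -> R) : meas Iopen F -> (forall x, Iopen x -> `|F x| <= 2) -> intI (fun x => `|F
    x|).
  move=> mF hF; apply: integrable_norm; apply: L2_intI; exact: (@L2_bounded _ _ 2).
have b2 u : `|cos (f u) - cos alpha| <= 2 by exact: cos_dist_le2.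
have ha : 0 <= alpha <= pi by have /andP[h1 h2] := halpha; rewrite !ltW.
pose X u := cos (f u) - cos alpha.
have E1 u : Iopen u -> cos (Num.min (f u) alpha) - cos alpha = Num.max (X u) 0.
  move=> /Iopen_closed Iu; rewrite cos_min ?hf// /X.
  by case: leP => h; case: leP => h'; lra.
have E2 u : Iopen u -> cos (Num.max (f u) alpha) - cos alpha = Num.min (X u) 0.
  move=> /Iopen_closed Iu; rewrite cos_max ?hf// /X.
  by case: leP => h; case: leP => h'; lra.
have i1 : intI (fun u => `|Num.max (X u) 0|).
  apply: int; [by apply: measurable_maxr; [exact: mc|exact: measurable_cst]|].
  by move=> x _; have := b2 x; rewrite -/(X x); case: (leP (X x) 0) => _ //; rewrite normr0.
have i2 : intI (fun u => `|Num.min (X u) 0|).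
  apply: int; [by apply: measurable_minr; [exact: mc|exact: measurable_cst]|].
  by move=> x _; have := b2 x; rewrite -/(X x); case: (leP (X x) 0) => _ //; rewrite normr0.
transitivity (\int[mu]_(u in Iopen)  (`|Num.max (X u) 0| + `|Num.min (X u) 0|)).
  apply: eq_Rintegral => u _; rewrite -/(X u).
  by case: leP; rewrite normr0 ?addr0 ?add0r.
rewrite RintegralD//; congr (_ + _); apply: eq_Rintegral => u; rewrite inE => Iu.
  by rewrite E1.
by rewrite E2.
Qed.

Lemma half_seminorm_ge0 (m : R -> R) : (0 <= half_seminorm alpha m)%E.
Proof.
rewrite /half_seminorm /sqr_seminorm_Hhalf !mule_ge0// ?lee_fin ?invr_ge0 ?mulr_ge0 ?pi_ge0//.
by apply: integral_ge0 => x _; apply: integral_ge0 => y _; rewrite lee_fin divr_ge0// sqr_ge0.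
Qed.

(** The terms of order 1/l cancel because Gp + Gm is the sum of all squared
    gammas.  What is left over on the right is a quarter of eps * s and the gain
    from both signs. *)
Lemma dissipation_real (K B Cp Cm Gp Gm p l eps s h s1 s2 h1 h2 J1 J2 : R) :
  0 < K -> 0 <= Cp -> 0 <= Cm -> 1 <= l -> 0 < eps -> 0 <= s -> s1 + s2 <= s -> h1 + h2 <= h ->
  0 <= J1 -> 0 <= J2 ->
  eps / 2 * s + h <= p * (Gp + Gm) / (2 * l) + B / l ^+ 2 ->
  p * Gp / (2 * l) - Cp / l ^+ 2 <= eps / 4 * s1 + h1 - J1 ^+ 2 / K ->
  p * Gm / (2 * l) - Cm / l ^+ 2 <= eps / 4 * s2 + h2 - J2 ^+ 2 / K ->
  eps * s + (J1 + J2) ^+ 2 <= (4 + 2 * K) * (`|B| + Cp + Cm) / l ^+ 2.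
Proof.
move=> K0 Cp0 Cm0 l1 e0 s0 ss hh j1 j2 A1 A2 A3.
have l2 : 0 < l ^+ 2 by rewrite exprn_gt0//; lra.
have x0 : 0 < (l ^+ 2)^-1 by rewrite invr_gt0.
have hB : B / l ^+ 2 <= `|B| / l ^+ 2 by apply: ler_wpM2r; [exact: ltW|exact: ler_norm].
have es : eps / 4 * (s1 + s2) <= eps / 4 * s by apply: ler_wpM2l => //; rewrite divr_ge0// ltW.
pose X := (`|B| + Cp + Cm) / l ^+ 2.
have X1 : eps / 4 * s + (J1 ^+ 2 + J2 ^+ 2) / K <= X.
  have eG : p * (Gp + Gm) / (2 * l) = p * Gp / (2 * l) + p * Gm / (2 * l) by rewrite mulrDr mulrDl.
  have eX : X = `|B| / l ^+ 2 + Cp / l ^+ 2 + Cm / l ^+ 2 by rewrite /X !mulrDl.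
  have eJ : (J1 ^+ 2 + J2 ^+ 2) / K = J1 ^+ 2 / K + J2 ^+ 2 / K by rewrite mulrDl.
  rewrite mulrDr in es; rewrite eX eJ; rewrite eG in A1.
  move: A1 A2 A3 hB es.
  move: (p * Gp / _) (p * Gm / _) (B / _) (`|B| / _) (Cp / _) (Cm / _) (J1 ^+ 2 / K) (J2 ^+ 2 /
      K) => *.
  lra.
have JK0 : 0 <= (J1 ^+ 2 + J2 ^+ 2) / K by rewrite divr_ge0 ?addr_ge0 ?sqr_ge0// ltW.
have es0 : 0 <= eps / 4 * s by rewrite mulr_ge0// divr_ge0// ltW.
have B1 : eps * s <= 4 * X by lra.
have B2 : (J1 + J2) ^+ 2 <= 2 * K * X.
  apply: (@le_trans _ _ (2 * K * ((J1 ^+ 2 + J2 ^+ 2) / K))).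
    have -> : 2 * K * ((J1 ^+ 2 + J2 ^+ 2) / K) = 2 * (J1 ^+ 2 + J2 ^+ 2).
      by field; rewrite gt_eqF.
    have := sqr_ge0 (J1 - J2); rewrite !expr2; lra.
  by apply: ler_wpM2l; [rewrite mulr_ge0// ltW|lra].
have -> : (4 + 2 * K) * (`|B| + Cp + Cm) / l ^+ 2 = 4 * X + 2 * K * X by rewrite /X; ring.
exact: lerD.
Qed.

(** Competitors for the two signs separately, at a quarter of the parameter:
    what is not needed for the leading order of the energy is an error of the
    next order. *)
Lemma dissipation (N : nat) (a : 'I_N -> R) (d : 'I_N -> bool) (B : R) : ordered_points a ->
  exists k C : R, [/\ 0 < k, 0 <= C & \forall eps \near (0 : R)^'+,
   forall (b : 'I_N -> R) (f g : R -> R) (s h : R), (forall n, Iclosed (b n)) -> (forall n, `|b n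
       - a n| <= k) ->
   prim f g -> L2 g -> sqint g = s%:E -> half_seminorm alpha (cos \o f) = h%:E ->
   (forall x, Iclosed x -> 0 <= f x <= pi) ->
   cos (f (-1)) = cos alpha -> cos (f 1) = cos alpha -> (forall n, cos (f (b n)) = pm (d n)) ->
   eps / 2 * s + h <= pi * (\sum_(n < N) gamma alpha (d n) ^+ 2) / (2 * logdelta eps) + B /
       logdelta eps ^+ 2 ->
   eps * s + (\int[mu]_(u in Iopen) `|cos (f u) - cos alpha|) ^+ 2 <= C / logdelta eps ^+ 2].
Proof.
move=> oa; have [a' [k [K [oa' k0 K0 hA]]]] := contracted_nodes_energy alpha oa.
pose Ap : pred 'I_N := fun n => d n; pose Am : pred 'I_N := fun n => ~~ d n.
have [Cp Cp0 hp] := inf_energy_quarter_ge (fun=> true) (ordered_enum_val Ap oa').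
have [Cm Cm0 hm] := inf_energy_quarter_ge (fun=> false) (ordered_enum_val Am oa').
exists k, ((4 + 2 * K) * (`|B| + Cp + Cm)); split => //.
  by rewrite mulr_ge0 ?addr_ge0// mulr_ge0// ltW.
have near1 : \forall eps \near (0 : R)^'+, 1 <= logdelta eps by exact: near_logdelta_ge.
have near0 : \forall eps \near (0 : R)^'+, 0 < eps by exact: nbhs_right_gt.
apply: filterS2 (filterI hp hm) (filterI near1 near0) => eps [{}hp {}hm] [l1 eps0].
move=> b f g s h bI hb fg lg sE hE f0pi fm1 f1 fb hle.
have cf := prim_cont fg.
have ha : 0 <= alpha <= pi by have /andP[h1 h2] := halpha; rewrite !ltW.
have [g1 [g2 [pg1 pg2 hg12]]] := prim_split alpha fg.
have mg := intI_measurable fg.1; have mg1 := intI_measurable pg1.1; have mg2 := intI_measurable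
    pg2.1.
have sq12 : (sqint g1 + sqint g2 <= s%:E)%E.
  by rewrite -sE; apply: sqintD_le => //; apply: aeW => x _; exact: hg12.
have := half_seminorm_split cf ha f0pi; rewrite hE => h12.
have fin2 (x y : \bar R) (z : R) : (0 <= x)%E -> (0 <= y)%E -> (x + y <= z%:E)%E ->
      exists x' y' : R, [/\ x = x'%:E, y = y'%:E, x' + y' <= z, 0 <= x' & 0 <= y'].
  case: x => [x| |]//; case: y => [y| |]// x0 y0; rewrite -EFinD lee_fin => xy.
  by exists x, y.
have [s1 [s2 [s1E s2E s12 s10 s20]]] := fin2 _ _ _ (sqint_ge0 g1) (sqint_ge0 g2) sq12.
have [h1 [h2 [h1E h2E hh12 h10 h20]]] := fin2 _ _ _ (half_seminorm_ge0 _) (half_seminorm_ge0 _) h12.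
have lg1 : L2 g1 by apply/L2E; split => //; rewrite s1E ltry.
have lg2 : L2 g2 by apply/L2E; split => //; rewrite s2E ltry.
have e40 : 0 <= eps / 4 by rewrite ltW// divr_gt0.
have Im1 : Iclosed (-1 : R) by rewrite IclosedE; lra.
have I1 : Iclosed (1 : R) by rewrite IclosedE; lra.
have [aI _] := oa.
have Jp := @hA b hb _ (@enum_val _ Ap) (fun=> true) _ g1 (eps / 4) e40 pg1 lg1.
have Jm := @hA b hb _ (@enum_val _ Am) (fun=> false) _ g2 (eps / 4) e40 pg2 lg2.
have fb0 n : 0 <= f (b n) <= pi.
  exact: f0pi.
have {}Jp : (inf_energy alpha (eps / 4) (a' \o @enum_val _ Ap) (fun=> true) <=
   (eps / 4 * s1 + h1 - (\int[mu]_(u in Iopen) `|cos (Num.min (f u) alpha) - cos alpha|) ^+ 2 /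
       K)%:E)%E.
  rewrite s1E h1E in Jp; apply: Jp.
  - by rewrite cos_min ?f0pi// fm1 maxxx.
  - by rewrite cos_min ?f0pi// f1 maxxx.
  - move=> m; rewrite cos_min ?fb0// fb (_ : d (enum_val m) = true); last exact: (enum_valP m).
    by rewrite /pm max_l// cos_le1.
  - move=> x y /Iopen_closed Ix /Iopen_closed Iy; rewrite !cos_min ?f0pi//.
    by apply: mulr_ge0; rewrite subr_ge0 le_max lexx orbT.
have {}Jm : (inf_energy alpha (eps / 4) (a' \o @enum_val _ Am) (fun=> false) <=
   (eps / 4 * s2 + h2 - (\int[mu]_(u in Iopen) `|cos (Num.max (f u) alpha) - cos alpha|) ^+ 2 /
       K)%:E)%E.
  rewrite s2E h2E in Jm; apply: Jm.
  - by rewrite cos_max ?f0pi// fm1 minxx.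
  - by rewrite cos_max ?f0pi// f1 minxx.
  - move=> m; rewrite cos_max ?fb0// fb (_ : d (enum_val m) = false); last
      exact/negbTE/(enum_valP m).
    by rewrite /pm min_l// cos_geN1.
  - move=> x y /Iopen_closed Ix /Iopen_closed Iy; rewrite !cos_max ?f0pi//.
    by apply: mulr_le0; rewrite subr_le0 ge_min lexx orbT.
have {hp}Jp := le_trans hp Jp; have {hm}Jm := le_trans hm Jm.
move: Jp Jm; rewrite !lee_fin (excess_split cf f0pi).
have J10 : 0 <= \int[mu]_(u in Iopen) `|cos (Num.min (f u) alpha) - cos alpha| by exact:
    Rintegral_ge0.
have J20 : 0 <= \int[mu]_(u in Iopen) `|cos (Num.max (f u) alpha) - cos alpha| by exact:
    Rintegral_ge0.
move: J10 J20; move: (\int[mu]_(u in Iopen) `|cos (Num.min (f u) alpha) - cos alpha|)%R => J1.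
move: (\int[mu]_(u in Iopen) `|cos (Num.max (f u) alpha) - cos alpha|)%R => J2 J10 J20.
have -> : \sum_(n < #|[eta Ap]|) gamma alpha true ^+ 2 = \sum_(n < N | d n) gamma alpha (d n) ^+ 2.
  rewrite [RHS](eq_bigr (fun=> gamma alpha true ^+ 2)); last by move=> n ->.
  by rewrite (big_enum_val (A := Ap) (fun=> gamma alpha true ^+ 2)).
have -> : \sum_(n < #|[eta Am]|) gamma alpha false ^+ 2 = \sum_(n < N | ~~ d n) gamma alpha (d n)
    ^+ 2.
  rewrite [RHS](eq_bigr (fun=> gamma alpha false ^+ 2)); last by move=> n /negbTE ->.
  by rewrite (big_enum_val (A := Am) (fun=> gamma alpha false ^+ 2)).
move: hle; rewrite (bigID d)/=.
move: (\sum_(i < N | d i) _) (\sum_(i < N | ~~ d i) _) (logdelta eps) l1 => Gp Gm l l1 hle Jp Jm.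
have s0 : 0 <= s by rewrite -lee_fin -sE sqint_ge0.
exact: (@dissipation_real K B Cp Cm Gp Gm pi l eps s h s1 s2 h1 h2 J1 J2).
Qed.

End Dissipation.

(** * The lower bound *)

Section LowerBound.
Context {R : realType}.
Local Notation mu := (@lebesgue_measure R).
Local Notation meas D f := (@measurable_fun _ _ (measurableTypeR R) R D f).
Variables (alpha : R) (e : bool -> R).
Hypotheses (halpha : 0 < alpha < pi) (he : core_energy alpha e).

(** The remainder is the amount by which E stays below t; an infinite value of E
    needs no remainder. *)
Lemma remainder_below (t : R -> R) (E : R -> \bar R) :
  (forall c : R, 0 < c -> \forall eps \near (0 : R)^'+, ((t eps - c / logdelta eps ^+ 2)%:E <= E
      eps)%E) ->
  exists2 r : R -> R, remainder r & \forall eps \near (0 : R)^'+, ((t eps - r eps)%:E <= E eps)%E.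
Proof.
move=> h; pose r eps := if E eps is x%:E then Num.max 0 (t eps - x) else 0.
exists r.
  apply/remainderP => c c0; apply: filterS (h c c0) => eps; rewrite /r.
  have q0 : 0 <= c / logdelta eps ^+ 2 by rewrite divr_ge0 ?sqr_ge0// ltW.
  case: (E eps) => [x| |]; rewrite ?normr0//.
  rewrite lee_fin => le; rewrite ger0_norm ?le_max ?lexx//.
  by rewrite ge_max q0/=; lra.
apply: filterS (h 1 ltr01) => eps; rewrite /r; case: (E eps) => [x| |]; [|by move=> _; exact:
    leey|by rewrite leeNy_eq].
move=> _; rewrite lee_fin lerBlDr -lerBlDl.
by rewrite le_max lexx orbT.
Qed.

Lemma fin_of_sum (x y : \bar R) (a t : R) : 0 < a -> (0 <= x)%E -> (0 <= y)%E ->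
  (a%:E * x + y < t%:E)%E -> exists x' y' : R, [/\ x = x'%:E, y = y'%:E & 0 <= x'].
Proof.
move=> a0; case: x => [x| |]//; case: y => [y| |]// x0 y0 h.
- by exists x, y.
- by move: h; rewrite gt0_muley ?lte_fin.
- by move: h; rewrite gt0_muley ?lte_fin.
Qed.

(** The arithmetic of the lower bound: the error terms eta * (eps * s) and
    eta * J^2 are controlled by dissipation. *)
Lemma absorb_error (c C eta l eps s h J r t : R) : 0 < eps -> 0 <= s -> 0 < eta ->
  8 * eta * C <= c / 2 -> `|r| <= c / 2 / l ^+ 2 -> eps * s + J ^+ 2 <= C / l ^+ 2 ->
  t + r <= eps / 2 * (1 + eta) * s + h + 8 * eta * J ^+ 2 ->
  t - c / l ^+ 2 <= eps / 2 * s + h.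
Proof.
move=> e0 s0 eta0 hC; rewrite ler_norml => /andP[r1 _] dis mov.
have l0 : 0 <= (l ^+ 2)^-1 by rewrite invr_ge0 sqr_ge0.
have h1 : 8 * eta * (eps * s + J ^+ 2) <= 8 * eta * (C / l ^+ 2).
  by apply: ler_wpM2l => //; rewrite mulr_ge0// ltW.
have h2 : 8 * eta * C / l ^+ 2 <= c / 2 / l ^+ 2 by apply: ler_wpM2r.
have h3 : 0 <= eta * (eps * s) by rewrite !mulr_ge0// ltW.
rewrite (mulrAC c) in r1 h2.
rewrite mulrA in h1; have {}h1 := le_trans h1 h2.
rewrite mulrDr in h1.
have E1 : eps / 2 * (1 + eta) * s = eps * s / 2 + eta * (eps * s) / 2 by field.
have E2 : eps / 2 * s = eps * s / 2 by field.
have E3 : 8 * eta * (eps * s) = 8 * (eta * (eps * s)) by ring.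
rewrite E1 in mov; rewrite E2; rewrite E3 in h1.
move: mov h1 h3 r1; move: (eta * (eps * s)) (eps * s) (8 * eta * J ^+ 2) (c / l ^+ 2) => *.
lra.
Qed.

(** Between the level before and the level after a jump, the liftings pass the
    level half way up. *)
Lemma crossing_points (phi : R -> R -> R) (phi0 : R -> R) (N : nat) (c k : R) (a w : 'I_N -> R)
    (d : 'I_N -> bool) :
  0 < k -> admissible_family alpha phi -> L2_converges phi phi0 -> meas Iopen phi0 ->
  ordered_points a -> (forall n, w n != 0) ->
  {ae mu, forall x, Iopen x -> phi0 x = step c a w x} -> jumps_at alpha c a w d ->
  \forall eps \near (0 : R)^'+, exists b : 'I_N -> R,
    forall n, [/\ Iclosed (b n), `|b n - a n| <= k & cos (phi eps (b n)) = pm (d n)].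
Proof.
move=> k0 adm /L2_convergesP conv mphi0 oa w0 fst hj.
suff : \forall eps \near (0 : R)^'+, forall n, exists b, [/\ Iclosed b, `|b - a n| <= k & cos
    (phi eps b) = pm (d n)].
  by apply: filterS => eps h; have [b hb] := choice h; exists b.
apply: filter_forall => n; have [aI _] := oa; have /andP[a1 a2] := aI n.
have [hl hl0 hhl] := step_left c a w (a n); have [hr hr0 hhr] := step_right c a w (a n).
(* On both sides of a_n, phi0 is constant up to distance h. *)
pose h := Num.min k (Num.min (Num.min hl hr) (Num.min (a n + 1) (1 - a n))).
have [h0 hk hl1 hr1 [ha1 ha2]] : [/\ 0 < h, h <= k, h <= hl, h <= hr & h <= a n + 1 /\ h <= 1 - a
    n].
  by split; rewrite /h ?lt_min ?ge_min ?lexx ?orbT// k0 hl0 hr0/=; apply/andP; split; lra.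
have C0 : 0 < (`|w n| / 2) ^+ 2 * h.
  by rewrite mulr_gt0// exprn_gt0// divr_gt0// normr_gt0.
have near0 : \forall eps \near (0 : R)^'+, 0 < eps by exact: nbhs_right_gt.
apply: filterS2 near0 (conv _ C0) => eps eps0 sm.
have [[cf _ _] _ _] := adm eps eps0.
have [||||b hb fb] := @crossing _ (phi eps) phi0 (a n) h (step c a w (a n)) (w n) h0 _ _ cf mphi0
    _ _ sm.
- lra.
- lra.
- apply: aeS fst => x e1 Ix /andP[x1 x2]; rewrite e1// hhl//; apply/andP; split; lra.
- apply: aeS fst => x e1 Ix /andP[x1 x2]; rewrite e1// hhr ?step_after//; apply/andP; split; lra.
exists b; have [_ cT _] := hj n; rewrite fb cT; split => //; last exact: le_trans hb hk.
by move: hb; rewrite ler_norml IclosedE => /andP[b1 b2]; apply/andP; split; lra.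
Qed.

(** If the energy is above the asserted bound, there is nothing to show; otherwise
    dissipation makes the cost of moving the nodes negligible. *)
Lemma energy_lower_bound (phi : R -> R -> R) (phi0 : R -> R) (N : nat) (a : 'I_N -> R) (d : 'I_N
    -> bool) :
  admissible_family alpha phi -> simple alpha phi0 -> L2_converges phi phi0 ->
  transition_profile alpha phi0 a d ->
  exists2 r : R -> R, remainder r & \forall eps \near (0 : R)^'+,
    ((eta_jumps alpha phi0 / logdelta eps
      + (\sum_(n < N) e (d n) + W alpha a d) / logdelta eps ^+ 2 - r eps)%:E
     <= energy_lift alpha eps (phi eps))%E.
Proof.
move=> adm [hPhi _] conv prof.
have [c [w [rep fst hj]]] := profile_step halpha hPhi prof.
have [oa js _] := rep; have [[fi _] _] := hPhi.
rewrite (eta_jumps_simple halpha rep hj).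
have w0 n : w n != 0.
  by have /andP[h _] := jump_size_bounds halpha (js n); rewrite -normr_gt0.
apply: remainder_below => c0 c00.
have [r1 /remainderP hr1 hinf] := he d oa.
set G := \sum_(n < N) _ in hinf *; set B := W alpha a d + _ in hinf.
have [k1 [C [k10 C0 hdis]]] := dissipation halpha he d B oa.
(* With this choice the error 8 * eta * C is at most half of c0. *)
pose eta := Num.min 2^-1 (c0 / (16 * (C + 1))).
have C1 : 0 < C + 1 by lra.
have eta0 : 0 < eta by rewrite lt_min; apply/andP; split; [rewrite invr_gt0|rewrite divr_gt0
    ?mulr_gt0].
have eta1 : eta <= 2^-1 by rewrite ge_min lexx.
have eta2 : 8 * eta * C <= c0 / 2.
  have h : eta <= c0 / (16 * (C + 1)) by rewrite ge_min lexx orbT.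
  rewrite ler_pdivlMr ?mulr_gt0// in h.
  have h' : 0 < eta * 16 by rewrite mulr_gt0.
  by lra.
have eta01 : 0 < eta <= 2^-1 by rewrite eta0.
have [k2 k20 hmov] := moved_nodes_energy alpha d oa eta01.
have k0 : 0 < Num.min k1 k2 by rewrite lt_min k10.
have hb := crossing_points k0 adm conv (intI_measurable fi) oa w0 fst hj.
have c20 : 0 < c0 / 2 by rewrite divr_gt0.
have near0 : \forall eps \near (0 : R)^'+, 0 < eps by exact: nbhs_right_gt.
apply: filterS3 (filterI hb near0) (filterI hinf (hr1 _ c20)) hdis.
move=> eps [[b hbn] eps0] [einf er1] edis.
have [hH1 start fin] := adm eps eps0.
have ends : cos (phi eps (-1)) = cos alpha /\ cos (phi eps 1) = cos alpha.
  by split; [case: start => ->; rewrite ?cosN|exact: in_2piZ_pm_cos].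
have [g [pg lg hrange hE]] := circle_fold alpha (H1_cos_sin hH1).
have := hE eps (ltW eps0); rewrite -/(energy_lift alpha eps (phi eps)) => {}hE.
set f := acos \o (cos \o phi eps) in pg.
have cosf x : cos (f x) = cos (phi eps x).
  by rewrite /f /= acosK// in_itv/= cos_geN1 cos_le1.
have hsf : half_seminorm alpha (cos \o phi eps) = half_seminorm alpha (cos \o f).
  by congr half_seminorm; apply/funext => x; rewrite /= cosf.
rewrite hsf in hE.
set t := pi / 2 * G / logdelta eps + _.
have [tE|Et] := leP t%:E (energy_lift alpha eps (phi eps)).
  by apply: le_trans tE; rewrite lee_fin gerBl; apply: divr_ge0; [exact: ltW|exact: sqr_ge0].
have tB : t = pi * G / (2 * logdelta eps) + B / logdelta eps ^+ 2.
  by rewrite /t /B (invfM 2); ring.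
have small := le_lt_trans hE Et.
have [s0 h0] := (sqint_ge0 g, half_seminorm_ge0 alpha (cos \o f)).
have e20 : 0 < eps / 2 by rewrite divr_gt0.
have [s [h [sE hhE s00]]] := fin_of_sum e20 s0 h0 small.
have [bI bk bc] : [/\ forall n, Iclosed (b n), forall n, `|b n - a n| <= Num.min k1 k2 & forall
    n, cos (f (b n)) = pm (d n)].
  by split => n; have [b1 b2 b3] := hbn n; rewrite ?cosf.
have bk1 n : `|b n - a n| <= k1 by apply: le_trans (bk n) _; rewrite ge_min lexx.
have bk2 n : `|b n - a n| <= k2 by apply: le_trans (bk n) _; rewrite ge_min lexx orbT.
have f0pi x : Iclosed x -> 0 <= f x <= pi by move=> /hrange[].
have fends : cos (f (-1)) = cos alpha /\ cos (f 1) = cos alpha by rewrite !cosf.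
have [fm1 f1] := fends.
have hEr : eps / 2 * s + h < t.
  by move: small; rewrite sE hhE -EFinM -EFinD lte_fin.
have := edis b f g s h bI bk1 pg lg sE hhE f0pi fm1 f1 bc.
rewrite -/G -tB => dis; have {}dis := dis (ltW hEr).
have := hmov b bk2 f g eps (ltW eps0) pg lg fm1 f1 bc.
rewrite einf sE hhE -EFinM -!EFinD lee_fin => mov.
move: hE; rewrite sE hhE -EFinM -EFinD; apply: le_trans; rewrite lee_fin.
rewrite -tB in mov.
exact: (absorb_error eps0 s00 eta0 eta2 er1 dis mov).
Qed.

End LowerBound.

(** * Recovery of liftings *)

Section UpperBound.
Context {R : realType}.
Local Notation mu := (@lebesgue_measure R).
Local Notation meas D f := (@measurable_fun _ _ (measurableTypeR R) R D f).

(** The nodes to the left of x are an initial segment, so the sum telescopes. *)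
Lemma step_telescope (N : nat) (c : R) (a w : 'I_N -> R) (G : R -> R) (x : R) : ordered_points a ->
  G (step c a w x) = G c + \sum_(n < N) (G (step c a w (a n) + w n) - G (step c a w (a n))) *
      after (a n) x.
Proof.
move=> oa; have [_ aord] := oa.
have initial (y : R) : exists k, (k <= N)%N /\ forall m : 'I_N, (a m < y) = (m < k)%N.
  pose Pk k := [forall m : 'I_N, (a m < y) ==> (m < k)%N].
  have exP : exists k, Pk k by exists N; apply/forallP => m; apply/implyP.
  case: (ex_minnP exP) => k /forallP hk kmin; exists k; split.
    by apply: kmin; apply/forallP => m; apply/implyP.
  move=> m; apply/idP/idP; first exact/implyP.
  rewrite ltNge; apply: contraTN => ya; rewrite -leqNgt; apply: kmin.
  apply/forallP => j; apply/implyP => jy; rewrite ltnNge; apply/negP; rewrite leq_eqVlt.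
  move=> /orP[/eqP/val_inj e|/aord h]; first by move: jy; rewrite -e ltNge ya.
  by move: (lt_trans h jy); rewrite ltNge ya.
pose F j := G (c + \sum_(m < N) w m * (if (m < j)%N then 1 else 0)).
have sE (y : R) k : (forall m : 'I_N, (a m < y) = (m < k)%N) -> G (step c a w y) = F k.
  by move=> hk; rewrite /F /step; congr G; congr (_ + _); apply: eq_bigr => m _; rewrite /after hk.
have stan (n : 'I_N) : G (step c a w (a n)) = F n.
  apply: sE => m; apply/idP/idP => [|/aord//].
  by case: (ltngtP m n) => // [/aord/ltW h|/val_inj ->]; rewrite ltNge ?h// lexx.
have stan1 (n : 'I_N) : G (step c a w (a n) + w n) = F n.+1.
  rewrite -(step_after c w oa) /F; congr G; congr (_ + _); apply: eq_bigr => m _.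
  rewrite ltnS; case: (leqP m n) => [|/aord h]; last by rewrite leNgt h.
  by rewrite leq_eqVlt => /orP[/eqP/val_inj ->|/aord/ltW ->]; rewrite ?lexx.
have [k [kN hk]] := initial x.
rewrite (sE x k hk).
have F0 : G c = F 0%N.
  by rewrite /F; congr G; rewrite big1 ?addr0// => m _; rewrite mulr0.
rewrite F0; under eq_bigr => n _ do rewrite stan stan1.
transitivity (F 0%N + \sum_(0 <= n < k) (F n.+1 - F n)).
  by rewrite telescope_sumr// addrC subrK.
congr (_ + _); rewrite (big_nat_widen 0 k N)// big_mkord [LHS]big_mkcond/=.
by apply: eq_bigr => n _; rewrite /after hk; case: ifP; rewrite ?mulr1 ?mulr0.
Qed.

Lemma prim_sum (I : Type) (l : seq I) (F G : I -> R -> R) : (forall i, prim (F i) (G i)) ->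
  prim (fun x => \sum_(i <- l) F i x) (fun x => \sum_(i <- l) G i x).
Proof.
move=> h; elim: l => [|i l IH].
  by apply: prim_ext (prim_cst 0) => x _; rewrite big_nil.
by apply: prim_ext (primD (h i) IH) => x _; rewrite big_cons.
Qed.

Lemma boundary_weight_ge1 (s : R) : Iopen s -> 1 <= boundary_weight s.
Proof.
rewrite IopenE => /andP[s1 s2]; rewrite /boundary_weight.
have h (x : R) : 0 < x < 2 -> 2^-1 <= x^-1 by move=> /andP[x0 x2]; rewrite lef_pV2 ?posrE//; lra.
have h1 := h (1 - s) ltac:(lra); have h2 := h (1 + s) ltac:(lra).
by lra.
Qed.

(** The boundary weight is at least 1. *)
Lemma sqint_half_seminorm (alpha : R) (m : R -> R) : cont11 m ->
  (sqint (fun x => (m x - cos alpha)%R) <= (2 * pi)%:E * half_seminorm alpha m)%E.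
Proof.
move=> cm; have mE := excess_meas alpha cm; have mI := @measurable_Iopen R.
rewrite /half_seminorm /sqr_seminorm_Hhalf (seminorm_split mE (@excess_out _ alpha m)).
have pi0 := pi_gt0 R.
set Q := (integral _ _ _); set P := (\int[mu]_(s in Iopen) (excess alpha m s ^+ 2 *
    boundary_weight s)%:E)%E.
have Q0 : (0 <= Q)%E by apply: integral_ge0 => z _; rewrite lee_fin divr_ge0// sqr_ge0.
have P0 : (0 <= P)%E.
  by apply: integral_ge0 => z Iz; rewrite lee_fin mulr_ge0 ?sqr_ge0// boundary_weight_ge0.
rewrite !muleA -!EFinM (_ : 2 * pi * 2^-1 * (2 * pi)^-1 = 2^-1); last first.
  by rewrite mulrAC divff ?mul1r// mulf_neq0// gt_eqF.
apply: (@le_trans _ _ P); last first.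
  rewrite ge0_muleDr ?mule_ge0// muleA -EFinM mulVf// mul1e.
  by apply: leeDr; rewrite mule_ge0.
apply: ge0_le_integral => //.
- by move=> x _; rewrite lee_fin sqr_ge0.
- apply/measurable_EFinP; apply: measurable_funX; apply: measurable_funB; last exact:
    measurable_cst.
  exact: cont11_meas.
- apply/measurable_EFinP; apply: measurable_funM.
    by apply: measurable_funX; exact: measurable_funS mE.
  exact: measurable_funS (@measurable_boundary_weight R).
- move=> x Ix; rewrite lee_fin excess_in// -[leLHS]mulr1.
  by apply: ler_wpM2l; [exact: sqr_ge0|exact: boundary_weight_ge1].
Qed.

Variables (alpha : R) (halpha : 0 < alpha < pi).

(** The sine changes its sign at the n-th jump, so the left factor is 2 or -2; and
    at the node the angle acos (d_n) is 0 or pi. *)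
Lemma jump_slope (N : nat) (c : R) (a w : 'I_N -> R) (d : 'I_N -> bool) (n : 'I_N) :
  jumps_at alpha c a w d ->
  (sin (step c a w (a n) + w n) - sin (step c a w (a n))) / sin alpha *
  (alpha - acos (pm (d n))) = w n.
Proof.
move=> hj; have [s0 cT wn] := hj n; have /andP[a0 a1] := halpha.
have sa : 0 < sin alpha by rewrite sin_gt0_pi ?a0.
set u := step c a w (a n) in s0 cT *; set T := u + w n / 2 in s0 cT.
have uE : u = T - w n / 2 by rewrite /T addrK.
have uE' : u + w n = T + w n / 2 by rewrite /T; field.
rewrite uE' {}uE sinB sinD s0 cT !mul0r add0r sub0r opprK.
have sw : sin (w n / 2) = Num.sg (w n) * sin alpha.
  have e : sin (`|w n| / 2) = sin alpha.
    rewrite wn mulrAC divff// mul1r; case: (d n) => //.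
    by rewrite sinB cospi sinpi mul0r sub0r mulN1r opprK.
  have [h|h] := leP 0 (w n).
    rewrite ger0_norm// in e; rewrite e; have [z|z] := eqVneq (w n) 0.
      by move: sa; rewrite -e z mul0r sin0 ltxx.
    by rewrite gtr0_sg ?mul1r// lt_neqAle eq_sym z.
  by rewrite ltr0_norm// mulNr sinN in e; rewrite ltr0_sg// mulN1r -e opprK.
rewrite sw.
have -> : (pm (d n) * (Num.sg (w n) * sin alpha) + pm (d n) * (Num.sg (w n) * sin alpha)) / sin
    alpha
    = 2 * pm (d n) * Num.sg (w n) by field; rewrite gt_eqF.
rewrite [in RHS](numEsg (w n)) wn /pm.
case: (d n); first by rewrite acos1; ring.
by rewrite acosN1; ring.
Qed.

(** By the Hoelder continuity of acos and by Young's inequality with the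
    parameter lam. *)
Lemma lifting_distance (phi phi0 m : R -> R) (lam K : R) : cont11 phi -> meas Iopen phi0 ->
    cont11 m ->
  {ae mu, forall x, Iopen x -> (phi x - phi0 x) ^+ 2 = (acos (m x) - alpha) ^+ 2 /\ -1 <= m x <=
      1} ->
  (half_seminorm alpha m <= K%:E)%E -> 0 < lam ->
  (sqint (fun x => (phi x - phi0 x)%R) <= (8 * lam + 8 * pi / lam * K)%:E)%E.
Proof.
move=> cphi mphi0 cm ae hK lam0.
have /andP[a0 a1] := halpha; have pi0 := pi_gt0 R; have mI := @measurable_Iopen R.
have acosa : acos (cos alpha) = alpha.
  by rewrite cosK// in_itv/=; apply/andP; split; exact: ltW.
have l40 : 0 <= 4 / lam by apply: divr_ge0 => //; exact: ltW.
have l4 : 0 <= 4 * lam by apply: mulr_ge0 => //; exact: ltW.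
have mX : meas Iopen (fun x => m x - cos alpha).
  by apply: measurable_funB; [exact: cont11_meas|exact: measurable_cst].
have mX2 : meas Iopen (fun x => (m x - cos alpha) ^+ 2) by exact: measurable_funX.
have mE2 : @measurable_fun _ _ (measurableTypeR R) _ Iopen (fun x => ((m x - cos alpha) ^+ 2)%:E)
    by exact/measurable_EFinP.
have sqX : (sqint (fun x => (m x - cos alpha)%R) <= (2 * pi * K)%:E)%E.
  apply: le_trans (sqint_half_seminorm alpha cm) _.
  rewrite (EFinM (2 * pi)); apply: lee_wpmul2l; last exact: hK.
  by rewrite lee_fin; apply: mulr_ge0; [exact: ler0n|exact: ltW].
apply: (@le_trans _ _ (\int[mu]_(x in Iopen) ((4 * lam)%:E + (4 / lam)%:E * ((m x - cos alpha) ^+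
    2)%:E))%E).
  apply: ae_ge0_le_integral.
  - exact: mI.
  - by move=> x _; rewrite lee_fin sqr_ge0.
  - apply/measurable_EFinP; apply: measurable_funX; apply: measurable_funB; last exact: mphi0.
    exact: cont11_meas cphi.
  - by move=> x _; rewrite -EFinM -EFinD lee_fin; apply: addr_ge0; [exact: l4|apply: mulr_ge0;
      [exact: l40|exact: sqr_ge0]].
  - apply: emeasurable_funD; first exact: measurable_cst.
    by apply/measurable_EFinP; apply: measurable_funM; [exact: measurable_cst|exact: mX2].
  apply: aeS ae => x h Ix; have [e m11] := h Ix.
  rewrite -EFinM -EFinD lee_fin e.
  have ca1 : -1 <= cos alpha <= 1 by rewrite cos_geN1 cos_le1.
  have := acos_dist m11 ca1; rewrite acosa => h'; apply: le_trans h' _.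
  move: (m x - cos alpha) => X; rewrite -(real_normK (num_real X)).
  move: (normr_ge0 X); move: `|X| => Y Y0.
  have := sqr_ge0 (lam - Y); rewrite sqrrB => h'.
  have Z : (4 / lam * Y ^+ 2) * lam = 4 * Y ^+ 2 by field; rewrite gt_eqF.
  rewrite -(ler_pM2r lam0) [leRHS]mulrDl Z; clear Z.
  by rewrite !expr2 in h' *; lra.
rewrite (ge0_integralD mu mI); last 4 first.
- by move=> x _; rewrite lee_fin.
- exact: measurable_cst.
- by move=> x _; rewrite -EFinM lee_fin; apply: mulr_ge0; [exact: l40|exact: sqr_ge0].
- by apply/measurable_EFinP; apply: measurable_funM; [exact: measurable_cst|exact: mX2].
rewrite integral_cst//= measure_Iopen (ge0_integralZl mu mI mE2); last 2 first.
- by move=> x _; rewrite lee_fin sqr_ge0.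
- by rewrite lee_fin.
rewrite (EFinD (8 * lam)); apply: leeD; first by rewrite -EFinM lee_fin; lra.
apply: (@le_trans _ _ ((4 / lam)%:E * (2 * pi * K)%:E)%E).
  by apply: lee_wpmul2l; [rewrite lee_fin|exact: sqX].
rewrite -EFinM lee_fin le_eqVlt; apply/orP; left; apply/eqP; ring.
Qed.

(** The sine of the step function divided by sin alpha is a sign that changes at
    every node.  Adding theta - alpha with this sign to the step function cancels
    the jumps, by jump_slope. *)
Lemma recovery (phi0 : R -> R) (N : nat) (c : R) (a w : 'I_N -> R) (d : 'I_N -> bool) (eps v t :
    R) :
  ordered_points a -> meas Iopen phi0 ->
  {ae mu, forall x, Iopen x -> phi0 x = step c a w x} ->
  {ae mu, forall x, Iopen x -> in_2piZ_pm alpha (phi0 x)} -> jumps_at alpha c a w d ->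
  0 < eps -> inf_energy alpha eps a d = v%:E -> 0 < t ->
  exists phi : R -> R, [/\ H1 phi, phi (-1) = c, in_2piZ_pm alpha (phi 1),
    (energy_lift alpha eps phi <= (v + t)%:E)%E &
    forall lam : R, 0 < lam -> (sqint (fun x => (phi x - phi0 x)%R) <=
       (8 * lam + 8 * pi / lam * (v + t))%:E)%E].
Proof.
move=> oa mphi0 fst fpm hj eps0 vE t0.
have /andP[a0 a1] := halpha.
have sa : 0 < sin alpha by rewrite sin_gt0_pi ?a0.
have [aI _] := oa.
have vfin : inf_energy alpha eps a d \is a fin_num by rewrite vE.
have [_ [[m1 m2] [/= circ b0 b1 ba] <-] /= hm] := lb_ereal_inf_adherent t0 vfin.
rewrite -/(inf_energy alpha eps a d) vE -EFinD in hm.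
have [g [pg lg hth hE]] := circle_fold alpha circ.
have {}hE := le_lt_trans (hE eps (ltW eps0)) hm.
set th := acos \o m1 in pg.
have Im1 : Iclosed (-1 : R) by rewrite IclosedE; lra.
have I1 : Iclosed (1 : R) by rewrite IclosedE; lra.
have acosa : acos (cos alpha) = alpha by rewrite cosK// in_itv/= !ltW.
have thm1 : th (-1) = alpha by rewrite /th/= b0.
have th1 : th 1 = alpha by rewrite /th/= b1.
(* The sign sg of theta - alpha jumps by ka n at a n. *)
pose ka n := (sin (step c a w (a n) + w n) - sin (step c a w (a n))) / sin alpha.
pose sg x := sin c / sin alpha + \sum_(n < N) ka n * after (a n) x.
pose phi x := c + sin c / sin alpha * (th x - alpha) + \sum_(n < N) ka n * ((th x - th (a n)) *
    after (a n) x).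
have sgE x : sg x = sin (step c a w x) / sin alpha.
  rewrite (step_telescope c w sin x oa) mulrDl mulr_suml; congr (_ + _).
  by apply: eq_bigr => n _; rewrite /ka mulrAC.
have phiE x : phi x = step c a w x + sg x * (th x - alpha).
  rewrite /phi /sg /step mulrDl mulr_suml [RHS]addrACA -!addrA; congr (_ + _).
  congr (_ + _); rewrite -big_split/=; apply: eq_bigr => n _.
  have h : ka n * (alpha - th (a n)) = w n by rewrite /th/= ba; exact: jump_slope.
  have -> : w n * after (a n) x = ka n * (alpha - th (a n)) * after (a n) x by rewrite h.
  by ring.
have stm1 : step c a w (-1) = c.
  rewrite /step big1 ?addr0// => n _; have /andP[h1 _] := aI n.
  by rewrite /after ltNge (ltW h1) mulr0.
have stcos x : -1 <= x <= 1 -> cos (step c a w x) = cos alpha.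
  move=> /andP[x1 x2]; apply: in_2piZ_pm_cos.
  have [->|xm] := eqVneq x (-1); last first.
    by apply: (step_value_left fst fpm); rewrite x2 andbT lt_neqAle eq_sym xm.
  have := @step_value_right _ N c a w alpha phi0 fst fpm (-1).
  rewrite (step_start c w oa) => h.
  rewrite stm1.
  by apply: h; lra.
have sg2 x : Iclosed x -> sg x ^+ 2 = 1.
  rewrite IclosedE => /stcos h; rewrite sgE expr_div_n sin2cos2 h -sin2cos2 divff//.
  by rewrite expf_neq0// gt_eqF.
have cosphi x : Iclosed x -> cos (phi x) = m1 x.
  move=> Ix; rewrite phiE cosD stcos -?IclosedE//.
  have -> : sin (step c a w x) = sg x * sin alpha by rewrite sgE divfK// gt_eqF.
  have hth' : cos (alpha + (th x - alpha)) = m1 x.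
    by rewrite addrC subrK; have [_] := hth x Ix.
  have /eqP := sg2 x Ix; rewrite sqrf_eq1 => /orP[/eqP ->|/eqP ->].
    by rewrite !mul1r -cosD.
  by rewrite !mulN1r cosN sinN mulrNN -cosD.
have pphi : prim phi (fun x => sg x * g x).
  have pS : prim (fun x => \sum_(n < N) ka n * ((th x - th (a n)) * after (a n) x))
      (fun x => \sum_(n < N) ka n * (g x * after (a n) x)).
    apply: prim_sum => n; apply: primZ; apply: prim_after => //; exact: aI.
  have := primD (primD (prim_cst c) (primZ (sin c / sin alpha) (primB pg (prim_cst alpha)))) pS.
  apply: prim_ext => x _; rewrite /phi//= /sg subr0 add0r mulrDl mulr_suml; congr (_ + _).
  by apply: eq_bigr => n _; ring.
clearbody sg phi.
have sq_eq : sqint (fun x => sg x * g x) = sqint g.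
  apply: eq_integral => x; rewrite inE => /Iopen_closed Ix.
  by rewrite exprMn sg2// mul1r.
have lphi : L2 (fun x => sg x * g x).
  apply/L2E; split; first exact: intI_measurable pphi.1.
  by rewrite sq_eq; have [_] := (L2E _).1 lg.
have hs : half_seminorm alpha (cos \o phi) = half_seminorm alpha m1.
  rewrite /half_seminorm; congr (_ * sqr_seminorm_Hhalf _)%E; apply/funext => x.
  have [Ix|nIx] := pselect (Iopen x); last by rewrite !excess_out.
  by rewrite !excess_in//= cosphi//; exact: Iopen_closed.
have c1 : cont11 m1 by have [/H1P[g1 /prim_cont]] := circ.
exists phi; split.
- by apply/H1P; exists (fun x => sg x * g x).
- by rewrite phiE thm1 subrr mulr0 addr0 stm1.
- rewrite phiE th1 subrr mulr0 addr0.
  by apply: (step_value_left fst fpm); rewrite lexx andbT; lra.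
- by rewrite (energy_liftE _ _ pphi lphi) sq_eq hs ltW.
move=> lam lam0; apply: lifting_distance.
- exact: prim_cont pphi.
- exact: mphi0.
- exact: c1.
- apply: aeS fst => x e Ix; have Ix' := Iopen_closed Ix.
  rewrite (e Ix) phiE addrAC subrr add0r exprMn (sg2 x Ix') mul1r; split; first exact: erefl.
  by rewrite -(cosphi x Ix') cos_geN1 cos_le1.
- apply: le_trans (ltW hE); apply: leeDr; apply: mule_ge0; last exact: sqint_ge0.
  by rewrite lee_fin; apply: divr_ge0; [exact: ltW|exact: ler0n].
- exact: lam0.
Qed.

End UpperBound.

(** * The upper bound *)

Section UpperBoundFamily.
Context {R : realType}.

Lemma inv_log_bound (G B r l : R) : 0 <= G -> 1 <= l -> `|r| <= 1 / l ^+ 2 ->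
  G / (2 * l) + B / l ^+ 2 + r + l^-1 / l ^+ 2 <= (G + `|B| + 2) / l.
Proof.
move=> G0 l1; rewrite ler_norml => /andP[_ r1].
have l0 : 0 < l by lra.
rewrite mul1r in r1; rewrite (invfM 2) -!exprVn in r1 *; set x := l^-1 in r1 *.
have x0 : 0 <= x by rewrite invr_ge0 ltW.
have x1 : x <= 1 by rewrite invf_le1.
have x2 : x ^+ 2 <= x by rewrite expr2 -[leRHS]mulr1; apply: ler_wpM2l.
have x3 : x * x ^+ 2 <= x by rewrite -[leRHS]mulr1; apply: ler_wpM2l => //; exact: le_trans x1.
have b1 : B * x ^+ 2 <= `|B| * x.
  by apply: le_trans (ler_norm _) _; rewrite normrM (ger0_norm (sqr_ge0 _)); apply: ler_wpM2l.
have g1 : 0 <= G * x by apply: mulr_ge0.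
rewrite mulrCA !mulrDl.
move: b1 g1 x2 x3 r1; rewrite mul1r; move: (G * x) (B * x ^+ 2) (`|B| * x) (x * x ^+ 2) (x ^+ 2)
    => *.
lra.
Qed.

Local Notation mu := (@lebesgue_measure R).
Local Notation meas D f := (@measurable_fun _ _ (measurableTypeR R) R D f).
Variables (alpha : R) (e : bool -> R).
Hypotheses (halpha : 0 < alpha < pi) (he : core_energy alpha e).

Lemma H1_cst (c : R) : H1 (cst c : R -> R).
Proof. by apply/H1P; exists (cst 0); [exact: prim_cst|apply: cont11_L2; apply: cont11_continuous;
    exact: cst_continuous]. Qed.

(** For each small eps take a lifting from recovery; for the other eps any
    admissible constant will do. *)
Lemma energy_upper_bound (phi0 : R -> R) (N : nat) (a : 'I_N -> R) (d : 'I_N -> bool) :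
  simple alpha phi0 -> normalised_start alpha phi0 -> transition_profile alpha phi0 a d ->
  exists phi : R -> R -> R, [/\ admissible_family alpha phi, L2_converges phi phi0 &
    exists2 r : R -> R, remainder r & \forall eps \near (0 : R)^'+,
      (energy_lift alpha eps (phi eps) <=
        (eta_jumps alpha phi0 / logdelta eps
          + (\sum_(n < N) e (d n) + W alpha a d) / logdelta eps ^+ 2 + r eps)%:E)%E].
Proof.
move=> [hPhi _] nstart prof.
have [c [w [rep fst hj]]] := profile_step halpha hPhi prof.
have [oa js _] := rep; have [[fi _] fpm] := hPhi.
rewrite (eta_jumps_simple halpha rep hj).
have cstart : c = alpha \/ c = - alpha.
  by case: nstart => h; [left|right]; rewrite -(right_limit_step oa fst h).
have [r1 /remainderP hr1 hinf] := he d oa.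
set G := \sum_(n < N) _ in hinf *; set B := W alpha a d + _ in hinf.
pose v eps := pi * G / (2 * logdelta eps) + B / logdelta eps ^+ 2 + r1 eps.
(* How far the chosen m may be from the infimum; this is o(1/l^2). *)
pose t eps : R := (logdelta eps)^-1 / logdelta eps ^+ 2.
have ex eps : exists phi : R -> R, [/\ H1 phi, phi (-1) = alpha \/ phi (-1) = - alpha, in_2piZ_pm
    alpha (phi 1) &
   0 < eps -> inf_energy alpha eps a d = (v eps)%:E -> 0 < logdelta eps ->
   (energy_lift alpha eps phi <= (v eps + t eps)%:E)%E /\
    forall lam : R, 0 < lam -> (sqint (fun x => (phi x - phi0 x)%R) <=
       (8 * lam + 8 * pi / lam * (v eps + t eps))%:E)%E].
  have [[eps0 [vE l0]]|no] := pselect (0 < eps /\ inf_energy alpha eps a d = (v eps)%:E /\ 0 <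
      logdelta eps).
    have t0 : 0 < t eps by apply: mulr_gt0; rewrite invr_gt0 ?exprn_gt0.
    have [phi [h1 h2 h3 h4 h5]] := recovery halpha oa (intI_measurable fi) fst fpm hj eps0 vE t0.
    by exists phi; split => //; rewrite h2.
  exists (cst alpha); split.
  - exact: H1_cst.
  - by left.
  - by left; exists 0; rewrite mulr0 add0r.
  - by move=> h1 h2 h3; exfalso; apply: no.
have [phi hphi] := choice ex.
have near0 : \forall eps \near (0 : R)^'+, 0 < eps by exact: nbhs_right_gt.
have good : \forall eps \near (0 : R)^'+,
   (energy_lift alpha eps (phi eps) <= (v eps + t eps)%:E)%E /\
    forall lam : R, 0 < lam -> (sqint (fun x => (phi eps x - phi0 x)%R) <=
       (8 * lam + 8 * pi / lam * (v eps + t eps))%:E)%E.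
  apply: filterS3 near0 hinf (near_logdelta_ge 1) => eps eps0 vE l1.
  by have [_ _ _ h] := hphi eps; apply: h => //; exact: lt_le_trans l1.
exists phi; split.
- by move=> eps eps0; have [h1 h2 h3 _] := hphi eps.
- apply/L2_convergesP => c1 c10.
  have pi0 := pi_gt0 R.
  (* This makes the first term 8 * lam of lifting_distance equal to c1 / 4. *)
  pose lam := c1 / 32; have lam0 : 0 < lam by apply: divr_gt0.
  pose K := 8 * pi / lam; have K0 : 0 < K by apply: divr_gt0 => //; exact: mulr_gt0.
  have G0 : 0 <= pi * G.
    by apply: mulr_ge0; [exact: ltW|apply: sumr_ge0 => n _; exact: sqr_ge0].
  pose D := pi * G + `|B| + 2; have D0 : 0 < D by rewrite /D; have := normr_ge0 B; lra.
  apply: filterS3 good (hr1 1 ltr01) (filterI (near_logdelta_ge 1) (near_logdelta_ge (2 * K * D /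
      c1))).
  move=> eps [_ /(_ lam lam0) h] hr [l1 l2]; apply: le_lt_trans h _.
  rewrite lte_fin -/K.
  have vt : v eps + t eps <= D / logdelta eps.
    by rewrite /v /t /D; exact: inv_log_bound.
  have l0 : 0 < logdelta eps by exact: lt_le_trans l1.
  have : K * (v eps + t eps) <= K * (D / logdelta eps) by apply: ler_wpM2l => //; exact: ltW.
  have : K * (D / logdelta eps) <= c1 / 2.
    rewrite mulrA ler_pdivrMr//; move: l2; rewrite ler_pdivrMr//; lra.
  by rewrite /lam; lra.
- exists (fun eps => r1 eps + t eps).
    apply/remainderP => c1 c10; have c20 : 0 < c1 / 2 by apply: divr_gt0.
    apply: filterS2 (hr1 _ c20) (near_logdelta_ge (2 / c1 + 1)) => eps h l1.
    have l0 : 0 < logdelta eps by apply: lt_le_trans l1; apply: ltr_wpDl => //; apply: divr_ge0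
        => //; exact: ltW.
    have q0 : 0 <= (logdelta eps ^+ 2)^-1 by rewrite invr_ge0 sqr_ge0.
    apply: le_trans (ler_normD _ _) _.
    have t1 : `|t eps| <= c1 / 2 / logdelta eps ^+ 2.
      rewrite /t ger0_norm; last by apply: mulr_ge0 => //; rewrite invr_ge0 ltW.
      apply: ler_wpM2r => //; rewrite -[c1 / 2]invrK lef_pV2 ?posrE ?invr_gt0// invf_div; lra.
    by rewrite (mulrAC c1) in h t1; lra.
  apply: filterS good => eps [h _]; apply: le_trans h _; rewrite lee_fin le_eqVlt.
  apply/orP; left; apply/eqP; rewrite /v /B (invfM 2); ring.
Qed.

End UpperBoundFamily.

Theorem corollary5 (R : realType) (alpha : R) (e : bool -> R)
    (halpha : 0 < alpha < pi) (he : core_energy alpha e) :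
  (forall (phi : R -> R -> R) (phi0 : R -> R) (N : nat)
      (a : 'I_N -> R) (d : 'I_N -> bool),
    admissible_family alpha phi ->
    simple alpha phi0 ->
    L2_converges phi phi0 ->
    transition_profile alpha phi0 a d ->
    N = iota_jumps alpha phi0 ->
    exists2 r : R -> R, remainder r &
      \forall eps \near (0 : R)^'+,
        ((eta_jumps alpha phi0 / logdelta eps
          + (\sum_(n < N) e (d n) + W alpha a d) / logdelta eps ^+ 2
          - r eps)%:E <= energy_lift alpha eps (phi eps))%E)
  /\
  (forall (phi0 : R -> R) (N : nat) (a : 'I_N -> R) (d : 'I_N -> bool),
    simple alpha phi0 ->
    normalised_start alpha phi0 ->
    transition_profile alpha phi0 a d ->
    N = iota_jumps alpha phi0 ->
    exists phi : R -> R -> R,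
      [/\ admissible_family alpha phi,
          L2_converges phi phi0 &
          exists2 r : R -> R, remainder r &
            \forall eps \near (0 : R)^'+,
              (energy_lift alpha eps (phi eps) <=
               (eta_jumps alpha phi0 / logdelta eps
                + (\sum_(n < N) e (d n) + W alpha a d) / logdelta eps ^+ 2
                + r eps)%:E)%E]).
Proof.
split=> [phi phi0 N a d adm simp conv prof _|phi0 N a d simp start prof _].
  exact: energy_lower_bound.
exact: energy_upper_bound.
Qed.
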